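(* Let $\mathcal{W}=(w_n)_{n\in\mathbb{N}}$ be a weight function system on $\mathbb{R}^d$ satisfying $(\mathrm{wM})$: for every $n\in\mathbb{N}$ there exist $m\ge n$ and $C>0$ such that $w_n(x+y)\le C w_m(x)$ for all $x\in\mathbb{R}^d$ and $|y|\le 1$. The following statements are equivalent: (i) $\mathcal{W}$ satisfies $(\mathrm{N})$: for every $n\in\mathbb{N}$ there exists $m\ge n$ such that $w_n/w_m\in L^1(\mathbb{R}^d)$. (ii) $E^\infty_{\mathcal{W}}=F^\infty_{\mathcal{W}}$ as sets for any two solid TIBFs of bounded type $E,F$ on $\mathbb{R}^d$. (iii) $E^\infty_{\mathcal{W}}=F^\infty_{\mathcal{W}}$ as Fréchet spaces for any two solid TIBFs of bounded type $E,F$ on $\mathbb{R}^d$. (iv) $\mathcal{K}^1_{\mathcal{W}}=\mathcal{B}_{\mathcal{W}}$ as sets. (v) $\mathcal{K}^1_{\mathcal{W}}=\mathcal{B}_{\mathcal{W}}$ as Fréchet spaces.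
   Context: $\mathbb{N}=\{0,1,2,\dots\}$; $\mathcal{D}'$ is the space of distributions on $\mathbb{R}^d$; $T_xf(t)=f(t-x)$. Solid TIBF of bounded type: a Banach space $(E,\|\cdot\|_E)$ is a translation-invariant Banach function space (TIBF) of bounded type on $\mathbb{R}^d$ if $E$ is non-trivial, $E\subseteq L^1_{\mathrm{loc}}(\mathbb{R}^d)$ continuously, and: (A.1) $T_xE\subseteq E$ for all $x\in\mathbb{R}^d$; (A.2) there is $C_0>0$ with $\|T_xf\|_E\le C_0\|f\|_E$ for all $x\in\mathbb{R}^d$, $f\in E$; (A.3) $E$ is a Banach module over $L^1(\mathbb{R}^d)$ under convolution ($\|f*\varphi\|_E\le\|f\|_E\|\varphi\|_{L^1}$). It is solid if $f\in E$, $g\in L^1_{\mathrm{loc}}(\mathbb{R}^d)$ and $|g|\le|f|$ a.e. imply $g\in E$ and $\|g\|_E\le\|f\|_E$. A weight function is a locally bounded measurable function $\mathbb{R}^d\to[1,\infty)$; a weight function system is a sequence $\mathcal{W}=(w_n)_{n\in\mathbb{N}}$ of weight functions with $w_n\le w_{n+1}$ for all $n$. For $n\in\mathbb{N}$ and a weight function $\omega$, $E^n_\omega:=\{f\in\mathcal{D}' : f^{(\alpha)}\omega\in E \text{ for all } |\alpha|\le n\}$ (meaning the distributional derivative $f^{(\alpha)}$ is in $L^1_{\mathrm{loc}}$ and $f^{(\alpha)}\omega\in E$), with norm $\max_{|\alpha|\le n}\|f^{(\alpha)}\omega\|_E$. Then $E^\infty_{\mathcal{W}}:=\bigcap_{n\in\mathbb{N}}E^n_{w_n}$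 with its projective limit Fréchet topology. $\mathcal{K}^1_{\mathcal{W}}:=(L^1)^\infty_{\mathcal{W}}$ and $\mathcal{B}_{\mathcal{W}}:=(L^\infty)^\infty_{\mathcal{W}}$. *)

(* Defs.v *)
From HB Require Import structures.
From mathcomp Require Import all_boot all_order all_algebra.
From mathcomp Require Import complex.
From mathcomp Require Import all_classical all_reals all_analysis.

Set Implicit Arguments.
Unset Strict Implicit.
Unset Printing Implicit Defensive.

Import Order.TTheory GRing.Theory Num.Theory.
Import numFieldNormedType.Exports.
Import ComplexField.Normc.

Local Open Scope classical_set_scope.
Local Open Scope ring_scope.
Local Open Scope complex_scope.

(* R^d is 'rV[R]_d, with its library topology; the sigma-algebra is the product
   of the Borel sigma-algebras of the coordinates, i.e. the Borel one. *)

Definition rV_display : measure_display.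
Proof. exact: default_measure_display. Qed.

Section measurable_rV.
Context {R : realType} (n : nat).

Definition rV_coord (i : 'I_n) (v : 'rV[R]_n) : measurableTypeR R := v ord0 i.

Let rV_measurable0 : g_sigma_preimage rV_coord set0.
Proof. exact: sigma_algebra0. Qed.

Let rV_measurableC A :
  g_sigma_preimage rV_coord A -> g_sigma_preimage rV_coord (~` A).
Proof. exact: sigma_algebraC. Qed.

Let rV_measurable_bigcup (F : _^nat) :
  (forall i, g_sigma_preimage rV_coord (F i)) ->
  g_sigma_preimage rV_coord (\bigcup_i (F i)).
Proof. exact: sigma_algebra_bigcup. Qed.

HB.instance Definition _ := @isMeasurable.Build rV_display
  'rV[R]_n (g_sigma_preimage rV_coord)
  rV_measurable0 rV_measurableC rV_measurable_bigcup.

Lemma measurable_rV_coord (i : 'I_n) :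
  measurable_fun [set: 'rV[R]_n] (rV_coord i).
Proof.
move=> _ Y mY; rewrite setTI; apply: sub_sigma_algebra => /=.
rewrite -bigcup_seq/=; exists i => /=; first by rewrite mem_index_enum.
by exists Y => //; rewrite setTI.
Qed.

Lemma measurable_fun_rV d (T : measurableType d) (f : T -> 'rV[R]_n) :
  (forall i, measurable_fun [set: T] (rV_coord i \o f)) ->
  measurable_fun [set: T] f.
Proof.
move=> mf.
have sub : g_sigma_preimage (fun i => rV_coord i \o f) `<=` measurable.
  apply: smallest_sub; first exact: sigma_algebra_measurable.
  rewrite -bigcup_seq => B [i _ [A mA <-]].
  exact: mf.
move=> _ A mA; apply: sub.
by rewrite g_sigma_preimage_comp; exists A.
Qed.

End measurable_rV.

(* Lebesgue measure on R^d, as the iterated product of the Lebesgue measure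
   on R. *)
Section lebesgue_rV.
Context {R : realType}.

Definition rV_cons n (p : measurableTypeR R * 'rV[R]_n) : 'rV[R]_n.+1 :=
  row_mx (p.1%:M : 'rV[R]_1) p.2.

Definition rV_uncons n (v : 'rV[R]_n.+1) : measurableTypeR R * 'rV[R]_n :=
  (v ord0 ord0, @rsubmx R 1 1 n v).

Lemma rV_consK n : cancel (@rV_cons n) (@rV_uncons n).
Proof.
move=> [x v]; rewrite /rV_cons /rV_uncons /=; congr (_, _).
  rewrite (_ : ord0 = lshift n (ord0 : 'I_1)); last exact/val_inj.
  by rewrite (@row_mxEl _ 1 1 n) mxE.
exact: row_mxKr.
Qed.

Lemma measurable_rV_cons n :
  measurable_fun [set: measurableTypeR R * 'rV[R]_n] (@rV_cons n).
Proof.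
apply: measurable_fun_rV => i.
case: (splitP (i : 'I_(1 + n))) => j ij.
- rewrite (_ : _ \o _ = fst); first exact: measurable_fst.
  apply/funext => -[x v] /=; rewrite /rV_coord /rV_cons.
  rewrite (_ : i = lshift n j); last exact/val_inj.
  by rewrite (@row_mxEl _ 1 1 n) mxE [j]ord1.
- rewrite (_ : _ \o _ = rV_coord j \o snd).
    exact: measurableT_comp (measurable_rV_coord j) measurable_snd.
  apply/funext => -[x v] /=; rewrite /rV_coord /rV_cons.
  rewrite (_ : i = rshift 1 j); last exact/val_inj.
  by rewrite (@row_mxEr _ 1 1 n).
Qed.

Lemma measurable_rV_uncons n :
  measurable_fun [set: 'rV[R]_n.+1] (@rV_uncons n).
Proof.
apply/measurable_fun_pairP; split; first exact: measurable_rV_coord.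
apply: measurable_fun_rV => i.
rewrite (_ : _ \o _ = rV_coord (rshift 1 i)); first exact: measurable_rV_coord.
by apply/funext => v; rewrite /rV_coord /rV_uncons /= mxE.
Qed.

Section lebesgue_cons.
Variables (n : nat) (mu : {sigma_finite_measure set 'rV[R]_n -> \bar R}).

Definition lebesgue_cons : set 'rV[R]_n.+1 -> \bar R :=
  pushforward (@lebesgue_measure R \x mu)%E (@rV_cons n).

Let lebesgue_cons0 : lebesgue_cons set0 = 0%E.
Proof. by rewrite /lebesgue_cons /pushforward preimage_set0 measure0. Qed.

Let lebesgue_cons_ge0 A : (0 <= lebesgue_cons A)%E.
Proof. exact: (measure_ge0 (@lebesgue_measure R \x mu)%E). Qed.

Let lebesgue_cons_sigma_additive : semi_sigma_additive lebesgue_cons.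
Proof.
move=> F mF tF mUF; rewrite /lebesgue_cons /pushforward preimage_bigcup.
have mc A : measurable A -> measurable (@rV_cons n @^-1` A).
  by move=> mA; rewrite -[X in measurable X]setTI; exact: measurable_rV_cons.
apply: measure_semi_sigma_additive.
- by move=> k; exact: mc.
- apply/trivIsetP => /= i j _ _ ij; rewrite -preimage_setI.
  by move/trivIsetP : tF => /(_ _ _ _ _ ij) ->//; rewrite preimage_set0.
- by rewrite -preimage_bigcup; exact: mc.
Qed.

Let lebesgue_cons_sigma_finite : sigma_finite setT lebesgue_cons.
Proof.
have /sigma_finiteP[F [TF ndF Foo]] := sigma_finiteT (@lebesgue_measure R).
have /sigma_finiteP[G [TG ndG Goo]] := sigma_finiteT mu.
exists (fun k => @rV_uncons n @^-1` (F k `*` G k)).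
  rewrite -preimage_bigcup; apply/esym/seteqP; split => // v _.
  have [i _ Fi] : (\bigcup_i F i) (rV_uncons v).1 by rewrite -TF.
  have [j _ Gj] : (\bigcup_i G i) (rV_uncons v).2 by rewrite -TG.
  exists (maxn i j) => //; split.
  - by move/subsetPset: (ndF _ _ (leq_maxl i j)); exact.
  - by move/subsetPset: (ndG _ _ (leq_maxr i j)); exact.
move=> k; have [mF Foo'] := Foo k; have [mG Goo'] := Goo k; split.
  rewrite -[X in measurable X]setTI.
  by apply: measurable_rV_uncons => //; exact: measurableX.
rewrite /lebesgue_cons /pushforward -comp_preimage.
rewrite (_ : _ \o _ = id); last by apply/funext => p /=; rewrite rV_consK.
by rewrite preimage_id product_measure1E// lte_mul_pinfty// ge0_fin_numE.
Qed.

HB.instance Definition _ := isMeasure.Build _ _ _ lebesgue_cons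
  lebesgue_cons0 lebesgue_cons_ge0 lebesgue_cons_sigma_additive.
HB.instance Definition _ := Measure_isSigmaFinite.Build _ _ _ lebesgue_cons
  lebesgue_cons_sigma_finite.

End lebesgue_cons.

Fixpoint lebesgue_rV (n : nat) :
    {sigma_finite_measure set 'rV[R]_n -> \bar R} :=
  match n with
  | 0 => \d_(0 : 'rV[R]_0)
  | n'.+1 => lebesgue_cons (lebesgue_rV n')
  end.

End lebesgue_rV.

Section functions.
Context {R : realType} {d : nat}.
Local Notation X := 'rV[R]_d.
Local Notation mu := (@lebesgue_rV R d).

(* Lebesgue (not only Borel) measurability. The library's integral is a
   difference of suprema of integrals of Borel simple functions, so it also
   returns the Lebesgue integral of such functions. *)
Definition lmeasurable (f : X -> R) : Prop :=
  exists2 g : X -> R, measurable_fun [set: X] g & \forall x \ae mu, f x = g x.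

Definition cmeasurable (f : X -> R[i]) : Prop :=
  lmeasurable (@complex.Re R \o f) /\ lmeasurable (@complex.Im R \o f).

Definition cintegral (f : X -> R[i]) : R[i] :=
  (\int[mu]_x complex.Re (f x)) +i* (\int[mu]_x complex.Im (f x)).

Definition translate (x : X) (f : X -> R[i]) : X -> R[i] := fun t => f (t - x).

(* For f in a space satisfying [tibf_translate_bounded] and [tibf_embedding] and
   g in L^1, this integral converges absolutely for almost every x. *)
Definition convolution (f g : X -> R[i]) : X -> R[i] :=
  fun x => cintegral (fun y => f (x - y) * g y).

Definition L1loc : set (X -> R[i]) :=
  [set f | cmeasurable f /\ forall K : set X, compact K ->
    (\int[mu]_(x in K) (normc (f x))%:E < +oo)%E].

(* A space of functions modulo a.e. equality is represented by the set of all
   representatives of its elements and by its norm, see [tibf_ae] below. *)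
Record normed_fspace := NormedFspace {
  fcarrier :> (X -> R[i]) -> Prop ;
  fnorm : (X -> R[i]) -> R }.

Definition Lp_space (p : \bar R) : normed_fspace := {|
  fcarrier := [set f | cmeasurable f /\
    ('N[mu]_p[(fun x => (normc (f x))%:E)] < +oo)%E] ;
  fnorm := fun f => fine 'N[mu]_p[(fun x => (normc (f x))%:E)] |}.

Record TIBF_bounded_type (E : normed_fspace) : Prop := {
  tibf_sub : E `<=` L1loc ;
  tibf_ae : forall f g, E f -> (\forall x \ae mu, g x = f x) ->
    E g /\ fnorm E g = fnorm E f ;
  tibf_zero : E (fun=> 0) ;
  tibf_add : forall f g, E f -> E g -> E (fun x => f x + g x) ;
  tibf_scale : forall (a : R[i]) f, E f -> E (fun x => a * f x) ;
  tibf_norm_ge0 : forall f, E f -> 0 <= fnorm E f ;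
  tibf_norm_eq0 : forall f, E f -> fnorm E f = 0 -> \forall x \ae mu, f x = 0 ;
  tibf_norm_add : forall f g, E f -> E g ->
    fnorm E (fun x => f x + g x) <= fnorm E f + fnorm E g ;
  tibf_norm_scale : forall (a : R[i]) f, E f ->
    fnorm E (fun x => a * f x) = normc a * fnorm E f ;
  tibf_complete : forall u : nat -> X -> R[i], (forall n, E (u n)) ->
    (forall e : R, 0 < e -> exists N, forall m n, (N <= m)%N -> (N <= n)%N ->
      fnorm E (fun x => u m x - u n x) < e) ->
    exists2 f, E f & fnorm E (fun x => u n x - f x) @[n --> \oo] --> (0 : R) ;
  tibf_nontrivial : exists2 f, E f & ~ (\forall x \ae mu, f x = 0) ;
  tibf_embedding : forall K : set X, compact K -> exists C : R,
    forall f, E f -> (\int[mu]_(x in K) (normc (f x))%:E <= (C * fnorm E f)%:E)%E ;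
  tibf_translate : forall x f, E f -> E (translate x f) ;
  tibf_translate_bounded : exists2 C0 : R, 0 < C0 &
    forall x f, E f -> fnorm E (translate x f) <= C0 * fnorm E f ;
  tibf_convolution : forall f phi, E f -> Lp_space 1 phi ->
    E (convolution f phi) /\
    fnorm E (convolution f phi) <= fnorm E f * fnorm (Lp_space 1) phi }.

Definition solid (E : normed_fspace) : Prop :=
  forall f g, E f -> L1loc g ->
    (\forall x \ae mu, normc (g x) <= normc (f x)) ->
    E g /\ fnorm E g <= fnorm E f.

Definition solid_TIBF_bounded_type (E : normed_fspace) : Prop :=
  TIBF_bounded_type E /\ solid E.

End functions.

Arguments normed_fspace R d : clear implicits.
Arguments Lp_space R d p : clear implicits.

Section test_functions.
Context {R : realType} {d : nat}.
Local Notation X := 'rV[R]_d.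

Definition rpderiv (i : 'I_d) (f : X -> R) : X -> R :=
  fun x => 'D_(delta_mx ord0 i) f x.

Definition rsmooth (f : X -> R) : Prop :=
  forall s : seq 'I_d, let g := foldr rpderiv f s in
    continuous g /\ forall i x, derivable g x (delta_mx ord0 i).

Definition pderiv (i : 'I_d) (f : X -> R[i]) : X -> R[i] :=
  fun x => rpderiv i (@complex.Re R \o f) x +i* rpderiv i (@complex.Im R \o f) x.

Definition smooth (f : X -> R[i]) : Prop :=
  rsmooth (@complex.Re R \o f) /\ rsmooth (@complex.Im R \o f).

Definition csupport (f : X -> R[i]) : set X := closure [set x | f x != 0].

Record testfun := Testfun {
  tf_val :> X -> R[i] ;
  tf_smooth : smooth tf_val ;
  tf_compact : compact (csupport tf_val) }.

Lemma rsmooth_rpderiv i f : rsmooth f -> rsmooth (rpderiv i f).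
Proof. by move=> sf s; have := sf (rcons s i); rewrite foldr_rcons. Qed.

Lemma rpderiv_near0 i (f : X -> R) x :
  (\forall y \near x, f y = 0) -> rpderiv i f x = 0.
Proof.
move=> fx0; rewrite /rpderiv.
have -> : 'D_(delta_mx ord0 i) f x = 'D_(delta_mx ord0 i) (cst (0 : R)) x.
  exact: near_eq_derive.
exact: derive_cst.
Qed.

Lemma pderiv_smooth i f : smooth f -> smooth (pderiv i f).
Proof. by move=> [? ?]; split; exact: rsmooth_rpderiv. Qed.

Lemma csupport_pderiv i f : csupport (pderiv i f) `<=` csupport f.
Proof.
rewrite [X in _ `<=` X](iffLR (closure_id _) (@closed_closure _ _)).
apply: closureS => x /=; apply: contraPP => Nx.
have {}Nx : \forall y \near x, f y = 0.
  have : nbhs x (~` csupport f).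
    apply: open_nbhs_nbhs; split => //.
    by apply: closed_openC; exact: closed_closure.
  apply: filterS => y /= Ny; apply: contrapT => /eqP fy0.
  by apply: Ny; exact: subset_closure.
apply/negP; rewrite negbK; apply/eqP; rewrite /pderiv.
by rewrite !rpderiv_near0//; apply: filterS Nx => y /= ->.
Qed.

Lemma pderiv_compact i f : compact (csupport f) -> compact (csupport (pderiv i f)).
Proof.
move=> cf; apply: subclosed_compact cf _; first exact: closed_closure.
exact: csupport_pderiv.
Qed.

Definition tf_pderiv (i : 'I_d) (phi : testfun) : testfun :=
  Testfun (pderiv_smooth i (tf_smooth phi)) (@pderiv_compact i phi (@tf_compact phi)).

(* The multi-indices alpha with |alpha| <= n are the alpha : mindex n such that
   (mdeg alpha <= n)%N. *)
Definition mindex (n : nat) := {ffun 'I_d -> 'I_n.+1}.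

Definition mdeg n (alpha : mindex n) : nat := (\sum_i alpha i)%N.

Definition tf_mderiv n (alpha : mindex n) (phi : testfun) : testfun :=
  foldr (fun i => iter (alpha i) (tf_pderiv i)) phi (enum 'I_d).

End test_functions.

Arguments testfun R d : clear implicits.
Arguments mindex d n : clear implicits.

Section distributions.
Context {R : realType} {d : nat}.
Local Notation X := 'rV[R]_d.

Definition functional := testfun R d -> R[i].

Definition distribution (f : functional) : Prop :=
  (forall (a : R[i]) (phi psi chi : testfun R d),
     (forall x, chi x = a * phi x + psi x) -> f chi = a * f phi + f psi) /\
  (forall K : set X, compact K -> exists (C : R) (N : nat),
     forall phi : testfun R d, csupport phi `<=` K ->
     normc (f phi) <= C * \sum_(alpha : mindex d N | (mdeg alpha <= N)%N)
       sup (range (fun x => normc (tf_mderiv alpha phi x)))).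

Definition dderiv n (alpha : mindex d n) (f : functional) : functional :=
  fun phi => (-1) ^+ mdeg alpha * f (tf_mderiv alpha phi).

Definition regular (g : X -> R[i]) : functional :=
  fun phi => cintegral (fun x => g x * phi x).

(* A locally integrable function representing f, if there is one; it is unique
   up to a.e. equality. *)
Definition density (f : functional) : X -> R[i] :=
  xget (fun=> 0) [set g | L1loc g /\ f = regular g].

Definition mul_weight (g : X -> R[i]) (w : X -> R) : X -> R[i] :=
  fun x => g x * (w x)%:C.

Definition EnW (E : normed_fspace R d) (n : nat) (w : X -> R) : set functional :=
  [set f | distribution f /\
    forall alpha : mindex d n, (mdeg alpha <= n)%N ->
      exists g, [/\ L1loc g, dderiv alpha f = regular g & E (mul_weight g w)]].

Definition EnW_norm (E : normed_fspace R d) (n : nat) (w : X -> R)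
    (f : functional) : R :=
  \big[Num.max/0]_(alpha : mindex d n | (mdeg alpha <= n)%N)
    fnorm E (mul_weight (density (dderiv alpha f)) w).

Definition EinfW (E : normed_fspace R d) (W : nat -> X -> R) : set functional :=
  \bigcap_n EnW E n (W n).

(* The open sets of the projective limit topology, i.e. the coarsest topology
   making all the inclusions of EinfW E W into EnW E n (W n) continuous. *)
Definition EinfW_open (E : normed_fspace R d) (W : nat -> X -> R) :
    set (set functional) :=
  [set U | U `<=` EinfW E W /\
    forall f, U f -> exists (N : nat) (e : R), 0 < e /\
      forall g, EinfW E W g ->
        (forall n, (n <= N)%N ->
           EnW_norm E n (W n) (fun phi => g phi - f phi) < e) ->
        U g].

Definition eq_Frechet (E F : normed_fspace R d) (W : nat -> X -> R) : Prop :=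
  EinfW E W = EinfW F W /\ EinfW_open E W = EinfW_open F W.

End distributions.

Section weights.
Context {R : realType} {d : nat}.
Local Notation X := 'rV[R]_d.

Definition weight_function (w : X -> R) : Prop :=
  [/\ lmeasurable w, forall x, 1 <= w x &
      forall x : X, exists M : R, \forall y \near x, w y <= M].

Definition weight_function_system (W : nat -> X -> R) : Prop :=
  (forall n, weight_function (W n)) /\ (forall n x, W n x <= W n.+1 x).

(* The library norm on 'rV[R]_d is the sup norm. *)
Definition euclidean_norm (x : X) : R := Num.sqrt (\sum_i x ord0 i ^+ 2).

Definition condition_wM (W : nat -> X -> R) : Prop :=
  forall n, exists m, (n <= m)%N /\ exists2 C : R, 0 < C &
    forall x y, euclidean_norm y <= 1 -> W n (x + y) <= C * W m x.

Definition condition_N (W : nat -> X -> R) : Prop :=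
  forall n, exists2 m, (n <= m)%N &
    Lp_space R d 1 (fun x => (W n x / W m x)%:C).

End weights.

(* Main.v *)
(* If (N) holds, both E^oo_W and F^oo_W are the space of those f whose derivatives
   are all bounded after multiplication by each w_n, with equivalent systems of
   norms. For f in E^oo_W, each derivative of f is a finite sum of convolutions of
   derivatives of f with bounded kernels supported in a small box; the embedding of
   E in L^1_loc, uniform under translations, and (wM) bound these convolutions, after
   multiplication by w_n, by the norm of E^m_(w_m). Conversely, (N), (wM) and
   solidity give w_n / w_m in E for some m, so that if h w_m is bounded then h w_n is
   in E.

   If (N) fails at n, there is g >= 0 such that g w_k is bounded for every k while
   g w_n is not integrable: take 1 / w_(n+m) on the m-th of a sequence of large
   disjoint annuli. Convolving g with a bump function yields an element of B_W which
   is not in K^1_W. Since L^1 and L^oo are solid TIBFs of bounded type, this closes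
   all the implications. *)

(* The sum of convolutions comes from u(0) = int_0^r (u(t)/r - (1 - t/r) u'(t)) dt, used in each of
   the d coordinates in turn: one term per set of differentiated coordinates, so d more derivatives
   are consumed and the kernels are bounded but not smooth. A distribution only meets test
   functions, so the identity is proved for these, transposed by Fubini, and returned to the weak
   derivatives by the du Bois-Reymond lemma; this is why smooth bumps, symmetry of mixed derivatives
   and differentiation under the integral sign are developed. Remainders are kept quadratic in the
   increment and uniform in the point, so that they survive integration. The averaging box has
   half-side 1/(d+1), which fits it into the Euclidean unit ball of (wM). Every comparison is an
   explicit estimate of the n-th norm of one space by the m-th norm of the other, so equality as
   sets and equality of topologies come from the same inequality. Elements of the spaces are only
   Lebesgue measurable: integrals are moved to Borel representatives before Tonelli or Fubini is
   used. *)
Require Import Defs.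
From HB Require Import structures.
From mathcomp Require Import all_boot all_order all_algebra.
From mathcomp Require Import complex.
From mathcomp Require Import all_classical all_reals all_analysis.
From mathcomp Require Import measurable_realfun ess_sup_inf ring lra.

Set Implicit Arguments.
Unset Strict Implicit.
Unset Printing Implicit Defensive.

Import Order.TTheory GRing.Theory Num.Theory.
Import numFieldNormedType.Exports.
Import ComplexField.Normc.

Local Open Scope classical_set_scope.
Local Open Scope ring_scope.
Local Open Scope complex_scope.

(** * Integration on R^d *)

Section integral_any.
Context d (T : measurableType d) (R : realType) (mu : {measure set T -> \bar R}).
Local Open Scope ereal_scope.
Implicit Types (f g : T -> \bar R) (D : set T).
Import HBNNSimple.

(* The library's integral is a supremum over simple functions, whence these
   lemmas hold without measurability assumptions. *)
Lemma ge0_le_integral_any D f g : (forall x, D x -> 0 <= f x) ->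
  (forall x, D x -> f x <= g x) -> \int[mu]_(x in D) f x <= \int[mu]_(x in D) g x.
Proof.
move=> f0 fg; have g0 x : D x -> 0 <= g x by move=> Dx; exact: le_trans (f0 _ Dx) (fg _ Dx).
rewrite !ge0_integralE//; apply: le_ereal_sup => _ [h hf <-]; exists h => //= x.
apply: le_trans (hf x) _; rewrite !patchE; case: ifPn => // /set_mem.
exact: fg.
Qed.

Lemma ge0_subset_integral_any D D' f : (forall x, D' x -> 0 <= f x) ->
  D `<=` D' -> \int[mu]_(x in D) f x <= \int[mu]_(x in D') f x.
Proof.
move=> f0 DD'; rewrite integral_mkcond [leRHS]integral_mkcond.
apply: ge0_le_integral_any => x _; rewrite !patchE; case: ifPn => //.
- by move=> /set_mem /DD'/f0.
- by move=> /set_mem /DD'/mem_set ->.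
- by move=> _; case: ifPn => // /set_mem; exact: f0.
Qed.

Let ae_le_integral_ge0 f g : (forall x, 0 <= f x) -> (forall x, 0 <= g x) ->
  (\forall x \ae mu, f x = g x) -> \int[mu]_x f x <= \int[mu]_x g x.
Proof.
move=> f0 g0 [N [mN N0 fgN]]; rewrite [leLHS]ge0_integralTE//.
apply: ge_ereal_sup => _ [h /= hf <-].
have mCN := measurableC mN.
pose h' := proj_nnsfun h mCN.
rewrite -(patch_setT (fun=> 0%R) h) -integral_nnsfun//.
rewrite (@ge0_ae_eq_integral _ _ _ _ _ _ (EFin \o h'))//=.
- apply: ge0_le_integral_any => x _ /=; first by rewrite lee_fin mulr_ge0.
  rewrite mindicE; case: (boolP (x \in ~` N)) => [/set_mem Nx|_]; last by rewrite mulr0.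
  rewrite mulr1; have -> : g x = f x by apply: contrapT => ?; apply: Nx; apply: fgN => /= /esym.
  exact: hf.
- exact/measurable_EFinP.
- exact/measurable_EFinP.
- by move=> x _; rewrite lee_fin.
- by move=> x _; rewrite lee_fin mulr_ge0.
- exists N; split => // x /=; apply: contra_notP => Nx _.
  by rewrite mindicE mem_set ?mulr1.
Qed.

Lemma integral_ae_any D f g : (\forall x \ae mu, f x = g x) ->
  \int[mu]_(x in D) f x = \int[mu]_(x in D) g x.
Proof.
move=> fg; rewrite integral_mkcond [RHS]integral_mkcond [LHS]integralE [RHS]integralE.
have H h1 h2 : (forall x, 0 <= h1 x) -> (forall x, 0 <= h2 x) ->
    (\forall x \ae mu, h1 x = h2 x) -> \int[mu]_x h1 x = \int[mu]_x h2 x.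
  move=> h10 h20 h12; apply/eqP; rewrite eq_le !ae_le_integral_ge0//.
  by apply: filterS h12 => x ->.
by congr (_ - _); apply: H => //; apply: filterS fg => x e;
  rewrite ?funeposE ?funenegE !patchE e.
Qed.

Lemma Rintegral_ae_any D (f g : T -> R) : (\forall x \ae mu, f x = g x) ->
  (\int[mu]_(x in D) f x)%R = (\int[mu]_(x in D) g x)%R.
Proof.
by move=> fg; congr fine; apply: integral_ae_any; apply: filterS fg => x ->.
Qed.

Lemma ae_le_integral_any D f g : (forall x, D x -> 0 <= f x) ->
  (forall x, D x -> 0 <= g x) -> (\forall x \ae mu, f x <= g x) ->
  \int[mu]_(x in D) f x <= \int[mu]_(x in D) g x.
Proof.
move=> f0 g0 fg; rewrite (@integral_ae_any D f (fun x => mine (f x) (g x))).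
  apply: ge0_le_integral_any => x Dx; first by rewrite le_min f0// g0.
  by rewrite ge_min lexx orbT.
by apply: filterS fg => x fg; rewrite min_l.
Qed.

End integral_any.

(** * Tonelli and reflections for Lebesgue measure on R^d *)

Section lebesgue_rV_theory.
Context {R : realType}.
Local Notation mu n := (@lebesgue_rV R n).

Lemma measurable_rV_entry n (i : 'I_n) :
  measurable_fun [set: 'rV[R]_n] (fun v => v ord0 i : R).
Proof. exact: measurable_rV_coord. Qed.

Lemma measurable_to_rV d (T : measurableType d) n (f : T -> 'rV[R]_n) :
  (forall i, measurable_fun [set: T] (fun t => f t ord0 i : R)) ->
  measurable_fun [set: T] f.
Proof. by move=> mf; apply: measurable_fun_rV => i; exact: mf. Qed.

Lemma measurable_rV_sub d (T : measurableType d) n (f g : T -> 'rV[R]_n) :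
  measurable_fun [set: T] f -> measurable_fun [set: T] g ->
  measurable_fun [set: T] (fun t => f t - g t).
Proof.
move=> mf mg; apply: measurable_to_rV => i.
under eq_fun do rewrite !mxE.
by apply: measurable_funB;
  [exact: measurableT_comp (measurable_rV_entry i) mf|
   exact: measurableT_comp (measurable_rV_entry i) mg].
Qed.

Lemma measurable_rV_add d (T : measurableType d) n (f g : T -> 'rV[R]_n) :
  measurable_fun [set: T] f -> measurable_fun [set: T] g ->
  measurable_fun [set: T] (fun t => f t + g t).
Proof.
move=> mf mg; apply: measurable_to_rV => i.
under eq_fun do rewrite !mxE.
by apply: measurable_funD;
  [exact: measurableT_comp (measurable_rV_entry i) mf|
   exact: measurableT_comp (measurable_rV_entry i) mg].
Qed.

Lemma ge0_integral_rVS n (f : 'rV[R]_n.+1 -> \bar R) :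
  measurable_fun [set: 'rV[R]_n.+1] f -> (forall x, 0 <= f x)%E ->
  (\int[mu n.+1]_x f x =
   \int[lebesgue_measure]_t \int[mu n]_v f (rV_cons (t, v)))%E.
Proof.
move=> mf f0.
have -> : (\int[mu n.+1]_x f x = \int[lebesgue_measure \x mu n]_p f (rV_cons p))%E.
  have := @ge0_integral_pushforward _ _ _ _ R _ (@measurable_rV_cons R n)
    (lebesgue_measure \x mu n)%E setT f measurableT mf (fun x _ => f0 x).
  by rewrite preimage_setT.
have mfc : measurable_fun setT (f \o @rV_cons R n).
  exact: measurableT_comp mf (@measurable_rV_cons R n).
by rewrite (fubini_tonelli1 (f \o @rV_cons R n))//= => x; exact: f0.
Qed.

(** Reflections are the basic symmetry because convolution contains [f (x - y)]; translations are
    obtained later as products of two reflections. The push-forward under t -> c - t gives half-open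
    intervals their length, and Lebesgue measure is unique with this property. *)
Lemma ge0_integral_reflect1 (f : R -> \bar R) (c : R) :
  measurable_fun [set: R] f -> (forall x, 0 <= f x)%E ->
  (\int[lebesgue_measure]_t f (c - t)%R = \int[lebesgue_measure]_t f t)%E.
Proof.
move=> mf f0.
have mphi : measurable_fun [set: measurableTypeR R] (fun t : R => c - t : measurableTypeR R).
  exact: measurable_funB.
have := @ge0_integral_pushforward _ _ _ _ R _ mphi
    lebesgue_measure setT f measurableT mf (fun x _ => f0 x).
rewrite preimage_setT => <-.
apply/esym/eq_measure_integral => A mA _.
apply: lebesgue_measure_unique => // _ [[a b]] _ <-.
rewrite /pushforward /=.
rewrite [X in _ = lebesgue_measure X](_ : _ = `[c - b, c - a[%classic); last first.
  by apply/seteqP; split => x /=; rewrite !in_itv/= => /andP[? ?]; apply/andP; split; lra.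
rewrite !lebesgue_measure_itv/= !lte_fin ltrD2l ltrN2.
by case: ifPn => // _; rewrite -!EFinD; congr EFin; ring.
Qed.

Lemma rV_consE0 n (t : R) (v : 'rV[R]_n) : rV_cons (t, v) ord0 ord0 = t.
Proof.
rewrite /rV_cons /= (_ : ord0 = lshift n (ord0 : 'I_1)); last exact/val_inj.
by rewrite (@row_mxEl _ 1 1 n) mxE eqxx mulr1n.
Qed.

Lemma rV_consES n (t : R) (v : 'rV[R]_n) (i : 'I_n) :
  rV_cons (t, v) ord0 (lift ord0 i) = v ord0 i.
Proof.
by rewrite /rV_cons /= (_ : lift ord0 i = rshift 1 i) ?(@row_mxEr _ 1 1 n)//; exact/val_inj.
Qed.

Lemma rV_consP n (u v : 'rV[R]_n.+1) : u ord0 ord0 = v ord0 ord0 ->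
  (forall i, u ord0 (lift ord0 i) = v ord0 (lift ord0 i)) -> u = v.
Proof. by move=> uv0 uvS; apply/rowP => i; case: (unliftP ord0 i) => [j|] ->. Qed.

Lemma ge0_integral_reflect n (c : 'rV[R]_n) (f : 'rV[R]_n -> \bar R) :
  measurable_fun [set: 'rV[R]_n] f -> (forall x, 0 <= f x)%E ->
  (\int[mu n]_x f (c - x)%R = \int[mu n]_x f x)%E.
Proof.
elim: n c f => [|n ih] c f mf f0.
  apply: eq_integral => x _; congr f.
  by apply/rowP => -[].
have mcf : measurable_fun [set: 'rV[R]_n.+1] (fun x => f (c - x)).
  by apply: measurableT_comp mf _; exact: measurable_rV_sub.
rewrite (ge0_integral_rVS mf f0) (ge0_integral_rVS mcf (fun x => f0 _)).
pose c' := @rsubmx R 1 1 n c; pose c0 := c ord0 ord0.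
have cE t v : c - rV_cons (t, v) = rV_cons (c0 - t, c' - v).
  apply: rV_consP => [|i]; rewrite ?rV_consE0 ?rV_consES [LHS]mxE [X in _ + X]mxE.
    by rewrite rV_consE0.
  rewrite rV_consES [RHS]mxE [X in _ = _ + X]mxE [X in _ = X + _]mxE.
  by congr (c _ _ - _); apply: ord_inj.
under eq_integral => t _.
  under eq_integral do rewrite cE.
  rewrite (ih _ (fun v => f (rV_cons (c0 - t, v)))); last 2 first.
  - apply: measurableT_comp mf _; apply: measurableT_comp (@measurable_rV_cons R n) _.
    exact: measurable_pair1.
  - by move=> x; exact: f0.
  over.
rewrite (@ge0_integral_reflect1 (fun t => \int[mu n]_v f (rV_cons (t, v)))%E)//.
- apply: (measurable_fun_fubini_tonelli_F (f \o @rV_cons R n)) => //=.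
  exact: measurableT_comp mf (@measurable_rV_cons R n).
- by move=> x; exact: integral_ge0.
Qed.

End lebesgue_rV_theory.

(** * Boxes, their measure, and Borel measurability of open and compact sets *)

Section lebesgue_rV_boxes.
Context {R : realType}.
Local Notation mu n := (@lebesgue_rV R n).

Lemma rV_norm_le n (x : 'rV[R]_n) (r : R) : 0 <= r ->
  (`|x| <= r) = [forall i, `|x ord0 i| <= r].
Proof.
move=> r0; rewrite [`|x|]mx_normrE; apply/bigmax_leP/forallP => /= [[_ H] i|H].
  exact: (H (ord0, i)).
by split => // -[i j] _ /=; rewrite (ord1 i).
Qed.

Lemma rV_entry_le n (x : 'rV[R]_n) i : `|x ord0 i| <= `|x|.
Proof.
by have := lexx `|x|; rewrite (@rV_norm_le _ x `|x|)// => /forallP.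
Qed.

(** For [0 <= r] this is the closed ball of the sup norm; the coordinatewise form makes it visibly a
    product, which suits the recursive definition of the measure. *)
Definition cbox n (r : R) : set 'rV[R]_n := [set x | forall i, `|x ord0 i| <= r].

Lemma measurable_forall_ord d (T : measurableType d) n (A : 'I_n -> set T) :
  (forall i, measurable (A i)) -> measurable [set x | forall i, A i x].
Proof.
move=> mA; rewrite (_ : mkset _ = ~` \bigcup_i ~` (A i)).
  apply: measurableC; apply: countable_bigcupT_measurable; first exact: countableP.
  by move=> i; exact: measurableC.
rewrite setC_bigcup; apply/seteqP; split => [x /= xA i _|x /= xA i].
  by rewrite setCK.
by have := xA i I; rewrite setCK.
Qed.

Lemma measurable_cbox n r : measurable (@cbox n r).
Proof.
apply: (@measurable_forall_ord _ _ _ (fun i => [set x : 'rV[R]_n | `|x ord0 i| <= r])) => i.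
rewrite (_ : mkset _ = (fun v : 'rV[R]_n => v ord0 i : measurableTypeR R) @^-1` `[- r, r]).
  rewrite -[X in measurable X]setTI.
  exact: (@measurable_rV_entry R n i measurableT _ (measurable_itv _)).
by apply/seteqP; split => x /=; rewrite in_itv/= ler_norml.
Qed.

Lemma compact_cbox n r : compact (@cbox n r).
Proof.
rewrite (_ : cbox r = [set v : 'rV[R]_n | forall i, `[- r, r]%classic (v ord0 i)]).
  by apply: (@rV_compact _ _ (fun=> `[- r, r]%classic)) => _; exact: segment_compact.
by apply/seteqP; split => x /= H i; have := H i; rewrite in_itv/= ler_norml.
Qed.

Lemma compact_sub_cbox n (K : set 'rV[R]_n) : compact K ->
  exists2 r, 0 < r & K `<=` cbox r.
Proof.
move=> /compact_bounded[M [_ HM]]; exists (`|M| + 1); first by rewrite ltr_wpDl.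
move=> x Kx i; apply: le_trans (rV_entry_le _ _) _.
by apply: HM => //; rewrite ltr_pwDr// ler_norm.
Qed.

Lemma lebesgue_cbox n r : 0 <= r -> mu n (cbox r) = ((r *+ 2) ^+ n)%:E.
Proof.
move=> r0; elim: n => [|n ih].
  by rewrite /= diracE mem_set ?expr0// => -[].
rewrite /= /lebesgue_cons/= /pushforward.
rewrite (_ : _ @^-1` _ = `[- r, r] `*` @cbox n r).
  rewrite product_measure1E//; [|exact: measurable_cbox].
  rewrite ih exprS EFinM; congr (_ * _)%E.
  have := lebesgue_measure_itv `[- r, r]; rewrite /= lte_fin => ->; case: ifPn.
    by rewrite -EFinB opprK -mulr2n.
  by rewrite -leNgt => rr; have -> : r = 0; [lra|rewrite mul0rn].
apply/seteqP; split => [[t v]/= H|[t v]/= [tr vr] i].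
  split => [|i]; first by have := H ord0; rewrite rV_consE0 ler_norml in_itv.
  by have := H (lift ord0 i); rewrite rV_consES.
case: (unliftP ord0 i) => [j|] ->; first by rewrite rV_consES.
by rewrite rV_consE0 ler_norml; move: tr; rewrite in_itv.
Qed.

Lemma lebesgue_cbox_lty n r : (mu n (cbox r) < +oo)%E.
Proof.
have [r0|r0] := leP 0 r; first by rewrite lebesgue_cbox// ltry.
have := @lebesgue_cbox n 0 (lexx _); move=> H.
apply: (@le_lt_trans _ _ (mu n (@cbox n 0))); last by rewrite H ltry.
apply: le_measure; rewrite ?inE; [exact: measurable_cbox..|].
by move=> x xr i; apply: le_trans (xr i) (ltW r0).
Qed.

(** The sigma-algebra is generated by the coordinates, the topology by the norm. They meet because U
    is the union of the countably many boxes with rational centre and radius 1/(k+1) that it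
    contains; radius below e/2 suffices, since two points of a box differ by at most twice its
    radius. *)
Lemma open_measurable_rV n (U : set 'rV[R]_n) : open U -> measurable U.
Proof.
move=> oU.
pose q2r (q : 'rV[rat]_n) : 'rV[R]_n := map_mx (ratr : rat -> R) q.
pose b (p : 'rV[rat]_n * nat) := [set x : 'rV[R]_n | cbox (p.2.+1%:R^-1) (x - q2r p.1)].
pose b' p := if `[< b p `<=` U >] then b p else set0.
have -> : U = \bigcup_p b' p.
  apply/seteqP; split => [x Ux|x [p _]]; rewrite /b'; last by case: asboolP => // /[apply].
  have /nbhs_ballP[e /= e0 eU] : nbhs x U by exact: open_nbhs_nbhs.
  have [k [s [sk sP]]] : exists k : nat, exists s : R, s = k.+1%:R^-1 /\ s < e / 2.
    exists (Num.truncn (e / 2)^-1), (Num.truncn (e / 2)^-1).+1%:R^-1; split => //.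
    rewrite invf_plt ?posrE ?divr_gt0// truncnS_gt// invr_ge0 ltW// divr_gt0//.
  have s0 : 0 < s by rewrite sk invr_gt0.
  have H i : exists q : rat, `|x ord0 i - ratr q| <= s.
    have ab : x ord0 i - s < x ord0 i + s by lra.
    have [q] := rat_in_itvoo ab.
    by rewrite in_itv/= => /andP[? ?]; exists q; rewrite ler_norml; apply/andP; split; lra.
  pose q := \row_i xchoose (H i).
  exists (q, k) => //; rewrite asboolT; rewrite /b /= -sk.
    by move=> i; rewrite !mxE; exact: (xchooseP (H i)).
  move=> y yq; apply: eU; rewrite -ball_normE/=.
  apply: (@le_lt_trans _ _ (s + s)); last by lra.
  rewrite rV_norm_le; last lra.
  apply/forallP => i; have /= := yq i; have /= := xchooseP (H i); rewrite !mxE => Hx Hy.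
  have -> : x ord0 i - y ord0 i = (x ord0 i - ratr (xchoose (H i))) -
     (y ord0 i - ratr (xchoose (H i))) by ring.
  by apply: le_trans (ler_normB _ _) _; apply: lerD.
apply: countable_bigcupT_measurable; first exact: countableP.
move=> p; rewrite /b'; case: asboolP => // _.
rewrite -[X in measurable X]setTI.
have := @measurable_rV_sub R _ _ _ id (cst (q2r p.1)) (@measurable_id _ _ _) (@measurable_cst _ _ _ _ _ _).
by apply=> //; exact: measurable_cbox.
Qed.

Lemma continuous_measurable_rV n (f : 'rV[R]_n -> R) : continuous f ->
  measurable_fun [set: 'rV[R]_n] f.
Proof.
move=> cf; apply: (measurability _ (RGenOpens.measurableE R)) => _ [_ [a [b ->] <-]].
rewrite setTI; apply: open_measurable_rV; apply: open_comp => // x _; exact: cf.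
Qed.

Lemma compact_measurable_rV n (K : set 'rV[R]_n) : compact K -> measurable K.
Proof.
move=> cK; rewrite -[K]setCK; apply: measurableC; apply: open_measurable_rV.
by rewrite openC; apply: compact_closed => //; exact: norm_hausdorff.
Qed.

End lebesgue_rV_boxes.

(** * Complex-valued functions and convolution *)

Section complex_modulus.
Context {R : realType}.
Implicit Types z : R[i].
Local Notation Re := (@complex.Re R).
Local Notation Im := (@complex.Im R).

Lemma normc_ge0 z : 0 <= normc z.
Proof. by case: z => a b /=; exact: sqrtr_ge0. Qed.

Lemma normr_Re_le z : `|Re z| <= normc z.
Proof.
by case: z => a b /=; rewrite -sqrtr_sqr ler_sqrt ?addr_ge0 ?sqr_ge0// lerDl sqr_ge0.
Qed.

Lemma normr_Im_le z : `|Im z| <= normc z.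
Proof.
by case: z => a b /=; rewrite -sqrtr_sqr ler_sqrt ?addr_ge0 ?sqr_ge0// lerDr sqr_ge0.
Qed.

Lemma normc_real (a : R) : normc a%:C = `|a|.
Proof. by rewrite /= expr0n /= addr0 sqrtr_sqr. Qed.

Lemma normc_le z : normc z <= `|Re z| + `|Im z|.
Proof.
case: z => a b; rewrite [X in normc X](_ : _ = a%:C + (0 +i* 1) * b%:C); last first.
  by apply/eqP; rewrite eq_complex /=; apply/andP; split; apply/eqP; ring.
apply: le_trans (le_normcD _ _) _; rewrite normcM !normc_real.
have -> : normc (0 +i* 1) = 1 :> R by rewrite /= expr0n/= add0r expr1n sqrtr1.
by rewrite mul1r.
Qed.

Lemma normc_subC z1 z2 : normc (z1 - z2) = normc (z2 - z1).
Proof. by rewrite -normcN opprB. Qed.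

Lemma normc_eq0 z : (normc z == 0) = (z == 0).
Proof. by apply/eqP/eqP => [/eq0_normc//|->]; rewrite normc0. Qed.

Lemma ReM z1 z2 : Re (z1 * z2) = Re z1 * Re z2 - Im z1 * Im z2.
Proof. by case: z1 z2 => ? ? []. Qed.

Lemma ImM z1 z2 : Im (z1 * z2) = Re z1 * Im z2 + Im z1 * Re z2.
Proof. by case: z1 z2 => ? ? []. Qed.

Lemma ReD z1 z2 : Re (z1 + z2) = Re z1 + Re z2.
Proof. by case: z1 z2 => ? ? []. Qed.

Lemma ImD z1 z2 : Im (z1 + z2) = Im z1 + Im z2.
Proof. by case: z1 z2 => ? ? []. Qed.

Lemma ReB z1 z2 : Re (z1 - z2) = Re z1 - Re z2.
Proof. by case: z1 z2 => ? ? []. Qed.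

Lemma ImB z1 z2 : Im (z1 - z2) = Im z1 - Im z2.
Proof. by case: z1 z2 => ? ? []. Qed.

Lemma complex_eqP z1 z2 : Re z1 = Re z2 -> Im z1 = Im z2 -> z1 = z2.
Proof. by case: z1 z2 => ? ? [? ?] /= -> ->. Qed.

End complex_modulus.

Section complex_measurable.
Context {R : realType}.
Local Notation Re := (@complex.Re R).
Local Notation Im := (@complex.Im R).

(** The Borel counterpart of [cmeasurable]. Composition and Fubini are carried out at this level,
    and [cmeasurable_repr] supplies a Borel representative. *)
Definition cborel d (T : measurableType d) (f : T -> R[i]) : Prop :=
  measurable_fun [set: T] (Re \o f) /\ measurable_fun [set: T] (Im \o f).

Section borel.
Context d (T : measurableType d).
Implicit Types f g : T -> R[i].

Lemma cborelM f g : cborel f -> cborel g -> cborel (fun x => f x * g x).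
Proof.
move=> [fr fi] [gr gi]; split.
  rewrite (_ : _ \o _ = (fun x => (Re \o f) x * (Re \o g) x - (Im \o f) x * (Im \o g) x)).
    by apply: measurable_funB; apply: measurable_funM.
  by apply/funext => x /=; rewrite ReM.
rewrite (_ : _ \o _ = (fun x => (Re \o f) x * (Im \o g) x + (Im \o f) x * (Re \o g) x)).
  by apply: measurable_funD; apply: measurable_funM.
by apply/funext => x /=; rewrite ImM.
Qed.

Lemma cborelD f g : cborel f -> cborel g -> cborel (fun x => f x + g x).
Proof.
move=> [fr fi] [gr gi]; split.
  rewrite (_ : _ \o _ = (fun x => (Re \o f) x + (Re \o g) x)); first exact: measurable_funD.
  by apply/funext => x /=; rewrite ReD.
rewrite (_ : _ \o _ = (fun x => (Im \o f) x + (Im \o g) x)); first exact: measurable_funD.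
by apply/funext => x /=; rewrite ImD.
Qed.

Lemma cborel_cst (c : R[i]) : cborel (fun _ : T => c).
Proof. by split; exact: measurable_cst. Qed.

Lemma cborel_real (f : T -> R) : measurable_fun setT f -> cborel (fun x => (f x)%:C).
Proof. by move=> mf; split; [exact: mf|exact: measurable_cst]. Qed.

Lemma cborel_comp d' (T' : measurableType d') (h : T' -> T) f :
  measurable_fun setT h -> cborel f -> cborel (f \o h).
Proof. by move=> mh [fr fi]; split; [exact: (measurableT_comp fr mh)|exact: (measurableT_comp fi mh)]. Qed.

Lemma measurable_normc f : cborel f -> measurable_fun [set: T] (fun x => normc (f x)).
Proof.
move=> [fr fi].
rewrite (_ : (fun _ => _) = Num.sqrt \o (fun x => (Re \o f) x ^+ 2 + (Im \o f) x ^+ 2)).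
  apply: (@measurableT_comp _ _ _ _ _ _ (@Num.sqrt R)); first exact: continuous_measurable_fun (@sqrt_continuous R).
  by apply: measurable_funD; [exact: measurable_funX fr|exact: measurable_funX fi].
by apply/funext => x /=; case: (f x).
Qed.

End borel.
End complex_measurable.

Section complex_integral.
Context {R : realType} {d : nat}.
Local Notation X := 'rV[R]_d.
Local Notation mu := (@lebesgue_rV R d).
Local Notation Re := (@complex.Re R).
Local Notation Im := (@complex.Im R).
Implicit Types f g : X -> R[i].

Lemma lmeasurable_comp2 (h : R * R -> R) (f g : X -> R) :
  measurable_fun setT h -> lmeasurable f -> lmeasurable g ->
  lmeasurable (fun x => h (f x, g x)).
Proof.
move=> mh [f' mf' ff'] [g' mg' gg']; exists (fun x => h (f' x, g' x)).
  by apply: measurableT_comp mh _; exact: measurable_fun_pair.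
by apply: filterS2 ff' gg' => x -> ->.
Qed.

Lemma borel_lmeasurable (f : X -> R) : measurable_fun setT f -> lmeasurable f.
Proof. by move=> mf; exists f => //; exact: nearW. Qed.

Lemma cborel_cmeasurable f : cborel f -> cmeasurable f.
Proof. by move=> [? ?]; split; exact: borel_lmeasurable. Qed.

Lemma cmeasurable_repr f : cmeasurable f ->
  exists2 g, cborel g & \forall x \ae mu, f x = g x.
Proof.
move=> [[u mu_ fu] [v mv fv]]; exists (fun x => u x +i* v x); first by split.
by apply: filterS2 fu fv => x /= <- <-; case: (f x).
Qed.

Lemma cmeasurable_ae f g : cmeasurable f -> (\forall x \ae mu, g x = f x) -> cmeasurable g.
Proof.
move=> [[u mu_ fu] [v mv fv]] gf; split.
  by exists u => //; apply: filterS2 fu gf => x /= <- ->.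
by exists v => //; apply: filterS2 fv gf => x /= <- ->.
Qed.

Lemma cmeasurableM f g : cmeasurable f -> cmeasurable g -> cmeasurable (fun x => f x * g x).
Proof.
move=> /cmeasurable_repr[f' bf ff'] /cmeasurable_repr[g' bg gg'].
apply: cmeasurable_ae (cborel_cmeasurable (cborelM bf bg)) _.
by apply: filterS2 ff' gg' => x -> ->.
Qed.

Lemma cmeasurableD f g : cmeasurable f -> cmeasurable g -> cmeasurable (fun x => f x + g x).
Proof.
move=> /cmeasurable_repr[f' bf ff'] /cmeasurable_repr[g' bg gg'].
apply: cmeasurable_ae (cborel_cmeasurable (cborelD bf bg)) _.
by apply: filterS2 ff' gg' => x -> ->.
Qed.

Lemma cmeasurable_real (w : X -> R) : lmeasurable w -> cmeasurable (fun x => (w x)%:C).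
Proof. by move=> mw; split => //; apply: borel_lmeasurable; exact: measurable_cst. Qed.

Definition cintegrable f := mu.-integrable setT (fun x => (Re (f x))%:E) /\
  mu.-integrable setT (fun x => (Im (f x))%:E).

Lemma cintegrableP f : cborel f -> (\int[mu]_x (normc (f x))%:E < +oo)%E -> cintegrable f.
Proof.
move=> bf foo; split; apply/integrableP; split.
- by apply/measurable_EFinP; exact: bf.1.
- apply: le_lt_trans foo; apply: ge0_le_integral_any => x _ //.
  by rewrite lee_fin normr_Re_le.
- by apply/measurable_EFinP; exact: bf.2.
- apply: le_lt_trans foo; apply: ge0_le_integral_any => x _ //.
  by rewrite lee_fin normr_Im_le.
Qed.

Lemma cintegral_ae f g : (\forall x \ae mu, f x = g x) -> cintegral f = cintegral g.
Proof.
by move=> fg; congr Complex; apply: Rintegral_ae_any; apply: filterS fg => x ->.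
Qed.

Lemma cintegralD f g : cintegrable f -> cintegrable g ->
  cintegral (fun x => f x + g x) = cintegral f + cintegral g.
Proof.
move=> [fr fi] [gr gi]; apply: complex_eqP => /=.
  by rewrite -RintegralD//; apply: eq_Rintegral => x _; exact: ReD.
by rewrite -RintegralD//; apply: eq_Rintegral => x _; exact: ImD.
Qed.

Lemma cintegralZl (a : R[i]) f : cintegrable f ->
  cintegral (fun x => a * f x) = a * cintegral f.
Proof.
move=> [fr fi].
have frZ (b : R) : mu.-integrable setT (fun x => (b * Re (f x))%:E).
  by under eq_fun do rewrite EFinM; exact: integrableZl.
have fiZ (b : R) : mu.-integrable setT (fun x => (b * Im (f x))%:E).
  by under eq_fun do rewrite EFinM; exact: integrableZl.
apply: complex_eqP => /=.
  rewrite ReM /= -!RintegralZl// -RintegralB//; [|exact: frZ|exact: fiZ].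
  by apply: eq_Rintegral => x _; exact: ReM.
rewrite ImM /= -!RintegralZl// -RintegralD//; [|exact: fiZ|exact: frZ].
by apply: eq_Rintegral => x _; exact: ImM.
Qed.

Lemma cintegrableZl (a : R[i]) f : cintegrable f -> cintegrable (fun x => a * f x).
Proof.
move=> [fr fi].
have frZ (b : R) : mu.-integrable setT (fun x => (b * Re (f x))%:E).
  by under eq_fun do rewrite EFinM; exact: integrableZl.
have fiZ (b : R) : mu.-integrable setT (fun x => (b * Im (f x))%:E).
  by under eq_fun do rewrite EFinM; exact: integrableZl.
split.
  under eq_fun do rewrite ReM EFinB; exact: integrableB.
under eq_fun do rewrite ImM EFinD; exact: integrableD.
Qed.

(** Multiplication by the unimodular constant |I| / I makes the integral I real and nonnegative, so
    only a real part remains to be estimated. *)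
Lemma normc_cintegral_le f : cborel f ->
  ((normc (cintegral f))%:E <= \int[mu]_x (normc (f x))%:E)%E.
Proof.
move=> bf; have [foo|] := ltP (\int[mu]_x (normc (f x))%:E)%E +oo%E; last first.
  by rewrite leye_eq => /eqP ->; rewrite leey.
have intf := cintegrableP bf foo.
set I := cintegral f; have [I0|I0] := eqVneq I 0.
  by rewrite I0 normc0; apply: integral_ge0 => x _; rewrite lee_fin normc_ge0.
have nI0 : normc I != 0 by rewrite normc_eq0.
pose u := (normc I)%:C / I.
have nu : normc u = 1 by rewrite normcM normc_real normcV ger0_norm ?normc_ge0 ?divff.
have uI : (normc I)%:C = cintegral (fun x => u * f x).
  by rewrite cintegralZl// /u -mulrA mulVf// mulr1.
have -> : normc I = Re (cintegral (fun x => u * f x)) by rewrite -uI.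
have [ufr _] := cintegrableZl u intf.
rewrite /= fineK; last exact: integrable_fin_num.
rewrite -[leRHS]gee0_abs; last by apply: integral_ge0 => x _; rewrite lee_fin normc_ge0.
apply: le_trans (lee_abs _) _; rewrite [leRHS]gee0_abs; last first.
  by apply: integral_ge0 => x _; rewrite lee_fin normc_ge0.
apply: le_trans (le_abse_integral _ _ _) _ => //.
  exact: measurable_int ufr.
apply: ge0_le_integral_any => x _ //=.
by rewrite lee_fin (le_trans (normr_Re_le _))// normcM nu mul1r.
Qed.

End complex_integral.

(** * Invariance of the integral, convolution, and Fubini for complex functions *)

Section convolution_theory.
Context {R : realType} {d : nat}.
Local Notation X := 'rV[R]_d.
Local Notation mu := (@lebesgue_rV R d).
Local Notation Re := (@complex.Re R).
Local Notation Im := (@complex.Im R).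
Implicit Types f g : X -> R[i].

Lemma measurable_reflect (c : X) : measurable_fun [set: X] (fun x => c - x).
Proof. exact: measurable_rV_sub. Qed.

Lemma measurable_translate (c : X) : measurable_fun [set: X] (fun x => x + c).
Proof. exact: measurable_rV_add. Qed.

(** The measure of the reflected null set is the integral of a reflected indicator, to which
    [ge0_integral_reflect] applies. *)
Lemma ae_reflect (P : X -> Prop) (c : X) :
  (\forall x \ae mu, P x) -> \forall x \ae mu, P (c - x).
Proof.
move=> [N [mN N0 PN]].
have mN' : measurable ((fun x : X => c - x) @^-1` N).
  by rewrite -[X in measurable X]setTI; exact: measurable_reflect.
exists ((fun x : X => c - x) @^-1` N); split => //; last by move=> x /= /PN.
have E : (\int[mu]_x (\1_N x)%:E = 0)%E by rewrite integral_indic// setIT.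
rewrite -[LHS](_ : \int[mu]_x (\1_N (c - x))%:E = _)%E.
  by rewrite (@ge0_integral_reflect R d c (fun x => (\1_N x)%:E))//; exact/measurable_EFinP.
rewrite -[X in mu X]setIT -integral_indic//.
Qed.

Lemma ae_translate (P : X -> Prop) (c : X) :
  (\forall x \ae mu, P x) -> \forall x \ae mu, P (x + c).
Proof.
move=> /(@ae_reflect _ c)/(@ae_reflect _ 0); apply: filterS => x.
by rewrite sub0r opprK addrC.
Qed.

Lemma lmeasurable_reflect (f : X -> R) c : lmeasurable f -> lmeasurable (fun x => f (c - x)).
Proof.
move=> [g mg fg]; exists (fun x => g (c - x)); last exact: ae_reflect fg.
exact: measurableT_comp mg (measurable_reflect c).
Qed.

Lemma lmeasurable_translate (f : X -> R) c : lmeasurable f -> lmeasurable (fun x => f (x + c)).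
Proof.
move=> [g mg fg]; exists (fun x => g (x + c)); last exact: ae_translate fg.
exact: measurableT_comp mg (measurable_translate c).
Qed.

Lemma cmeasurable_translate f c : cmeasurable f -> cmeasurable (fun x => f (x + c)).
Proof.
by move=> [mr mi]; split; [exact: (lmeasurable_translate c mr)|exact: (lmeasurable_translate c mi)].
Qed.

Lemma lintegral_reflect (f : X -> R) c : lmeasurable f -> (forall x, 0 <= f x) ->
  (\int[mu]_x (f (c - x))%:E = \int[mu]_x (f x)%:E)%E.
Proof.
move=> [g mg fg] f0.
rewrite (@integral_ae_any _ _ _ mu setT (EFin \o f) (fun x => (`|g x|)%:E)); last first.
  by apply: filterS fg => x /= <-; rewrite ger0_norm.
rewrite (@integral_ae_any _ _ _ mu setT (fun x => (f (c - x))%:E) (fun x => (`|g (c - x)|)%:E)); last first.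
  by apply: filterS (ae_reflect c fg) => x /= <-; rewrite ger0_norm.
rewrite (@ge0_integral_reflect R d c (fun x => `|g x|%:E))//.
by apply/measurable_EFinP; exact: measurableT_comp.
Qed.

Lemma lintegral_translate (f : X -> R) c : lmeasurable f -> (forall x, 0 <= f x) ->
  (\int[mu]_x (f (x + c))%:E = \int[mu]_x (f x)%:E)%E.
Proof.
move=> mf f0; rewrite -(lintegral_reflect c mf)// -(@lintegral_reflect (fun x => f (c - x)) 0)//.
  by apply: eq_integral => x _; rewrite sub0r opprK addrC.
exact: lmeasurable_reflect.
Qed.

(** Splitting into two nonnegative integrals gives access to the Tonelli-type results without
    assuming integrability: [fine] and the extended difference are total. *)
Let Rintegral_posneg (f : X -> R) : (\int[mu]_x f x =
  fine (\int[mu]_x (Num.max (f x) 0)%:E - \int[mu]_x (Num.max (- f x) 0)%:E)%E)%R.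
Proof.
rewrite /Rintegral integralE; congr (fine (_ - _)%E); apply: eq_integral => x _.
  by rewrite funeposE -EFin_max.
by rewrite funenegE -EFinN -EFin_max.
Qed.

Lemma Rintegral_reflect (f : X -> R) c : lmeasurable f ->
  (\int[mu]_x f (c - x) = \int[mu]_x f x)%R.
Proof.
move=> mf; rewrite !Rintegral_posneg; congr (fine (_ - _)%E).
  apply: (@lintegral_reflect (fun x => Num.max (f x) 0)) => [|x]; last by rewrite le_max lexx orbT.
  apply: (@lmeasurable_comp2 R d (fun p => Num.max p.1 p.2) f (fun=> 0)) => //.
    exact: measurable_maxr.
  by apply: borel_lmeasurable; exact: measurable_cst.
apply: (@lintegral_reflect (fun x => Num.max (- f x) 0)) => [|x]; last by rewrite le_max lexx orbT.
apply: (@lmeasurable_comp2 R d (fun p => Num.max (- p.1) p.2) f (fun=> 0)) => //.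
  by apply: measurable_maxr => //; exact: measurableT_comp.
by apply: borel_lmeasurable; exact: measurable_cst.
Qed.

Lemma cintegral_reflect f c : cmeasurable f -> cintegral (fun x => f (c - x)) = cintegral f.
Proof.
by move=> [mr mi]; congr Complex; [exact: (Rintegral_reflect c mr)|exact: (Rintegral_reflect c mi)].
Qed.

Lemma measurable_Rintegral (F : X * X -> R) : measurable_fun setT F ->
  measurable_fun [set: X] (fun x => \int[mu]_y F (x, y)).
Proof.
move=> mF; under eq_fun do rewrite Rintegral_posneg.
apply: measurableT_comp; first exact: fine_measurable.
apply: emeasurable_funB.
  apply: (@measurable_fun_fubini_tonelli_F _ _ _ _ _ _ (fun p => (Num.max (F p) 0)%:E)) => [|x].
    by apply/measurable_EFinP; exact: measurable_maxr.
  by rewrite lee_fin le_max lexx orbT.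
apply: (@measurable_fun_fubini_tonelli_F _ _ _ _ _ _ (fun p => (Num.max (- F p) 0)%:E)) => [|x].
  by apply/measurable_EFinP; apply: measurable_maxr => //; exact: measurableT_comp.
by rewrite lee_fin le_max lexx orbT.
Qed.

Lemma cborel_cintegral (F : X * X -> R[i]) : cborel F ->
  cborel (fun x : X => cintegral (fun y => F (x, y))).
Proof.
move=> [Fr Fi]; split.
  exact: (measurable_Rintegral Fr).
exact: (measurable_Rintegral Fi).
Qed.

Lemma cborel_sub_fst f : cborel f -> cborel (fun p : X * X => f (p.1 - p.2)).
Proof.
move=> bf; apply: (@cborel_comp _ _ _ _ _ (fun p : X * X => p.1 - p.2) f) => //.
exact: measurable_rV_sub.
Qed.

Lemma cborel_fst f : cborel f -> cborel (fun p : X * X => f p.1).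
Proof. by move=> bf; exact: (@cborel_comp _ _ _ _ _ (fst : X * X -> X) f). Qed.

Lemma cborel_snd f : cborel f -> cborel (fun p : X * X => f p.2).
Proof. by move=> bf; exact: (@cborel_comp _ _ _ _ _ (snd : X * X -> X) f). Qed.

(** Equality holds at every point, since for each x the integrands agree for almost every y. Hence
    representatives can be exchanged by rewriting. *)
Lemma convolution_ae f f' g g' : (\forall x \ae mu, f x = f' x) ->
  (\forall x \ae mu, g x = g' x) -> convolution f g = convolution f' g'.
Proof.
move=> ff' gg'; apply/funext => x; apply: cintegral_ae.
by apply: filterS2 (ae_reflect x ff') gg' => y -> ->.
Qed.

Lemma cborel_convolution f g : cborel f -> cborel g -> cborel (convolution f g).
Proof.
move=> bf bg.
apply: (@cborel_cintegral (fun p => f (p.1 - p.2) * g p.2)).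
by apply: cborelM; [exact: cborel_sub_fst|exact: cborel_snd].
Qed.

Lemma cmeasurable_convolution f g : cmeasurable f -> cmeasurable g ->
  cmeasurable (convolution f g).
Proof.
move=> /cmeasurable_repr[f' bf ff'] /cmeasurable_repr[g' bg gg'].
rewrite (convolution_ae ff' gg'); apply: cborel_cmeasurable.
exact: cborel_convolution.
Qed.

Lemma normc_convolution_le f g x : cmeasurable f -> cmeasurable g ->
  ((normc (convolution f g x))%:E <=
   \int[mu]_y (normc (f (x - y)) * normc (g y))%:E)%E.
Proof.
move=> /cmeasurable_repr[f' bf ff'] /cmeasurable_repr[g' bg gg'].
rewrite (convolution_ae ff' gg').
rewrite (@integral_ae_any _ _ _ mu setT _ (fun y => (normc (f' (x - y)) * normc (g' y))%:E)).
  apply: le_trans (normc_cintegral_le _) _.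
    by apply: cborelM => //; apply: (@cborel_comp _ _ _ _ _ (fun y : X => x - y) f') => //;
      exact: measurable_reflect.
  by apply: ge0_le_integral_any => y _; rewrite lee_fin ?normc_ge0// normcM.
by apply: filterS2 (ae_reflect x ff') gg' => y /= -> ->.
Qed.

(** The L^1 case of Young's inequality: Tonelli, then translation invariance of the inner
    integral. *)
Lemma normc_convolution_int_le f g : cmeasurable f -> cmeasurable g ->
  (\int[mu]_x (normc (convolution f g x))%:E <=
   (\int[mu]_x (normc (f x))%:E) * \int[mu]_x (normc (g x))%:E)%E.
Proof.
move=> mf mg; have [f' bf ff'] := cmeasurable_repr mf; have [g' bg gg'] := cmeasurable_repr mg.
have E (h h' : X -> R[i]) : (\forall x \ae mu, h x = h' x) ->
    (\int[mu]_x (normc (h x))%:E = \int[mu]_x (normc (h' x))%:E)%E.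
  by move=> hh'; apply: integral_ae_any; apply: filterS hh' => x ->.
rewrite (E _ _ ff') (E _ _ gg') (convolution_ae ff' gg').
have mnf := measurable_normc bf; have mng := measurable_normc bg.
pose F (p : X * X) := (normc (f' (p.1 - p.2)) * normc (g' p.2))%:E.
have mF : measurable_fun setT F.
  apply/measurable_EFinP; apply: measurable_funM.
    exact: (measurable_normc (cborel_sub_fst bf)).
  exact: (measurable_normc (cborel_snd bg)).
have F0 p : (0 <= F p)%E by rewrite lee_fin mulr_ge0 ?normc_ge0.
apply: (@le_trans _ _ (\int[mu]_x \int[mu]_y F (x, y))%E).
  apply: ge0_le_integral_any => x _; first by rewrite lee_fin normc_ge0.
  by apply: normc_convolution_le; exact: cborel_cmeasurable.
rewrite fubini_tonelli//.
under eq_integral => y _.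
  rewrite /F /=; under eq_integral do rewrite EFinM.
  rewrite ge0_integralZr//; last 3 first.
  - apply/measurable_EFinP; apply: (measurableT_comp mnf); exact: measurable_rV_sub.
  - by move=> x _; rewrite lee_fin normc_ge0.
  - by rewrite lee_fin normc_ge0.
  rewrite (@lintegral_translate (fun x => normc (f' x)) (- y)); last 2 first.
  - exact: borel_lmeasurable.
  - by move=> x; exact: normc_ge0.
  over.
rewrite ge0_integralZl//; first exact/measurable_EFinP.
- by move=> x _; rewrite lee_fin normc_ge0.
- by apply: integral_ge0 => x _; rewrite lee_fin normc_ge0.
Qed.

Lemma cintegral_Fubini (F : X * X -> R[i]) : cborel F ->
  (\int[mu]_x \int[mu]_y (normc (F (x, y)))%:E < +oo)%E ->
  cintegral (fun x => cintegral (fun y => F (x, y))) =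
  cintegral (fun y => cintegral (fun x => F (x, y))).
Proof.
move=> bF Foo.
have H (G : X * X -> R) : measurable_fun setT G -> (forall p, `|G p| <= normc (F p)) ->
   (\int[mu]_x \int[mu]_y G (x, y) = \int[mu]_y \int[mu]_x G (x, y))%R.
  move=> mG GF.
  have mG' : measurable_fun setT (EFin \o G) by exact/measurable_EFinP.
  have Goo : (\int[mu]_x \int[mu]_y `|(EFin \o G) (x, y)| < +oo)%E.
    apply: le_lt_trans Foo; apply: ge0_le_integral_any => x _; first exact: integral_ge0.
    by apply: ge0_le_integral_any => y _ //=; rewrite lee_fin.
  have intG : (mu \x mu)%E.-integrable setT (EFin \o G).
    exact: (integrable12ltyP mu mu mG').2.
  have := Fubini intG; rewrite /Rintegral /= => FE.
  (* The real-valued inner integral and the extended one agree only where the section is integrable,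
     that is, for almost every x; this suffices for the outer integral. *)
  transitivity (fine (\int[mu]_x \int[mu]_y (G (x, y))%:E))%E; last rewrite FE.
    congr fine; apply: ae_eq_integral => //.
    - apply/measurable_EFinP; exact: (measurable_Rintegral mG).
    - exact: measurable_fubini_F intG.
    - have := ae_integrable1 intG; apply: filterS => x /= intx _.
      by rewrite fineK//; exact: integrable_fin_num.
  congr fine; apply: ae_eq_integral => //.
  - exact: measurable_fubini_G intG.
  - apply/measurable_EFinP; apply: (@measurable_Rintegral (fun p => G (p.2, p.1))).
    by apply: measurableT_comp mG _; exact: measurable_swap.
  - have := ae_integrable2 intG; apply: filterS => x /= intx _.
    by rewrite fineK//; exact: integrable_fin_num.
apply: complex_eqP => /=.
  by apply: (H (Re \o F)) => [|p]; [exact: bF.1|exact: normr_Re_le].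
by apply: (H (Im \o F)) => [|p]; [exact: bF.2|exact: normr_Im_le].
Qed.

End convolution_theory.

(** * Test functions *)

Section calculus1.
Context {R : realType}.

Lemma cvg_is_derive (V : normedModType R) (f : V -> R) (x v : V) (l : R) :
  (fun h => h^-1 *: ((f \o shift x) (h *: v) - f x)) @ 0^' --> l -> is_derive x v f l.
Proof.
move=> fl; apply: DeriveDef; first by apply/cvg_ex; exists l.
exact: cvg_lim fl.
Qed.

(** Derivatives are often produced in this form below: a quadratic remainder with a constant uniform
    in the base point can be integrated against a kernel. *)
Lemma is_derive_quad (V : normedModType R) (f : V -> R) (x v : V) (l C : R) :
  (forall h, `|h| <= 1 -> `|f (h *: v + x) - f x - h * l| <= C * h ^+ 2) ->
  is_derive x v f l.
Proof.
move=> fC; apply: cvg_is_derive; apply/cvgrPdist_le => e e0.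
near=> h.
have h0 : h != 0 by near: h; exact: nbhs_dnbhs_neq.
have h1 : `|h| <= 1.
  near: h; apply: dnbhs0_le; exact: ltr01.
have he : `|h| <= e / (`|C| + 1).
  by near: h; apply: dnbhs0_le; rewrite divr_gt0// ltr_wpDl.
have -> : l - h^-1 *: ((f \o shift x) (h *: v) - f x) =
   - (h^-1 * (f (h *: v + x) - f x - h * l)).
  by rewrite /= /GRing.scale/= [X in _ = - X]mulrBr mulKf// opprB.
rewrite normrN normrM normfV ler_pdivrMl ?normr_gt0//.
apply: le_trans (fC _ h1) _; rewrite -real_normK ?num_real// expr2 mulrA mulrC.
rewrite ler_wpM2l// (le_trans (ler_wpM2r _ (ler_norm C)))//.
apply: (@le_trans _ _ ((`|C| + 1) * `|h|)); first by rewrite ler_wpM2r// lerDl.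
by rewrite mulrC -ler_pdivlMr// ltr_wpDl.
Unshelve. all: by end_near. Qed.

Lemma is_derive_comp1 (f g : R -> R) (x df dg : R) : is_derive x 1 f df ->
  is_derive (f x) 1 g dg -> is_derive x 1 (g \o f) (dg * df).
Proof.
move=> [dfx <-] [dgx <-]; apply: DeriveDef.
  move: dfx dgx => /derivable1_diffP ? /derivable1_diffP ?.
  by apply/derivable1_diffP; exact: differentiable_comp.
by rewrite -!derive1E (derive1_comp dfx dgx).
Qed.

Lemma is_derive_affine (f : R -> R) (a b x df : R) : is_derive (a * x + b) 1 f df ->
  is_derive x 1 (fun t => f (a * t + b)) (a * df).
Proof.
move=> fdf; rewrite mulrC.
apply: (@is_derive_comp1 (fun t => a * t + b) f) => //.
have : is_derive x 1 ((a \*: id) + cst b) (a *: 1 + 0) by exact: is_deriveD.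
by rewrite addr0 /GRing.scale /= mulr1.
Qed.

Lemma is_derive_mul1 (f g : R -> R) (x df dg : R) : is_derive x 1 f df ->
  is_derive x 1 g dg -> is_derive x 1 (fun t => f t * g t) (df * g x + f x * dg).
Proof.
move=> fd gd; have := is_deriveM fd gd.
by rewrite /GRing.scale /= addrC (mulrC (g x)).
Qed.

(** The difference quotients on the two sides are literally the same function, so directional
    calculus reduces to one real variable. *)
Lemma is_derive_line (V : normedModType R) (f : V -> R) (x v : V) (t l : R) :
  is_derive (t *: v + x) v f l <-> is_derive t 1 (fun h => f (h *: v + x)) l.
Proof.
have E : (fun h => h^-1 *: ((f \o shift (t *: v + x)) (h *: v) - f (t *: v + x))) =
    (fun h : R => h^-1 *: (((fun h => f (h *: v + x)) \o shift t) (h *: 1) - f (t *: v + x))).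
  by apply/funext => h /=; rewrite addrA -scalerDl [h *: 1]mulr1.
split=> -[df <-]; apply: DeriveDef; rewrite /derivable /derive.
- by rewrite -E.
- by rewrite -E.
- by rewrite E.
- by rewrite E.
Qed.

(** Carrying the derivative as a witness makes stability under sums, products and affine
    substitutions a plain induction on n. *)
Fixpoint smoothn n (f : R -> R) : Prop :=
  if n is m.+1 then exists2 f' : R -> R, (forall t : R, is_derive t 1 f (f' t)) & smoothn m f'
  else True.

Lemma smoothnS n f : smoothn n.+1 f -> smoothn n f.
Proof. by elim: n f => // n ih f [f' ff' /ih sf']; exists f'. Qed.

Lemma smoothnD n f g : smoothn n f -> smoothn n g -> smoothn n (fun t => f t + g t).
Proof.
elim: n f g => // n ih f g [f' ff' sf'] [g' gg' sg'].
exists (fun t => f' t + g' t); last exact: ih.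
by move=> t; exact: (@is_deriveD _ _ _ f g).
Qed.

Lemma smoothnM n f g : smoothn n f -> smoothn n g -> smoothn n (fun t => f t * g t).
Proof.
elim: n f g => // n ih f g sf sg.
have [f' ff' sf'] := sf; have [g' gg' sg'] := sg.
exists (fun t => f' t * g t + f t * g' t).
  by move=> t; exact: is_derive_mul1.
by apply: smoothnD; apply: ih => //; exact: smoothnS.
Qed.

Lemma smoothn_cst n c : smoothn n (fun=> c).
Proof.
elim: n c => // n ih c; exists (fun=> 0); last exact: ih.
by move=> t; exact: is_derive_cst.
Qed.

Lemma smoothn_affine n f a b : smoothn n f -> smoothn n (fun t => f (a * t + b)).
Proof.
elim: n f => // n ih f [f' ff' sf']; exists (fun t => a * f' (a * t + b)).
  by move=> t; exact: is_derive_affine.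
by apply: smoothnM; [exact: smoothn_cst|exact: ih].
Qed.

(** For k = 0 this is the classical smooth function exp(-1/t) that is flat at 0. The powers of 1/t
    are included so that the family is closed, up to linear combinations, under differentiation. *)
Definition flat k (t : R) : R := if 0 < t then t ^- k * expR (- t^-1) else 0.

(** With s = 1/t the bound reads s^(k+2) / (k+2)! <= exp s, one term of the exponential series. The
    factor t^2 makes the derivative at 0 vanish through [is_derive_quad]. *)
Lemma flat_le k t : 0 <= flat k t <= k.+2`!%:R * t ^+ 2.
Proof.
rewrite /flat; case: ifPn => t0; last by rewrite lexx mulr_ge0// sqr_ge0.
apply/andP; split; first by rewrite mulr_ge0 ?expR_ge0// invr_ge0 exprn_ge0// ltW.
rewrite expRN -exprVn; set s := t^-1.
have s0 : 0 < s by rewrite invr_gt0.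
have -> : t ^+ 2 = s ^- 2 by rewrite /s exprVn invrK.
rewrite ler_pdivrMr ?expR_gt0// mulrAC ler_pdivlMr ?exprn_gt0//.
rewrite -exprD addn2 mulrC -ler_pdivrMr ?ltr0n ?fact_gt0//.
by have := @expR_ge1Dxn R s k.+1 (ltW s0); lra.
Qed.

Lemma is_derive_flat k (t : R) :
  is_derive t 1 (flat k) (flat k.+2 t - k%:R * flat k.+1 t).
Proof.
have [t0|t0|->] := ltgtP t 0.
- rewrite /flat ltNge (ltW t0)/= mulr0 subr0.
  have H : is_derive t 1 (cst 0 : R -> R) 0 by exact: is_derive_cst.
  apply: near_eq_is_derive H.
  near=> u; rewrite /= ifN// -leNgt ltW//; near: u; exact: lt_nbhsl.
- have E : \forall u \near t, (fun t : R => (t^-1) ^+ k * expR (- t^-1)) u = flat k u.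
    near=> u; rewrite /flat ifT ?exprVn//; near: u; exact: lt_nbhsr.
  apply: near_eq_is_derive E _.
  have tn0 : t != 0 by rewrite gt_eqF.
  have dinv : is_derive t 1 (fun y : R => y^-1) (- t ^- 2).
    have [d1 d2] : is_derive t 1 (id : R -> R) 1 by exact: is_derive_id.
    apply: DeriveDef; first exact: (@derivableV _ _ id).
    by rewrite (@deriveV _ _ id)// d2 /GRing.scale/= mulr1.
  have dX : is_derive t 1 (fun y : R => y^-1 ^+ k) ((k%:R * (t^-1) ^+ k.-1) * (- t ^- 2)).
    have -> : (fun y : R => y^-1 ^+ k) = (fun y : R => y^-1) ^+ k.
      by apply/funext => y; rewrite exprfctE.
    exact: is_deriveX.
  have dN : is_derive t 1 (fun y : R => - y^-1) (- - t ^- 2).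
    exact: (@is_deriveN _ _ _ (fun y : R => y^-1)).
  have := is_derive_mul1 dX (is_derive_comp1 dN (is_derive_expR _)).
  move=> /is_derive_eq; apply.
  rewrite /flat t0 /= opprK.
  by case: k {dX} => [|k] /=; rewrite -?exprVn ?exprS ?expr0; ring.
- apply: (@is_derive_quad _ _ _ _ _ (k.+2`!%:R)) => h h1.
  have f0 j : flat j 0 = 0 by rewrite /flat ltxx.
  rewrite !f0 mulr0 !subr0 mulr0 subr0 addr0 [_ *: _]mulr1.
  by have /andP[? ?] := flat_le k h; rewrite ger0_norm.
Unshelve. all: by end_near. Qed.

Lemma smoothn_flat n k : smoothn n (flat k).
Proof.
elim: n k => // n ih k; exists (fun t => flat k.+2 t + (- k%:R) * flat k.+1 t).
  by move=> t; rewrite mulNr; exact: is_derive_flat.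
by apply: smoothnD => //; apply: smoothnM => //; exact: smoothn_cst.
Qed.

End calculus1.

(** * Tensor products of one-variable functions and bump functions *)

Section tensor_test_functions.
Context {R : realType} {d : nat}.
Local Notation X := 'rV[R]_d.
Local Notation e_ i := (delta_mx ord0 i : X).

Definition tensor (th : 'I_d -> R -> R) (x : X) : R := \prod_i th i (x ord0 i).

Definition smooth1 (f : R -> R) : Prop := forall n, smoothn n f.

(** [smoothn] gives a possibly different derivative for each order; uniqueness of the derivative
    identifies them all. *)
Lemma smooth1_derive f : smooth1 f ->
  exists2 f', smooth1 f' & forall t : R, is_derive t 1 f (f' t).
Proof.
move=> sf; have [f' ff' _] := sf 1%N; exists f' => // n.
have [g fg sg] := sf n.+1; suff -> : f' = g by [].
by apply/funext => t; rewrite -(@derive_val _ _ _ _ _ _ _ (ff' t)) (@derive_val _ _ _ _ _ _ _ (fg t)).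
Qed.

Lemma is_derive_tensor th j (x : X) (l : R) : is_derive (x ord0 j) 1 (th j) l ->
  is_derive x (e_ j) (tensor th) (l * \prod_(i | i != j) th i (x ord0 i)).
Proof.
move=> thl; rewrite -[x]add0r -[0 in X in is_derive X](scale0r (e_ j)).
apply/is_derive_line.
rewrite (_ : (fun h => _) = (fun h => th j (1 * h + x ord0 j) * \prod_(i | i != j) th i (x ord0 i))).
  have thl' : is_derive (1 * 0 + x ord0 j) 1 (th j) l by rewrite mul1r add0r.
  have := @is_derive_affine R (th j) 1 (x ord0 j) 0 l thl'; rewrite [1 * l]mul1r => H.
  have := @is_derive_mul1 R _ (cst (\prod_(i | i != j) th i (x ord0 i))) 0 l 0 H (is_derive_cst _ _ _).
  rewrite mulr0 addr0.
  by rewrite [0 + x]add0r.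
apply/funext => h; rewrite /tensor (bigD1 j)//= !mxE !eqxx /= mulr1 mul1r; congr (_ * _).
by apply: eq_bigr => i ij; rewrite !mxE (negbTE ij) andbF mulr0 add0r.
Qed.

Lemma continuous_tensor th : (forall i, continuous (th i)) -> continuous (tensor th).
Proof.
move=> cth; apply: continuous_big; first exact: mul_continuous.
move=> i _ x.
apply: (@continuous_comp _ _ _ (fun x : X => x ord0 i) (th i)); last exact: cth.
exact: coord_continuous.
Qed.

Lemma smooth1_continuous f : smooth1 f -> continuous f.
Proof.
move=> /smooth1_derive[f' _ ff'] t.
by have [+ _] := ff' t; move=> /derivable1_diffP/differentiable_continuous.
Qed.

(** A partial derivative of a tensor product is again a tensor product, with one factor replaced by
    its derivative. *)
Lemma rsmooth_tensor th : (forall i, smooth1 (th i)) -> rsmooth (tensor th).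
Proof.
move=> sth s /=.
have [th' sth' ->] : exists2 th', (forall i, smooth1 (th' i)) &
    foldr rpderiv (tensor th) s = tensor th'.
  elim: s => [|j s [th' sth' /= ->]]; first by exists th.
  have [f' sf' ff'] := smooth1_derive (sth' j).
  exists (fun i => if i == j then f' else th' i); first by move=> i; case: ifP.
  apply/funext => x; rewrite /rpderiv /= (@derive_val _ _ _ _ _ _ _ (is_derive_tensor (ff' (x ord0 j)))).
  rewrite /tensor [RHS](bigD1 j)//= eqxx; congr (_ * _).
  by apply: eq_bigr => i /negbTE ->.
split; first by apply: continuous_tensor => i; exact: smooth1_continuous.
move=> i x; have [f' _ ff'] := smooth1_derive (sth' i).
exact: (is_derive_tensor (ff' (x ord0 i))).(ex_derive).
Qed.

(** Real test functions, with the support condition phrased by boxes. The calculus is done for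
    these; a [testfun] splits into two of them by [testfun_Re] and [testfun_Im]. *)
Definition rtest (u : X -> R) : Prop :=
  rsmooth u /\ exists2 r, 0 < r & forall x, u x != 0 -> cbox r x.

Lemma rsmooth0 : rsmooth (fun _ : X => 0 : R).
Proof.
move=> s /=; have -> : foldr rpderiv (fun _ : X => 0 : R) s = cst 0.
  elim: s => //= i s ->; apply/funext => x; by rewrite /rpderiv derive_cst.
by split => [x|i x]; [exact: cst_continuous|exact: derivable_cst].
Qed.

Lemma closed_cbox r : closed (@cbox R d r).
Proof. by apply: compact_closed; [exact: norm_hausdorff|exact: compact_cbox]. Qed.

Lemma rtest_testfun (u : X -> R) : rtest u ->
  exists phi : testfun R d, forall x, phi x = (u x)%:C.
Proof.
move=> [su [r r0 ur]].
have cu : compact (csupport (fun x => (u x)%:C)).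
  apply: (subclosed_compact _ (@compact_cbox R d r)); first exact: closed_closure.
  rewrite [X in _ `<=` X](iffLR (closure_id _) (@closed_cbox r)).
  apply: closureS => x /=; rewrite eq_complex /= eqxx andbT; exact: ur.
have sm : smooth (fun x => (u x)%:C) by split; [exact: su|exact: rsmooth0].
by exists (Testfun sm cu).
Qed.

Lemma testfun_supp (phi : testfun R d) :
  exists2 r, 0 < r & forall x, phi x != 0 -> cbox r x.
Proof.
have [r r0 pr] := compact_sub_cbox (@tf_compact _ _ phi); exists r => // x px.
by apply: pr; exact: subset_closure.
Qed.

Lemma testfun_Re (phi : testfun R d) : rtest (@complex.Re R \o phi).
Proof.
split; first by have [] := tf_smooth phi.
have [r r0 pr] := testfun_supp phi; exists r => // x /= px; apply: pr.
by apply: contra_neq px => ->.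
Qed.

Lemma testfun_Im (phi : testfun R d) : rtest (@complex.Im R \o phi).
Proof.
split; first by have [] := tf_smooth phi.
have [r r0 pr] := testfun_supp phi; exists r => // x /= px; apply: pr.
by apply: contra_neq px => ->.
Qed.

(** Positive exactly on ]a, b[ and bounded by 1. The factor k+1 sharpens the edges: as k grows the
    functions tend pointwise to the indicator of ]a, b[. *)
Definition bump1 (k : nat) (a b t : R) : R :=
  flat 0 (k.+1%:R * (t - a)) * flat 0 (k.+1%:R * (b - t)).

Lemma flat0_ge0 (t : R) : 0 <= flat 0 t.
Proof. by rewrite /flat; case: ifP => // _; rewrite expr0 invr1 mul1r expR_ge0. Qed.

Lemma flat0_le1 (t : R) : flat 0 t <= 1.
Proof.
rewrite /flat; case: ifPn => // t0; rewrite expr0 invr1 mul1r.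
by rewrite -expR0 ler_expR oppr_le0 invr_ge0 ltW.
Qed.

Lemma flat0_gt0 (t : R) : (0 < flat 0 t) = (0 < t).
Proof. by rewrite /flat; case: ifPn => [t0|_]; rewrite ?ltxx// expr0 invr1 mul1r expR_gt0. Qed.

Lemma flat0_cvg (t : R) : flat 0 (k.+1%:R * t) @[k --> \oo] --> ((0 < t)%R%:R : R).
Proof.
case: (ltP 0 t) => t0; last first.
  have -> : (fun k => flat 0 (k.+1%:R * t)) = cst (0 : R).
    by apply/funext => k; rewrite /flat ltNge mulr_ge0_le0.
  exact: cvg_cst.
have -> : (fun k => flat 0 (k.+1%:R * t)) = (fun k => expR (- (t^-1 * harmonic k))).
  apply/funext => k; rewrite /flat mulr_gt0// expr0 invr1 mul1r /harmonic.
  by rewrite invfM mulrC.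
have H : (- (t^-1 * harmonic k)) @[k --> \oo] --> (- (t^-1 * 0) : R).
  by apply: cvgN; apply: cvgMr; exact: cvg_harmonic.
have := @continuous_cvg _ _ _ _ _ _ expR _ (@continuous_expR R _) H.
by rewrite mulr0 oppr0 expR0 => /(_ _); apply.
Qed.

Lemma smooth1_bump1 k a b : smooth1 (bump1 k a b).
Proof.
move=> n; apply: smoothnM.
  have := @smoothn_affine R n (flat 0) k.+1%:R (- (k.+1%:R * a)) (smoothn_flat n 0).
  by congr smoothn; apply/funext => t; rewrite mulrBr.
have := @smoothn_affine R n (flat 0) (- k.+1%:R) (k.+1%:R * b) (smoothn_flat n 0).
by congr smoothn; apply/funext => t; rewrite mulrBr mulNr addrC.
Qed.

Lemma bump1_ge0 k a b t : 0 <= bump1 k a b t.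
Proof. by rewrite mulr_ge0// flat0_ge0. Qed.

Lemma bump1_le1 k a b t : bump1 k a b t <= 1.
Proof. by rewrite mulr_ile1 ?flat0_ge0 ?flat0_le1. Qed.

Lemma bump1_gt0 k a b t : (0 < bump1 k a b t) = (a < t < b).
Proof.
have H x : (0 < k.+1%:R * x :> R) = (0 < x) by rewrite pmulr_rgt0.
have := flat0_ge0 (k.+1%:R * (t - a)); rewrite le_eqVlt => /orP[/eqP/esym E|E].
  rewrite /bump1 E mul0r ltxx; have := flat0_gt0 (k.+1%:R * (t - a)).
  by rewrite E ltxx H subr_gt0 => <-.
rewrite /bump1 pmulr_rgt0// flat0_gt0 H subr_gt0.
by move: E; rewrite flat0_gt0 H subr_gt0 => ->.
Qed.

Lemma bump1_cvg a b t : bump1 k a b t @[k --> \oo] --> ((a < t < b)%R%:R : R).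
Proof.
have -> : ((a < t < b)%R%:R : R) = (0 < t - a)%R%:R * (0 < b - t)%R%:R.
  by rewrite !subr_gt0 -natrM mulnb.
by apply: cvgM; exact: flat0_cvg.
Qed.

Definition bump k (a b : 'I_d -> R) : X -> R := tensor (fun i => bump1 k (a i) (b i)).

Definition obox (a b : 'I_d -> R) : set X := [set x | forall i, a i < x ord0 i < b i].

Lemma bump_ge0 k a b x : 0 <= bump k a b x.
Proof. by apply: prodr_ge0 => i _; exact: bump1_ge0. Qed.

Lemma bump_le1 k a b x : bump k a b x <= 1.
Proof. by apply: prodr_ile1 => i; rewrite bump1_ge0 bump1_le1. Qed.

Lemma bump_neq0 k a b x : bump k a b x != 0 -> obox a b x.
Proof.
move=> /prodf_neq0 H i; rewrite -(bump1_gt0 k) lt_neqAle eq_sym H//.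
exact: bump1_ge0.
Qed.

Lemma bump_gt0 k a b x : obox a b x -> 0 < bump k a b x.
Proof. by move=> H; apply: prodr_gt0 => i _; rewrite bump1_gt0 H. Qed.

Lemma bump_cvg a b x : bump k a b x @[k --> \oo] --> (\1_(obox a b) x : R).
Proof.
have -> : (\1_(obox a b) x : R) = \prod_i (a i < x ord0 i < b i)%R%:R.
  rewrite indicE; case: (boolP (_ \in _)) => [/set_mem H|].
    by rewrite big1// => i _; rewrite H.
  rewrite notin_setE => /existsNP[i /negP/negbTE Hi].
  by rewrite (bigD1 i)//= Hi mul0r.
apply: cvg_big; first exact: mul_continuous.
by move=> i _; exact: bump1_cvg.
Qed.

End tensor_test_functions.

(** * The du Bois-Reymond lemma *)

Section density_measure.
Context d (T : measurableType d) (R : realType) (mu : {measure set T -> \bar R}).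
Variables (f : T -> \bar R) (mf : measurable_fun setT f) (f0 : forall x, (0 <= f x)%E).

(** The two proofs are arguments of the definition so that the measure structure can be attached to
    [density_measure mf f0]. *)
Definition density_measure of measurable_fun setT f & (forall x, (0 <= f x)%E) :=
  fun A : set T => (\int[mu]_(x in A) f x)%E.

Let dm0 : density_measure mf f0 set0 = 0%E.
Proof. exact: integral_set0. Qed.

Let dm_ge0 A : (0 <= density_measure mf f0 A)%E.
Proof. by apply: integral_ge0 => x _; exact: f0. Qed.

Let dm_sigma : semi_sigma_additive (density_measure mf f0).
Proof. exact: semi_sigma_additive_nng_induced. Qed.

HB.instance Definition _ := isMeasure.Build _ _ _ (density_measure mf f0) dm0 dm_ge0 dm_sigma.

End density_measure.

Section uniqueness.
Context {R : realType} {d : nat}.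
Local Notation X := 'rV[R]_d.
Local Notation mu := (@lebesgue_rV R d).

Definition oboxes : set (set X) := [set A | exists a b, A = obox a b].

Lemma measurable_obox a b : measurable (obox a b : set X).
Proof.
apply: (@measurable_forall_ord _ _ _ (fun i => [set x : X | a i < x ord0 i < b i])) => i.
rewrite (_ : mkset _ = (fun v : X => v ord0 i : measurableTypeR R) @^-1` `]a i, b i[).
  rewrite -[X in measurable X]setTI.
  exact: (@measurable_rV_entry R d i measurableT _ (measurable_itv _)).
by apply/seteqP; split => x /=; rewrite in_itv/=.
Qed.

Lemma obox_setI a b a' b' : obox a b `&` obox a' b' =
  obox (fun i => Num.max (a i) (a' i)) (fun i => Num.min (b i) (b' i)) :> set X.
Proof.
apply/seteqP; split => [x [H1 H2] i|x H]; first by rewrite lt_min gt_max; have /andP[-> ->] := H1 i; have /andP[-> ->] := H2 i.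
by split => i; have := H i; rewrite lt_min gt_max => /andP[/andP[? ?] /andP[? ?]]; apply/andP.
Qed.

Lemma bigcup_obox : \bigcup_k (obox (fun=> - k.+1%:R) (fun=> k.+1%:R)) = [set: X].
Proof.
apply/seteqP; split => // x _; exists (Num.truncn `|x|) => // i.
rewrite -ltr_norml; apply: le_lt_trans (rV_entry_le x i) _; exact: truncnS_gt.
Qed.

(** A slab constraining a single coordinate is the union over k of the open boxes whose other sides
    are ]-k-1, k+1[; hence each coordinate is measurable for the sigma-algebra of open boxes. *)
Lemma measurable_oboxesE : @measurable _ X = <<s oboxes >>.
Proof.
apply/seteqP; split => A; last first.
  apply: smallest_sub; first exact: sigma_algebra_measurable.
  by move=> _ [a [b ->]]; exact: measurable_obox.
pose T := g_sigma_algebraType oboxes.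
have mid : measurable_fun [set: T] (id : T -> X).
  apply: (@measurable_fun_rV R d _ T) => i.
  apply: (measurability _ (RGenOpens.measurableE R)) => _ [_ [a [b ->]] <-].
  rewrite setTI (_ : _ @^-1` _ = \bigcup_k obox (fun j => if j == i then a else - k.+1%:R)
     (fun j => if j == i then b else k.+1%:R)).
    apply: (@bigcupT_measurable _ T) => k; apply: sub_sigma_algebra.
    by eexists; eexists.
  apply/seteqP; split => [x /=|x [k _ /(_ i)]]; last first.
    by rewrite eqxx /= in_itv.
  rewrite /rV_coord/= in_itv/= => xab.
  have [k _ xk] : (\bigcup_k (obox (fun=> - k.+1%:R) (fun=> k.+1%:R))) (x : X).
    by rewrite bigcup_obox.
  by exists k => // j; case: eqP => [->//|_]; exact: xk.
by move=> mA; have := mid measurableT A mA; rewrite setTI preimage_id.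
Qed.

Variable h : X -> R.
Hypothesis mh : measurable_fun setT h.
Hypothesis h_loc : forall r, (\int[mu]_(x in cbox r) `|h x|%:E < +oo)%E.
Hypothesis h_test : forall u, rtest u -> (\int[mu]_x (h x * u x))%R = 0.

Let obox_sub_cbox a b : exists2 r, 0 < r & obox a b `<=` (cbox r : set X).
Proof.
exists (\sum_i (`|a i| + `|b i|) + 1); first by rewrite ltr_wpDl// sumr_ge0// => i _; rewrite addr_ge0.
move=> x xab i; have /andP[ax xb] := xab i.
have H : `|a i| + `|b i| <= \sum_i (`|a i| + `|b i|).
  by rewrite (bigD1 i)//= lerDl sumr_ge0// => j _; rewrite addr_ge0.
have := ler_norm (a i); have := ler_norm (b i); have := ler_norm (- a i); have := ler_norm (- b i).
rewrite !normrN ler_norml => ? ? ? ?; apply/andP; split; lra.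
Qed.

Let h_int r : mu.-integrable setT (fun x => (`|h x| * \1_(cbox r) x)%:E).
Proof.
apply/integrableP; split.
  apply/measurable_EFinP; apply: measurable_funM; first exact: measurableT_comp.
  by apply: measurable_indic; exact: measurable_cbox.
apply: le_lt_trans (h_loc r); rewrite [leRHS]integral_mkcond.
apply: ge0_le_integral_any => x _ //=.
by rewrite patchE indicE; case: ifP => _; rewrite ?mulr1 ?mulr0 ?normr0 ?normr_id.
Qed.

Lemma rtest_bump k a b : rtest (bump k a b : X -> R).
Proof.
split; first by apply: rsmooth_tensor => i; exact: smooth1_bump1.
have [r r0 H] := obox_sub_cbox a b; exists r => // x /bump_neq0; exact: H.
Qed.

(** Dominated convergence along the bumps of the box, all bounded by the indicator of one larger
    closed box. *)
Let int_obox a b : (\int[mu]_(x in obox a b) (h x)%:E = 0)%E.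
Proof.
have [r r0 abr] := obox_sub_cbox a b.
have m1 : measurable_fun setT (\1_(obox a b) : X -> R).
  by apply: measurable_indic; exact: measurable_obox.
have mb k : measurable_fun setT (bump k a b : X -> R).
  apply: continuous_measurable_rV.
  by have [/(_ [::])[]] := rtest_bump k a b.
have bound k x : `|h x * bump k a b x| <= `|h x| * \1_(cbox r) x.
  rewrite normrM ler_wpM2l// indicE; case: (boolP (_ \in _)) => [_|].
    by rewrite ger0_norm ?bump_ge0 ?bump_le1.
  rewrite notin_setE => xr; have [->|/bump_neq0/abr//] := eqVneq (bump k a b x) 0.
  by rewrite normr0.
have [|||||_ _] := @dominated_convergence _ _ _ mu setT measurableT
  (fun k x => (h x * bump k a b x)%:E) (fun x => (h x * \1_(obox a b) x)%:E)
  (fun x => (`|h x| * \1_(cbox r) x)%:E).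
- by move=> k; apply/measurable_EFinP; exact: measurable_funM.
- by apply/measurable_EFinP; exact: measurable_funM.
- apply: nearW => x _; apply: cvg_EFin; first exact: nearW.
  by apply: cvgMr; exact: bump_cvg.
- exact: h_int.
- by apply: nearW => x k _; rewrite /= lee_fin.
have E k : (\int[mu]_x (h x * bump k a b x)%:E = 0)%E.
  have ifin : mu.-integrable setT (fun x => (h x * bump k a b x)%:E).
    apply: le_integrable (h_int r) => //; first by apply/measurable_EFinP; exact: measurable_funM.
    by move=> x _; rewrite /= lee_fin (le_trans (bound k x))// ler_norm.
  rewrite -[LHS]fineK; last exact: integrable_fin_num.
  by congr EFin; exact: (h_test (rtest_bump k a b)).
under eq_fun do rewrite E.
move=> /cvg_lim; rewrite lim_cst// => /(_ _)/esym H.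
rewrite integral_mkcond -[RHS]H//; apply: eq_integral => x _.
by rewrite patchE indicE; case: ifP => _; rewrite ?mulr1 ?mulr0.
Qed.

(** The measures with densities h^+ and h^- agree on open boxes, which are stable under intersection
    and generate the Borel sets, hence on all Borel sets. Thus h^+ = h^- almost everywhere, and
    since one of the two always vanishes, h = 0. *)
Lemma rtest_ortho_ae0 : \forall x \ae mu, h x = 0.
Proof.
pose H x := (h x)%:E; have mH : measurable_fun setT H by exact/measurable_EFinP.
have mp := measurable_funepos mH; have mn := measurable_funeneg mH.
have int_cbox r : mu.-integrable (cbox r) H.
  apply/integrableP; split; first exact: measurable_funTS.
  exact: h_loc.
have pm A : oboxes A ->
    density_measure mu mp (funepos_ge0 H) A = density_measure mu mn (funeneg_ge0 H) A.
  move=> [a [b ->]]; have [r r0 abr] := obox_sub_cbox a b.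
  have intab : mu.-integrable (obox a b) H.
    apply: integrableS (int_cbox r) => //; first exact: measurable_cbox.
    exact: measurable_obox.
  have := int_obox a b; rewrite integralE.
  have := integrable_pos_fin_num (measurable_obox a b) intab.
  have := integrable_neg_fin_num (measurable_obox a b) intab.
  rewrite /density_measure /=.
  by move=> ? ? /eqP; rewrite sube_eq// add0e => /eqP.
have pmA A : measurable A ->
    (\int[mu]_(x in A) H^\+ x = \int[mu]_(x in A) H^\- x)%E.
  apply: (@measure_unique _ _ _ oboxes (fun k => obox (fun=> - k.+1%:R) (fun=> k.+1%:R))
    measurable_oboxesE _ _ bigcup_obox (density_measure mu mp (funepos_ge0 H))
    (density_measure mu mn (funeneg_ge0 H)) pm).
  - move=> _ _ [a [b ->]] [a' [b' ->]]; rewrite obox_setI; by eexists; eexists.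
  - by move=> k; eexists; eexists.
  - move=> k; have [r r0 abr] := obox_sub_cbox (fun=> - k.+1%:R) (fun=> k.+1%:R).
    have := integral_funepos_lt_pinfty (measurable_cbox r) (int_cbox r).
    apply: le_lt_trans.
    by apply: ge0_subset_integral_any.
have aek k : \forall x \ae mu, cbox k%:R x -> (H^\+ x = H^\- x)%E.
  apply: (@integral_ae_eq _ _ _ mu (cbox k%:R) (measurable_cbox _)).
  - apply: integrable_funepos; [exact: measurable_cbox|exact: int_cbox].
  - exact: measurable_funTS.
  - by move=> A _ mA; exact: pmA.
have := ae_foralln aek.
apply: filterS => x xk.
have : (H^\+ x = H^\- x)%E.
  apply: (xk (Num.truncn `|x|).+1) => i.
  by rewrite (le_trans (rV_entry_le x i))// ltW// truncnS_gt.
rewrite funeposE funenegE /H -EFinN -!EFin_max => -[].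
have [h0|/ltW h0] := leP 0 (h x).
  by rewrite (_ : Num.max (- h x) 0 = 0)//; apply/max_idPr; rewrite oppr_le0.
rewrite (_ : Num.max (- h x) 0 = - h x); last by apply/max_idPl; rewrite oppr_ge0.
by move=> /esym/eqP; rewrite oppr_eq0 => /eqP.
Qed.

End uniqueness.

(** * Taylor estimates and the calculus of test functions *)

Section mean_value_bounds.
Context {R : realType}.

Lemma mvt_bound1 (F F' : R -> R) (B h : R) : (forall t : R, is_derive t 1 F (F' t)) ->
  (forall t, `|t| <= `|h| -> `|F' t| <= B) -> `|F h - F 0| <= B * `|h|.
Proof.
move=> FF' F'B.
have cF : continuous F.
  by move=> t; have [+ _] := FF' t; move=> /derivable1_diffP/differentiable_continuous.
have [h0|h0] := leP 0 h.
  have [c] := MVT_segment h0 (fun t _ => FF' t) (continuous_subspaceT cF).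
  rewrite in_itv/= subr0 => /andP[c0 ch] ->; rewrite normrM ler_wpM2r//.
  by apply: F'B; rewrite !ger0_norm.
have [c] := MVT_segment (ltW h0) (fun t _ => FF' t) (continuous_subspaceT cF).
rewrite in_itv/= distrC sub0r => /andP[ch c0] ->; rewrite normrM normrN ler_wpM2r//.
by apply: F'B; rewrite !ler0_norm ?lerN2// ltW.
Qed.

(** The first-order bound applied to t -> F t - t F' 0, whose derivative F' t - F' 0 is itself at
    most B |h|. *)
Lemma mvt_bound2 (F F' F'' : R -> R) (B h : R) : (forall t : R, is_derive t 1 F (F' t)) ->
  (forall t : R, is_derive t 1 F' (F'' t)) ->
  (forall t, `|t| <= `|h| -> `|F'' t| <= B) -> `|F h - F 0 - h * F' 0| <= B * h ^+ 2.
Proof.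
move=> FF' FF'' F''B.
have dG (t : R) : is_derive t 1 (fun t => F t + t * (- F' 0)) (F' t - F' 0).
  have H : is_derive t 1 (fun t => t * (- F' 0)) (1 * (- F' 0) + t * 0).
    exact: (@is_derive_mul1 R id (cst (- F' 0)) t 1 0 (is_derive_id _ _) (is_derive_cst _ _ _)).
  move: H; rewrite mulr0 addr0 mul1r => H.
  exact: (@is_deriveD _ _ _ F (fun t => t * (- F' 0))).
have GB t : `|t| <= `|h| -> `|F' t - F' 0| <= B * `|h|.
  move=> th; apply: le_trans (mvt_bound1 FF'' (B := B) _) _.
    by move=> s st; apply: F''B; exact: le_trans th.
  by rewrite ler_wpM2l// (le_trans _ (F''B 0 _))// normr0.
have := mvt_bound1 dG GB.
rewrite mul0r addr0 -mulrA -normrM -expr2 ger0_norm ?sqr_ge0//.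
by rewrite mulrN addrAC.
Qed.

End mean_value_bounds.

Section test_calculus.
Context {R : realType} {d : nat}.
Local Notation X := 'rV[R]_d.
Local Notation mu := (@lebesgue_rV R d).
Local Notation e_ i := (delta_mx ord0 i : X).
Implicit Types (u v : X -> R) (s : seq 'I_d).

(** Derivatives are indexed by lists of directions, since the representation formula adds directions
    one at a time; the translation to multi-indices is made later by [mseq] and [mx]. *)
Definition rD s u : X -> R := foldr rpderiv u s.

Lemma rtest_continuous u : rtest u -> continuous u.
Proof. by move=> [/(_ [::])[]]. Qed.

Lemma rtest_measurable u : rtest u -> measurable_fun setT u.
Proof. by move=> /rtest_continuous; exact: continuous_measurable_rV. Qed.

Lemma rtest_bound u : rtest u -> exists2 M, 0 < M & forall x, `|u x| <= M.
Proof.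
move=> tu; have [_ [r r0 ur]] := tu.
have : compact (u @` cbox r).
  apply: continuous_compact; last exact: compact_cbox.
  by apply: continuous_subspaceT; exact: rtest_continuous.
move=> /compact_bounded[M [_ HM]]; exists (`|M| + 1); first by rewrite ltr_wpDl.
move=> x; have [->|/ur xr] := eqVneq (u x) 0; first by rewrite normr0 addr_ge0.
by apply: (HM (`|M| + 1)); [rewrite ltr_pwDr// ler_norm|exists x].
Qed.

Lemma rtest_derive u i x : rtest u -> is_derive x (e_ i) u (rpderiv i u x).
Proof. by move=> [su _]; apply: DeriveDef => //; have [_] := su [::]; exact. Qed.

Lemma rpderiv_support i u r : (forall x, u x != 0 -> cbox r x) ->
  forall x, rpderiv i u x != 0 -> cbox r x.
Proof.
move=> ur x; apply: contra_neqP => xr; apply: rpderiv_near0.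
have : nbhs x (~` @cbox R d r).
  apply: open_nbhs_nbhs; split => //; apply: closed_openC; exact: closed_cbox.
by apply: filterS => y yr; apply/eqP; apply: contra_notT yr; exact: ur.
Qed.

Lemma rD_support s u r : (forall x, u x != 0 -> cbox r x) ->
  forall x, rD s u x != 0 -> cbox r x.
Proof. by move=> ur; elim: s => //= i s; exact: rpderiv_support. Qed.

Lemma rtest_rpderiv i u : rtest u -> rtest (rpderiv i u).
Proof.
move=> [su [r r0 ur]]; split; first exact: rsmooth_rpderiv.
by exists r => //; exact: rpderiv_support.
Qed.

Lemma rtest_rD s u : rtest u -> rtest (rD s u).
Proof. by move=> tu; elim: s => //= i s; exact: rtest_rpderiv. Qed.

Lemma rtest_line u i x (t : R) : rtest u ->
  is_derive t 1 (fun h => u (h *: e_ i + x)) (rpderiv i u (t *: e_ i + x)).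
Proof.
by move=> tu; have [H _] := is_derive_line u x (e_ i) t (rpderiv i u (t *: e_ i + x));
  exact: H (rtest_derive i (t *: e_ i + x) tu).
Qed.

Lemma rtest_lip1 u i : rtest u ->
  exists2 C, 0 <= C & forall x h, `|u (h *: e_ i + x) - u x| <= C * `|h|.
Proof.
move=> tu; have [C C0 HC] := rtest_bound (rtest_rpderiv i tu).
exists C; first exact: ltW.
move=> x h; have := mvt_bound1 (fun t => rtest_line i x t tu) (B := C) (h := h).
by rewrite scale0r add0r; apply => t _; exact: HC.
Qed.

Lemma rtest_quad u i : rtest u ->
  exists2 C, 0 <= C & forall x h, `|u (h *: e_ i + x) - u x - h * rpderiv i u x| <= C * h ^+ 2.
Proof.
move=> tu; have tui := rtest_rpderiv i tu.
have [C C0 HC] := rtest_bound (rtest_rpderiv i tui).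
exists C; first exact: ltW.
move=> x h; have := mvt_bound2 (fun t => rtest_line i x t tu)
  (fun t => rtest_line i x t tui) (B := C) (h := h).
by rewrite !scale0r !add0r; apply => t _; exact: HC.
Qed.

(** The segment from y to x is replaced by a path that changes one coordinate at a time, and each
    coordinate costs at most its Lipschitz constant times the sup norm. *)
Lemma rtest_lipschitz u : rtest u ->
  exists2 C, 0 <= C & forall x y, `|u x - u y| <= C * `|x - y|.
Proof.
move=> tu.
have /choice[C HC] : forall i, exists C : R, 0 <= C /\ forall x h, `|u (h *: e_ i + x) - u x| <= C * `|h|.
  by move=> i; have [C ? ?] := rtest_lip1 i tu; exists C.
exists (\sum_i C i); first by apply: sumr_ge0 => i _; have [] := HC i.
move=> x y.
have H s : `|u (\sum_(i <- s) ((x - y) ord0 i) *: e_ i + y) - u y| <= \sum_(i <- s) C i * `|x - y|.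
  elim: s => [|i s ih]; first by rewrite !big_nil add0r subrr normr0.
  rewrite !big_cons -addrA.
  set z := \sum_(_ <- s) _ + y in ih *.
  rewrite -[X in X - u y](subrK (u z)) -addrA; apply: le_trans (ler_normD _ _) _.
  apply: lerD => //; have [C0 /(_ z ((x - y) ord0 i)) H] := HC i.
  by apply: le_trans H _; rewrite ler_wpM2l// rV_entry_le.
rewrite mulr_suml; have := H (index_enum _).
suff -> : \sum_i ((x - y) ord0 i) *: e_ i + y = x by [].
by rewrite -row_sum_delta subrK.
Qed.

Let translate_quotient (V : X -> R) i c x :
  (fun h => h^-1 *: (((fun y => V (y + c)) \o shift x) (h *: e_ i) - V (x + c))) =
  (fun h => h^-1 *: ((V \o shift (x + c)) (h *: e_ i) - V (x + c))).
Proof. by apply/funext => h /=; rewrite addrA. Qed.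

Lemma rpderiv_translate i u (c : X) :
  rpderiv i (fun x => u (x + c)) = (fun x => rpderiv i u (x + c)).
Proof.
by apply/funext => x; rewrite /rpderiv /derive translate_quotient.
Qed.

Lemma rD_translate s u (c : X) : rD s (fun x => u (x + c)) = (fun x => rD s u (x + c)).
Proof. by elim: s => //= i s ->; exact: rpderiv_translate. Qed.

Lemma rtest_translate u (c : X) : rtest u -> rtest (fun x => u (x + c)).
Proof.
move=> tu; split.
  move=> s /=; rewrite -/(rD s (fun x => u (x + c))) rD_translate; have [su _] := tu.
  have cD : continuous (fun x : X => rD s u (x + c)).
    move=> x; apply: (@continuous_comp _ _ _ (fun x : X => x + c) (rD s u)).
      by apply: (@cvgD R X X (nbhs x) _ (id : X -> X) (cst c)); [exact: cvg_id|exact: cvg_cst].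
    by have [cs _] := su s; exact: cs.
  split => // i x; have [_ /(_ i (x + c))] := su s.
  by rewrite /derivable translate_quotient.
have [_ [r r0 ur]] := tu; exists (r + `|c|); first by rewrite ltr_pwDl.
move=> x /ur H i; have -> : x ord0 i = (x + c) ord0 i - c ord0 i by rewrite mxE addrK.
by apply: le_trans (ler_normB _ _) _; apply: lerD => //; exact: rV_entry_le.
Qed.

Lemma le_quad_eq (a b C : R) : 0 <= C ->
  (forall t : R, 0 < t -> `|t ^+ 2 * a - t ^+ 2 * b| <= C * t ^+ 3) -> a = b.
Proof.
move=> C0 H; apply/eqP; rewrite -subr_eq0 -normr_le0; apply/ler_addgt0Pr => e e0.
have t0 : 0 < e / (C + 1) by rewrite divr_gt0// ltr_wpDl.
(* This t = e / (C + 1) makes C t at most e once the factor t^2 has been cancelled. *)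
have := H _ t0; set t := e / _ in t0 *; rewrite -mulrBr normrM ger0_norm ?sqr_ge0//.
have -> : C * t ^+ 3 = t ^+ 2 * (C * t) by ring.
rewrite ler_pM2l ?exprn_gt0// add0r => /le_trans; apply.
apply: (@le_trans _ _ ((C + 1) * t)); first by rewrite ler_wpM2r ?lerDl// ltW.
by rewrite /t mulrC divfK// gt_eqF// ltr_wpDl.
Qed.

Lemma second_difference_dist (D p q r T A B C1 C2 : R) :
  `|D - p - q + r - T * B| <= C1 -> `|D - q - p + r - T * A| <= C2 -> `|T * A - T * B| <= C1 + C2.
Proof.
move=> E1 E2; have -> : T * A - T * B = (D - p - q + r - T * B) - (D - q - p + r - T * A) by ring.
by apply: le_trans (ler_normB _ _) _; exact: lerD.
Qed.

Lemma rpderivC u i j : rtest u -> rpderiv i (rpderiv j u) = rpderiv j (rpderiv i u).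
Proof.
move=> tu.
(* t^-2 times the second difference, which is symmetric in k and l, tends to both mixed derivatives. *)
have H k l : exists2 C, 0 <= C & forall x t, 0 < t ->
    `|u (t *: e_ k + (t *: e_ l + x)) - u (t *: e_ k + x) - u (t *: e_ l + x) + u x
      - t ^+ 2 * rpderiv l (rpderiv k u) x| <= C * t ^+ 3.
  have tk := rtest_rpderiv k tu; have tkk := rtest_rpderiv k tk.
  have [C1 C10 H1] := rtest_quad l tk; have [C2 C20 H2] := rtest_lip1 l tkk.
  exists (C1 + C2); first exact: addr_ge0.
  move=> x t t0.
  have dF (s : R) : is_derive s 1 (fun s : R => u (s *: e_ k + (t *: e_ l + x)) - u (s *: e_ k + x))
     (rpderiv k u (s *: e_ k + (t *: e_ l + x)) - rpderiv k u (s *: e_ k + x)).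
    apply: (@is_deriveB _ _ _ (fun s : R => u (s *: e_ k + (t *: e_ l + x))) (fun s : R => u (s *: e_ k + x)));
      exact: rtest_line.
  have dF' (s : R) : is_derive s 1 (fun s : R => rpderiv k u (s *: e_ k + (t *: e_ l + x)) - rpderiv k u (s *: e_ k + x))
     (rpderiv k (rpderiv k u) (s *: e_ k + (t *: e_ l + x)) - rpderiv k (rpderiv k u) (s *: e_ k + x)).
    apply: (@is_deriveB _ _ _ (fun s : R => rpderiv k u (s *: e_ k + (t *: e_ l + x))) (fun s : R => rpderiv k u (s *: e_ k + x)));
      exact: rtest_line.
  have bd (s : R) : `|s| <= `|t| -> `|rpderiv k (rpderiv k u) (s *: e_ k + (t *: e_ l + x)) - rpderiv k (rpderiv k u) (s *: e_ k + x)| <= C2 * t.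
    by move=> _; rewrite addrCA; apply: le_trans (H2 _ _) _; rewrite ger0_norm// ltW.
  have := mvt_bound2 dF dF' bd; rewrite !scale0r !add0r => E2.
  have E1 := H1 x t.
  have -> : u (t *: e_ k + (t *: e_ l + x)) - u (t *: e_ k + x) - u (t *: e_ l + x) + u x
      - t ^+ 2 * rpderiv l (rpderiv k u) x =
    (u (t *: e_ k + (t *: e_ l + x)) - u (t *: e_ k + x) - (u (t *: e_ l + x) - u x)
      - t * (rpderiv k u (t *: e_ l + x) - rpderiv k u x)) +
    t * (rpderiv k u (t *: e_ l + x) - rpderiv k u x - t * rpderiv l (rpderiv k u) x) by ring.
  apply: le_trans (ler_normD _ _) _; rewrite mulrDl [leRHS]addrC; apply: lerD.
    by apply: le_trans E2 _; rewrite -mulrA -exprS.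
  rewrite normrM (gtr0_norm t0) exprS mulrCA ler_pM2l//.
have [C1 C10 H1] := H i j; have [C2 C20 H2] := H j i.
apply/funext => x; apply: (@le_quad_eq _ _ (C1 + C2)); first exact: addr_ge0.
move=> t t0; have := H1 x t t0; have := H2 x t t0.
rewrite (addrCA (t *: e_ j)) mulrDl => E2 E1; exact: second_difference_dist E1 E2.
Qed.

Lemma rD_rpderiv i s u : rtest u -> rD s (rpderiv i u) = rpderiv i (rD s u).
Proof.
move=> tu; elim: s => //= j s ->; apply: rpderivC; exact: rtest_rD.
Qed.

Lemma rD_cat s1 s2 u : rD (s1 ++ s2) u = rD s1 (rD s2 u).
Proof. exact: foldr_cat. Qed.

(** A multi-index yields a sorted list of directions, a concatenation such as [b ++ s] does not;
    symmetry of mixed derivatives makes the two comparable. *)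
Lemma rD_perm s1 s2 u : rtest u -> perm_eq s1 s2 -> rD s1 u = rD s2 u.
Proof.
move=> tu; elim: s1 s2 => [s2|i s1 ih s2 p12]; first by rewrite perm_sym => /perm_nilP ->.
have is2 : i \in s2 by rewrite -(perm_mem p12) mem_head.
case/splitPr: is2 p12 => a b; rewrite perm_sym perm_catC /= perm_cons => p.
rewrite rD_cat /= rD_rpderiv; last exact: rtest_rD.
by rewrite -rD_cat (ih (a ++ b))// perm_sym perm_catC.
Qed.

End test_calculus.

(** * Bounded functions of bounded support and integration by parts *)

Section bounded_compact_support.
Context {R : realType} {d : nat}.
Local Notation X := 'rV[R]_d.
Local Notation mu := (@lebesgue_rV R d).
Local Notation e_ i := (delta_mx ord0 i : X).
Implicit Types (f g K u v : X -> R) (s : seq 'I_d).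

(** A class containing both the test functions and the discontinuous kernels [ker]; its members are
    integrable against every locally integrable function. *)
Definition bcs f : Prop := measurable_fun setT f /\
  exists M r, [/\ 0 <= M, 0 <= r & forall x, `|f x| <= M * \1_(cbox r) x].

Lemma measurable_cbox_indic r : measurable_fun setT (\1_(cbox r) : X -> R).
Proof. by apply: measurable_indic; exact: measurable_cbox. Qed.

Lemma bcs_integrable f : bcs f -> mu.-integrable setT (EFin \o f).
Proof.
move=> [mf [M [r [M0 r0 fM]]]]; apply/integrableP; split; first exact/measurable_EFinP.
apply: (@le_lt_trans _ _ (\int[mu]_x (M * \1_(cbox r) x)%:E)%E).
  by apply: ge0_le_integral_any => x _ //=; rewrite lee_fin.
under eq_integral do rewrite EFinM.
rewrite ge0_integralZl//; last by apply/measurable_EFinP; exact: measurable_cbox_indic.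
rewrite integral_indic//; last exact: measurable_cbox.
by rewrite setIT lte_mul_pinfty// lebesgue_cbox_lty.
Qed.

Lemma rtest_bcs u : rtest u -> bcs u.
Proof.
move=> tu; split; first exact: rtest_measurable.
have [M M0 uM] := rtest_bound tu; have [_ [r r0 ur]] := tu.
exists M, r; split; [exact: ltW|exact: ltW|] => x.
rewrite indicE; case: (boolP (_ \in _)) => [_|]; first by rewrite mulr1.
rewrite notin_setE => xr; have [->|/ur//] := eqVneq (u x) 0.
by rewrite normr0 mulr0.
Qed.

Lemma bcs_le f g c : measurable_fun setT f -> bcs g -> (forall x, `|f x| <= c * `|g x|) -> bcs f.
Proof.
move=> mf [_ [M [r [M0 r0 gM]]]] fg; split => //; exists (`|c| * M), r; split => //.
  by rewrite mulr_ge0.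
move=> x; apply: le_trans (fg x) _; apply: (@le_trans _ _ (`|c| * `|g x|)).
  by rewrite ler_wpM2r// ler_norm.
by rewrite -mulrA ler_wpM2l.
Qed.

Lemma bcsMl f g c : measurable_fun setT f -> (forall x, `|f x| <= c) -> bcs g ->
  bcs (fun x => f x * g x).
Proof.
move=> mf fc bg; apply: (@bcs_le _ g c) => //; first by apply: measurable_funM => //; exact: bg.1.
by move=> x; rewrite normrM ler_wpM2r.
Qed.

Lemma bcs_bound f : bcs f -> exists c, forall x, `|f x| <= c.
Proof.
move=> [_ [M [r [M0 r0 fM]]]]; exists M => x; apply: le_trans (fM x) _.
by rewrite indicE; case: (_ \in _); rewrite ?mulr1 ?mulr0.
Qed.

Lemma bcsM f g : bcs f -> bcs g -> bcs (fun x => f x * g x).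
Proof. by move=> bf; have [c fc] := bcs_bound bf; apply: (@bcsMl _ _ c) => //; exact: bf.1. Qed.

Lemma bcs_abs f : bcs f -> bcs (fun x => `|f x|).
Proof.
move=> bf; apply: (@bcs_le _ f 1) => //; last by move=> x; rewrite normr_id mul1r.
by apply: measurableT_comp => //; exact: bf.1.
Qed.

Lemma bcs_translate f c : bcs f -> bcs (fun x => f (x + c)).
Proof.
move=> [mf [M [r [M0 r0 fM]]]]; split.
  by apply: measurableT_comp mf _; exact: measurable_translate.
exists M, (r + `|c|); split => //; first exact: addr_ge0.
move=> x; apply: le_trans (fM _) _; rewrite ler_wpM2l// !indicE ler_nat.
case: (boolP (x + c \in _)) => // /set_mem H; rewrite mem_set// => i.
have -> : x ord0 i = (x + c) ord0 i - c ord0 i by rewrite mxE addrK.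
by apply: le_trans (ler_normB _ _) _; apply: lerD => //; exact: rV_entry_le.
Qed.

Lemma bcsB f g : bcs f -> bcs g -> bcs (fun x => f x - g x).
Proof.
move=> [mf [M [r [M0 r0 fM]]]] [mg [N [q [N0 q0 gN]]]]; split; first exact: measurable_funB.
exists (M + N), (r + q); split; [exact: addr_ge0|exact: addr_ge0|] => x.
apply: le_trans (ler_normB _ _) _; rewrite mulrDl; apply: lerD.
  apply: le_trans (fM x) _; rewrite ler_wpM2l// !indicE ler_nat.
  case: (boolP (x \in cbox r)) => // /set_mem H; rewrite mem_set// => i.
  by apply: le_trans (H i) _; rewrite lerDl.
apply: le_trans (gN x) _; rewrite ler_wpM2l// !indicE ler_nat.
case: (boolP (x \in cbox q)) => // /set_mem H; rewrite mem_set// => i.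
by apply: le_trans (H i) _; rewrite lerDr.
Qed.

Lemma bcsZ f c : bcs f -> bcs (fun x => c * f x).
Proof. by apply: (@bcsMl (fun=> c) f `|c|) => //; exact: measurable_cst. Qed.

Lemma Rintegral_bound f g : measurable_fun setT f -> mu.-integrable setT (EFin \o g) ->
  (forall x, `|f x| <= g x) -> `|\int[mu]_x f x| <= \int[mu]_x g x.
Proof.
move=> mf ig fg.
have intf : mu.-integrable setT (EFin \o f).
  apply: le_integrable ig => //; first exact/measurable_EFinP.
  by move=> x _ /=; rewrite lee_fin (le_trans (fg x))// ler_norm.
apply: le_trans (le_normr_Rintegral _ _) _ => //.
apply: le_Rintegral => //.
exact: (@integrable_norm _ _ _ mu setT f).
Qed.

Lemma le_lin_eq (a b C : R) : 0 <= C ->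
  (forall t : R, 0 < t -> `|t * a - t * b| <= C * t ^+ 2) -> a = b.
Proof.
move=> C0 H; apply: (@le_quad_eq _ _ _ C) => // t t0.
have -> : t ^+ 2 * a - t ^+ 2 * b = t * (t * a - t * b) by ring.
rewrite normrM (gtr0_norm t0); have -> : C * t ^+ 3 = t * (C * t ^+ 2) by ring.
by rewrite ler_pM2l// H.
Qed.

Lemma Rintegral_translate f c : lmeasurable f ->
  \int[mu]_x f (x + c) = \int[mu]_x f x.
Proof.
move=> mf; rewrite -(Rintegral_reflect c mf) -(@Rintegral_reflect R d (fun x => f (c - x)) 0).
  by apply: eq_Rintegral => x _; rewrite sub0r opprK addrC.
exact: lmeasurable_reflect.
Qed.

Lemma ibp_dist (a b p q t D1 D2 : R) : `|a - b - t * p| <= D1 -> `|a - b - - t * q| <= D2 ->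
  `|t * p - t * - q| <= D1 + D2.
Proof.
move=> H1 H2; have -> : t * p - t * - q = (a - b - - t * q) - (a - b - t * p) by ring.
by apply: le_trans (ler_normB _ _) _; rewrite addrC; exact: lerD.
Qed.

(** Translation invariance gives int u(x + t e_i) v(x) = int u(x) v(x - t e_i). Both sides are
    expanded to first order in t with an error O(t^2), and the coefficients of t are compared. *)
Lemma rtest_ibp i u v : rtest u -> rtest v ->
  \int[mu]_x (rpderiv i u x * v x) = - \int[mu]_x (u x * rpderiv i v x).
Proof.
move=> tu tv; have tu' := rtest_rpderiv i tu; have tv' := rtest_rpderiv i tv.
have bu := rtest_bcs tu; have bv := rtest_bcs tv.
have bu' := rtest_bcs tu'; have bv' := rtest_bcs tv'.
have [C1 C10 H1] := rtest_quad i tu; have [C2 C20 H2] := rtest_quad i tv.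
pose A t := \int[mu]_x (u (x + t *: e_ i) * v x).
have key (f g w : X -> R) t C : bcs f -> bcs g -> bcs w -> 0 <= C ->
   (forall x, `|f (t *: e_ i + x) - f x - t * w x| <= C * t ^+ 2) ->
   `|\int[mu]_x (f (x + t *: e_ i) * g x) - \int[mu]_x (f x * g x) - t * \int[mu]_x (w x * g x)|
     <= (C * \int[mu]_x `|g x|) * t ^+ 2.
  move=> {}bu {}bv bw C0 H.
  have b1 : bcs (fun x => f (x + t *: e_ i) * g x) by apply: bcsM => //; exact: bcs_translate.
  have b2 := bcsM bu bv; have b3 := bcsZ t (bcsM bw bv).
  rewrite -RintegralZl//; last exact: bcs_integrable (bcsM bw bv).
  rewrite -RintegralB//; try exact: bcs_integrable.
  rewrite -RintegralB//; try exact: bcs_integrable; last exact: bcs_integrable (bcsB b1 b2).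
  rewrite -mulrA [X in C * X]mulrC mulrA -RintegralZl//; last exact: bcs_integrable (bcs_abs bv).
  apply: Rintegral_bound.
  - exact: (bcsB (bcsB b1 b2) b3).1.
  - exact: bcs_integrable (bcsZ _ (bcs_abs bv)).
  - move=> x; have -> : f (x + t *: e_ i) * g x - f x * g x - t * (w x * g x) =
      (f (t *: e_ i + x) - f x - t * w x) * g x by rewrite (addrC x); ring.
    by rewrite normrM ler_wpM2r.
have Rge0 (w : X -> R) : 0 <= \int[mu]_x `|w x| by exact: Rintegral_ge0.
apply: (@le_lin_eq _ _ (C1 * \int[mu]_x `|v x| + C2 * \int[mu]_x `|u x|)).
  by rewrite addr_ge0// mulr_ge0.
move=> t t0.
have E1 := key u v (rpderiv i u) t C1 bu bv bu' C10 (fun x => H1 x t).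
have E2 := key v u (rpderiv i v) (- t) C2 bv bu bv' C20 (fun x => H2 x (- t)).
have EA : \int[mu]_x (v (x + (- t) *: e_ i) * u x) = A t.
  rewrite -[LHS](@Rintegral_translate (fun x => v (x + - t *: e_ i) * u x) (t *: e_ i)).
    by apply: eq_Rintegral => x _; rewrite scaleNr addrK mulrC.
  apply: borel_lmeasurable; apply: measurable_funM; last exact: bu.1.
  exact: (bcs_translate _ bv).1.
have EB : \int[mu]_x (v x * u x) = \int[mu]_x (u x * v x).
  by apply: eq_Rintegral => x _; rewrite mulrC.
have EC : \int[mu]_x (rpderiv i v x * u x) = \int[mu]_x (u x * rpderiv i v x).
  by apply: eq_Rintegral => x _; rewrite mulrC.
move: E1 E2; rewrite EA EB EC sqrrN -/(A t) mulrDl; exact: ibp_dist.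
Qed.

End bounded_compact_support.

(** * Correlation of a kernel with a test function *)

Section test_convolution.
Context {R : realType} {d : nat}.
Local Notation X := 'rV[R]_d.
Local Notation mu := (@lebesgue_rV R d).
Local Notation e_ i := (delta_mx ord0 i : X).
Implicit Types (f g K u v : X -> R) (s : seq 'I_d).

Lemma lipschitz_continuous_rV (u : X -> R) C :
  (forall x y, `|u x - u y| <= C * `|x - y|) -> continuous u.
Proof.
move=> uC x; apply/(@cvgrPdist_le R R X (nbhs (x : X)) (nbhs_filter (x : X))) => e e0; near=> y.
apply: le_trans (uC _ _) _; apply: (@le_trans _ _ ((`|C| + 1) * `|x - y|)).
  by rewrite ler_wpM2r// (le_trans (ler_norm C))// lerDl.
rewrite mulrC -ler_pdivlMr ?ltr_wpDl//; near: y.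
have e1 : 0 < e / (`|C| + 1) by rewrite divr_gt0// ltr_wpDl.
by have := nbhsx_ballx x _ e1; apply: filterS => y; rewrite -ball_normE => /ltW.
Unshelve. all: by end_near. Qed.

(** The correlation of K with u, that is, the transpose of convolution by K; see [pairing_Kint]. *)
Definition Kint K u (x : X) : R := \int[mu]_y (K y * u (x + y)).

Let bcs_shift u x : rtest u -> bcs (fun y => u (x + y)).
Proof.
by move=> /rtest_bcs/(bcs_translate x); congr bcs; apply/funext => y; rewrite addrC.
Qed.

(** A family of continuous functions closed under partial derivatives consists of smooth functions.
    Indexing by a type T with a map [der] lets the index carry the proof that it is a test
    function. *)
Lemma rsmooth_step (T : Type) (P : T -> X -> R) (der : 'I_d -> T -> T) :
  (forall t, continuous (P t)) -> (forall i t x, is_derive x (e_ i) (P t) (P (der i t) x)) ->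
  forall t s, rD s (P t) = P (foldr der t s) /\ rsmooth (P t).
Proof.
move=> cP dP.
have H t s : rD s (P t) = P (foldr der t s).
  elim: s => //= i s ->; apply/funext => x; rewrite /rpderiv.
  by have [_ ->] := dP i (foldr der t s) x.
move=> t s; split=> // s'; rewrite -/(rD s' (P t)) H; split => // i x; have [] := dP i (foldr der t s') x.
Qed.

(** Differentiation under the integral sign: the quadratic remainder of u is uniform in the point,
    so it is only multiplied by the integral of |K|. The support grows by the radius of that of
    K. *)
Lemma Kint_rtest K u s : bcs K -> rtest u -> rtest (Kint K u) /\ rD s (Kint K u) = Kint K (rD s u).
Proof.
move=> bK tu.
have bKa := bcs_abs bK.
pose T := {u : X -> R | rtest u}.
pose der i (t : T) : T := exist _ (rpderiv i (sval t)) (rtest_rpderiv i (svalP t)).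
have bKs (t : T) x : bcs (fun y => K y * (sval t) (x + y)).
  by apply: bcsM => //; apply: bcs_shift; exact: svalP.
have cP (t : T) : continuous (Kint K (sval t)).
  have [C C0 HC] := rtest_lipschitz (svalP t).
  apply: (@lipschitz_continuous_rV _ (C * \int[mu]_y `|K y|)) => x y.
  rewrite /Kint -RintegralB//; try exact: bcs_integrable.
  rewrite mulrAC -RintegralZl//; last exact: bcs_integrable.
  apply: Rintegral_bound; [exact: (bcsB _ _).1|exact: bcs_integrable (bcsZ _ _)|].
  move=> z; rewrite -mulrBr normrM mulrC ler_wpM2r//.
  by apply: le_trans (HC _ _) _; rewrite opprD addrACA subrr addr0.
have dP i (t : T) x : is_derive x (e_ i) (Kint K (sval t)) (Kint K (sval (der i t)) x).
  have [C C0 HC] := rtest_quad i (svalP t).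
  apply: (@is_derive_quad _ _ _ _ _ _ (C * \int[mu]_y `|K y|)) => h _.
  have b2 := bcsZ h (bKs (der i t) x).
  rewrite /Kint -RintegralZl//; last exact: bcs_integrable.
  rewrite -RintegralB//; try exact: bcs_integrable.
  rewrite -RintegralB//; try exact: bcs_integrable; last exact: bcs_integrable (bcsB _ _).
  rewrite mulrAC -RintegralZl//; last exact: bcs_integrable.
  apply: Rintegral_bound; [exact: (bcsB (bcsB _ _) _).1|exact: bcs_integrable (bcsZ _ _)|].
  move=> y; have -> : K y * sval t (h *: e_ i + x + y) - K y * sval t (x + y) -
      h * (K y * sval (der i t) (x + y)) =
      K y * (sval t (h *: e_ i + (x + y)) - sval t (x + y) - h * rpderiv i (sval t) (x + y)).
    by rewrite addrA /=; ring.
  by rewrite normrM mulrC ler_wpM2r.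
have H := rsmooth_step cP dP.
have [H1 H2] := H (exist _ u tu) s.
split; last first.
  rewrite -[u in Kint K u]/(sval (exist _ u tu : T)) H1; congr Kint.
  by elim: s {H1} => //= i s ->.
split => //.
have [_ [M [r [M0 r0 KM]]]] := bK; have [_ [q q0 uq]] := tu.
exists (r + q); first exact: ltr_wpDl.
move=> x; apply: contra_neqP => xrq; rewrite /Kint.
rewrite [RHS](_ : 0 = \int[mu]_y (0 : R)); last by rewrite /Rintegral integral0.
apply: eq_Rintegral => y _.
have [->|/uq H3] := eqVneq (u (x + y)) 0; first by rewrite mulr0.
have := KM y; rewrite indicE; case: (boolP (y \in _)) => [/set_mem yr|_].
  move=> _; exfalso; apply: xrq => i.
  have -> : x ord0 i = (x + y) ord0 i - y ord0 i by rewrite mxE addrK.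
  by apply: le_trans (ler_normB _ _) _; rewrite addrC; apply: lerD.
by rewrite mulr0 normr_le0 => /eqP ->; rewrite mul0r.
Qed.

End test_convolution.

(** * Freezing the first coordinate *)

Section slices.
Context {R : realType} {n : nat}.

Lemma rV_cons_line (t h : R) (v : 'rV[R]_n) i :
  rV_cons (t, h *: delta_mx ord0 i + v) = h *: delta_mx ord0 (lift ord0 i) + rV_cons (t, v).
Proof.
apply: rV_consP => [|j]; rewrite ?rV_consE0 ?rV_consES [RHS]mxE ?rV_consE0 ?rV_consES !mxE ?eqxx /=.
  by rewrite mulr0 add0r.
by rewrite (inj_eq lift_inj).
Qed.

Lemma rV_cons_line0 (t h : R) (v : 'rV[R]_n) :
  rV_cons (t + h, v) = h *: delta_mx ord0 ord0 + rV_cons (t, v).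
Proof.
apply: rV_consP => [|j]; rewrite ?rV_consE0 ?rV_consES [RHS]mxE ?rV_consE0 ?rV_consES !mxE ?eqxx /=.
  by rewrite mulr1 addrC.
by rewrite mulr0 add0r.
Qed.

Lemma slice_derive (u : 'rV[R]_n.+1 -> R) t v i l :
  is_derive (rV_cons (t, v)) (delta_mx ord0 (lift ord0 i)) u l ->
  is_derive v (delta_mx ord0 i) (fun v => u (rV_cons (t, v))) l.
Proof.
have E : (fun h => h^-1 *: ((u \o shift (rV_cons (t, v))) (h *: delta_mx ord0 (lift ord0 i)) - u (rV_cons (t, v)))) =
  (fun h => h^-1 *: (((fun v => u (rV_cons (t, v))) \o shift v) (h *: delta_mx ord0 i) - u (rV_cons (t, v)))).
  by apply/funext => h /=; rewrite rV_cons_line.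
by move=> -[df <-]; apply: DeriveDef; rewrite /derivable /derive -E.
Qed.

Lemma slice_derive0 (u : 'rV[R]_n.+1 -> R) t v l :
  is_derive (rV_cons (t, v)) (delta_mx ord0 ord0) u l ->
  is_derive t 1 (fun t => u (rV_cons (t, v))) l.
Proof.
have E : (fun h => h^-1 *: ((u \o shift (rV_cons (t, v))) (h *: delta_mx ord0 ord0) - u (rV_cons (t, v)))) =
  (fun h : R => h^-1 *: (((fun t => u (rV_cons (t, v))) \o shift t) (h *: 1) - u (rV_cons (t, v)))).
  by apply/funext => h /=; rewrite [_ *: 1]mulr1 [h + t]addrC rV_cons_line0.
by move=> -[df <-]; apply: DeriveDef; rewrite /derivable /derive -E.
Qed.

(** This feeds the induction on the dimension in [rtest_representation0]: direction i of the slice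
    is direction [lift ord0 i] of u. *)
Lemma slice_rtest (u : 'rV[R]_n.+1 -> R) t s : rtest u ->
  rtest (fun v => u (rV_cons (t, v))) /\
  rD s (fun v => u (rV_cons (t, v))) = (fun v => rD (map (lift ord0) s) u (rV_cons (t, v))).
Proof.
move=> tu.
pose T := {u : 'rV[R]_n.+1 -> R | rtest u}.
pose P (w : T) := fun v : 'rV[R]_n => sval w (rV_cons (t, v)).
pose der i (w : T) : T := exist _ (rpderiv (lift ord0 i) (sval w)) (rtest_rpderiv (lift ord0 i) (svalP w)).
have cP w : continuous (P w).
  have [C C0 HC] := rtest_lipschitz (svalP w).
  apply: (@lipschitz_continuous_rV _ _ _ C) => v v'; apply: le_trans (HC _ _) _.
  rewrite ler_wpM2l// rV_norm_le//; apply/forallP => i; rewrite mxE [X in _ + X]mxE.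
  case: (unliftP ord0 i) => [j|] ->; last by rewrite !rV_consE0 subrr normr0.
  by rewrite !rV_consES; have := rV_entry_le (v - v') j; rewrite !mxE.
have dP i (w : T) v : is_derive v (delta_mx ord0 i) (P w) (P (der i w) v).
  by apply: slice_derive; exact: (rtest_derive _ _ (svalP w)).
have H := rsmooth_step cP dP.
have [H1 H2] := H (exist _ u tu) s.
split; last first.
  rewrite -[fun v => u _]/(P (exist _ u tu)) H1 /P; apply/funext => v; congr (_ _).
  by elim: s {H1} => //= i s ->.
split => //; have [_ [r r0 ur]] := tu; exists r => // v /ur H3 i.
by have := H3 (lift ord0 i); rewrite rV_consES.
Qed.

Lemma Rintegral_rVS (f : 'rV[R]_n.+1 -> R) :
  (@lebesgue_rV R n.+1).-integrable setT (EFin \o f) ->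
  \int[@lebesgue_rV R n.+1]_x f x =
  \int[@lebesgue_rV R n]_v \int[lebesgue_measure]_t f (rV_cons (t, v)).
Proof.
move=> intf.
have mc := @measurable_rV_cons R n.
pose g := (EFin \o f) \o @rV_cons R n.
have mf : measurable_fun setT (EFin \o f) := measurable_int _ intf.
have intg : (lebesgue_measure \x @lebesgue_rV R n)%E.-integrable setT g.
  apply/integrableP; split; first exact: measurableT_comp mf mc.
  have mabs : measurable_fun setT (abse \o (EFin \o f)) by exact: measurableT_comp.
  have /integrableP[_] := intf; congr (_ < _)%E.
  have := @ge0_integral_pushforward _ _ _ _ R _ mc (lebesgue_measure \x @lebesgue_rV R n)%E
    setT (abse \o (EFin \o f)) measurableT mabs (fun x _ => abse_ge0 _).
  by rewrite preimage_setT.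
transitivity (fine (\int[lebesgue_measure \x @lebesgue_rV R n]_p g p)%E).
  congr fine.
  have := @integral_pushforward _ _ _ _ R _ mc (lebesgue_measure \x @lebesgue_rV R n)%E
    setT (EFin \o f) mf.
  by rewrite preimage_setT => /(_ intg measurableT).
rewrite -integral21_prod_meas1//; congr fine; apply: integral_ae_any.
have := ae_integrable2 intg; apply: filterS => v /= intv.
by rewrite fineK//; exact: integrable_fin_num.
Qed.

End slices.

(** * A test function as an integral of its derivatives of order at most one in each variable *)

Section ftc.
Context {R : realType}.
Variable r : R.
Hypothesis r0 : 0 < r.

(* u(0) is the integral over [0, r] of u(t) / r - (1 - t / r) u'(t). *)
Definition ker1 (b : bool) (t : R) : R :=
  \1_(`[0, r]%classic) t * (if b then - (1 - t / r) else r^-1).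

Lemma ker1_bound b t : `|ker1 b t| <= (1 + r^-1) * \1_(`[0, r]%classic) t.
Proof.
rewrite /ker1 indicE; case: (boolP (t \in _)) => [/set_mem|_]; last by rewrite mul0r mulr0 normr0.
rewrite /= in_itv /= mul1r mulr1 => /andP[t0 tr]; case: b; last first.
  by rewrite ger0_norm ?invr_ge0 ?(ltW r0)// lerDr.
rewrite normrN; apply: (@le_trans _ _ 1); last by rewrite lerDl invr_ge0 ltW.
have := divr_ge0 t0 (ltW r0); have : t / r <= 1 by rewrite ler_pdivrMr// mul1r.
by rewrite ler_norml => *; apply/andP; split; lra.
Qed.

Lemma measurable_ker1 b : measurable_fun setT (ker1 b).
Proof.
apply: measurable_funM; first by apply: measurable_indic.
case: b; last exact: measurable_cst.
apply: measurableT_comp => //; apply: measurable_funB => //.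
by apply: measurable_funM => //; exact: measurable_cst.
Qed.

Lemma integrable_ker1 b (w : R -> R) M : measurable_fun setT w -> (forall t, `|w t| <= M) ->
  lebesgue_measure.-integrable setT (fun t => (ker1 b t * w t)%:E).
Proof.
move=> mw wM; have M0 : 0 <= M := le_trans (normr_ge0 _) (wM 0).
have H : lebesgue_measure.-integrable setT (fun t : R => (((1 + r^-1) * M) * \1_(`[0, r]%classic) t)%:E).
  by under eq_fun do rewrite EFinM; apply: integrableZl => //; exact: integrable_indic_itv.
apply: le_integrable H => //.
  by apply/measurable_EFinP; apply: measurable_funM => //; exact: measurable_ker1.
move=> t _ /=; rewrite lee_fin normrM [leRHS]ger0_norm.
  by rewrite mulrAC; apply: ler_pM => //; exact: ker1_bound.
by rewrite mulr_ge0 ?indic_ge0// mulr_ge0// addr_ge0// invr_ge0 ltW.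
Qed.

Lemma ftc_ker1 (F F' : R -> R) : (forall t : R, is_derive t 1 F (F' t)) -> continuous F' ->
  \int[lebesgue_measure]_t (ker1 false t * F t + ker1 true t * F' t) = F 0.
Proof.
move=> FF' cF'.
have cF : continuous F.
  by move=> t; have [+ _] := FF' t; move=> /derivable1_diffP/differentiable_continuous.
(* This antiderivative of the integrand vanishes at r and equals - F 0 at 0. *)
pose G t := - (1 - t / r) * F t.
pose g t := r^-1 * F t + - (1 - t / r) * F' t.
have dG (t : R) : is_derive t 1 G (g t).
  apply: is_derive_mul1 => //.
  have H : is_derive t 1 (fun t : R => id (r^-1 * t + - 1)) (r^-1 * 1).
    by apply: is_derive_affine; exact: is_derive_id.
  move: H; rewrite mulr1; congr is_derive.
  by apply/funext => s /=; rewrite opprB mulrC.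
have cg : continuous g.
  move=> t; apply: cvgD; apply: cvgM; [exact: cvg_cst|exact: cF| |exact: cF'].
  by apply: cvgN; apply: cvgB; [exact: cvg_cst|apply: cvgM; [exact: cvg_id|exact: cvg_cst]].
have H := @continuous_FTC2 R g G 0 r r0 _ _ _.
rewrite (_ : (fun t => _) = g \_ `[0, r]); last first.
  apply/funext => t; rewrite patchE /ker1 indicE; case: ifP => _.
    by rewrite !mul1r.
  by rewrite !mul0r addr0.
rewrite -Rintegral_mkcond /Rintegral H.
- by rewrite -EFinB /= /G divff ?gt_eqF// subrr oppr0 !mul0r sub0r subr0 mulN1r opprK.
- exact: continuous_subspaceT.
- have dGt t : derivable G t 1 by have [] := dG t.
  have cG : continuous G by move=> t; exact/differentiable_continuous/derivable1_diffP.
  split => //.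
  + by apply: cvg_at_right_filter; exact: cG.
  + by apply: cvg_at_left_filter; exact: cG.
- by move=> t _; rewrite derive1E; have [] := dG t.
Qed.

(** Applied to [enum 'I_n] this enumerates the sets of coordinates to be differentiated, without
    repetition inside each list. *)
Fixpoint subseqs (T : Type) (l : seq T) : seq (seq T) :=
  if l is i :: l' then subseqs l' ++ map (cons i) (subseqs l') else [:: [::]].

Lemma subseqs_map (T U : Type) (f : T -> U) l :
  subseqs (map f l) = map (map f) (subseqs l).
Proof. by elim: l => //= i l ->; rewrite map_cat -!map_comp. Qed.

(** The coordinates in b carry the kernel paired with the derivative, the others the kernel paired
    with the function. *)
Definition ker n (b : seq 'I_n) (y : 'rV[R]_n) : R := \prod_i ker1 (i \in b) (y ord0 i).

Lemma ker_cons n (b : seq 'I_n.+1) t (v : 'rV[R]_n) :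
  ker b (rV_cons (t, v)) = ker1 (ord0 \in b) t * \prod_i ker1 (lift ord0 i \in b) (v ord0 i).
Proof.
rewrite /ker big_ord_recl rV_consE0; congr (_ * _).
by apply: eq_bigr => i _; rewrite rV_consES.
Qed.

Lemma measurable_ker n (b : seq 'I_n) : measurable_fun setT (ker b).
Proof.
apply: measurable_prod => i _.
exact: (measurableT_comp (measurable_ker1 _) (measurable_rV_entry i)).
Qed.

Lemma ker_bound n (b : seq 'I_n) y : `|ker b y| <= (1 + r^-1) ^+ n * \1_(cbox r) y.
Proof.
have c0 : 0 <= 1 + r^-1 by rewrite addr_ge0// invr_ge0 ltW.
have [yr|yr] := pselect (forall i, y ord0 i \in `[0, r]).
  rewrite indicE mem_set; last first.
    by move=> i; have := yr i; rewrite in_itv/= => /andP[y0 ?]; rewrite ger0_norm.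
  rewrite mulr1 /ker normr_prod; apply: (@le_trans _ _ (\prod_(i < n) (1 + r^-1))).
    apply: ler_prod => i _; rewrite normr_ge0/=; apply: le_trans (ker1_bound _ _) _.
    by rewrite indicE mem_set ?mulr1 ?lexx//; exact: yr.
  by rewrite prodr_const card_ord.
rewrite (_ : ker b y = 0) ?normr0; first by rewrite mulr_ge0 ?exprn_ge0.
have /existsNP[i yi] := yr; rewrite /ker (bigD1 i)//= /ker1 indicE memNset ?mul0r//.
Qed.

Lemma ker_bcs n (b : seq 'I_n) : bcs (ker b).
Proof.
split; first exact: measurable_ker.
exists ((1 + r^-1) ^+ n), r; split; [|exact: ltW|exact: ker_bound].
by rewrite exprn_ge0// addr_ge0// invr_ge0 ltW.
Qed.

(** Induction on the dimension, starting from the Dirac mass on R^0: [ftc_ker1] in the first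
    coordinate turns the formula for n + 1 variables into the formula for the slice at 0. *)
Lemma rtest_representation0 n (u : 'rV[R]_n -> R) : rtest u ->
  \sum_(b <- subseqs (enum 'I_n)) \int[@lebesgue_rV R n]_y (ker b y * rD b u y) = u 0.
Proof.
elim: n u => [|n ih] u tu.
  rewrite enum_ord0 /= big_seq1 /=.
  rewrite /Rintegral integral_dirac//; last first.
    apply/measurable_EFinP; apply: measurable_funM; first exact: measurable_ker.
    exact: rtest_measurable.
  by rewrite diracT mul1e /ker big_ord0 mul1r.
(* Each set of coordinates avoiding the first one is matched with the same set with [ord0] added;
   the sum of the two terms is what [ftc_ker1] evaluates. *)
rewrite enum_ordSl /= subseqs_map big_cat /= !big_map -big_split /=.
have [tu0 _] := slice_rtest 0 [::] tu.
have u0E : u 0 = (fun v => u (rV_cons (0, v))) 0.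
  congr u; apply: rV_consP => [|i]; rewrite ?rV_consE0 ?rV_consES !mxE//.
rewrite u0E -[RHS](ih (fun v => u (rV_cons (0, v))))//; apply: eq_bigr => b _.
set U := rD (map (lift ord0) b) u.
have tU : rtest U by exact: rtest_rD.
have tU0 : rtest (rpderiv ord0 U) by exact: rtest_rpderiv.
have b1 := bcsM (ker_bcs (map (lift ord0) b)) (rtest_bcs tU).
have b2 := bcsM (ker_bcs (ord0 :: map (lift ord0) b)) (rtest_bcs tU0).
rewrite -RintegralD//; [|exact: bcs_integrable..].
rewrite Rintegral_rVS; last first.
  have b3 : bcs (fun y => ker (map (lift ord0) b) y * U y - (-1) * (ker (ord0 :: map (lift ord0) b) y * rpderiv ord0 U y)).
    by apply: bcsB => //; exact: bcsZ.
  have := bcs_integrable b3; congr (_.-integrable _ _).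
  by apply/funext => y /=; rewrite mulN1r opprK.
apply: eq_Rintegral => v _.
have lift0 : (ord0 \in map (lift ord0) b) = false.
  by apply/negbTE/mapP => -[j _ /eqP]; rewrite (negbTE (neq_lift _ _)).
have -> : (fun t => ker (map (lift ord0) b) (rV_cons (t, v)) * U (rV_cons (t, v)) +
   ker (ord0 :: map (lift ord0) b) (rV_cons (t, v)) * rpderiv ord0 U (rV_cons (t, v))) =
  (fun t => ker b v * (ker1 false t * U (rV_cons (t, v)) + ker1 true t * rpderiv ord0 U (rV_cons (t, v)))).
  apply/funext => t; rewrite !ker_cons lift0 mem_head.
  have -> : \prod_i ker1 (lift ord0 i \in map (lift ord0) b) (v ord0 i) = ker b v.
    by apply: eq_bigr => i _; rewrite mem_map//; exact: lift_inj.
  move: (ker1 false t) (ker1 true t) (U _) (rpderiv _ _ _) (ker b v) => a1 a2 a3 a4 a5.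
  by ring.
have [_ E0] := slice_rtest 0 b tu; rewrite E0 -/U.
have dU (w : 'rV[R]_n.+1 -> R) (t : R) : rtest w ->
    is_derive t 1 (fun t => w (rV_cons (t, v))) (rpderiv ord0 w (rV_cons (t, v))).
  by move=> tw; apply: slice_derive0; exact: rtest_derive.
have cU (w : 'rV[R]_n.+1 -> R) : rtest w -> continuous (fun t : R => w (rV_cons (t, v))).
  by move=> tw t; have [+ _] := dU w t tw; move=> /derivable1_diffP/differentiable_continuous.
rewrite RintegralZl//.
  congr (_ * _); apply: (ftc_ker1 (F := fun t => U (rV_cons (t, v)))); last exact: cU.
  by move=> t; exact: dU.
have H c (w : 'rV[R]_n.+1 -> R) : rtest w ->
    lebesgue_measure.-integrable setT (fun t : R => (ker1 c t * w (rV_cons (t, v)))%:E).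
  move=> tw; have [M M0 wM] := rtest_bound tw.
  apply: integrable_ker1 (fun t => wM _).
  exact: continuous_measurable_fun (cU w tw).
have := integrableD measurableT (H false U tU) (H true _ tU0).
by congr (_.-integrable _ _); apply/funext => t /=; rewrite EFinD.
Qed.

Lemma rtest_representation n (u : 'rV[R]_n -> R) x : rtest u ->
  u x = \sum_(b <- subseqs (enum 'I_n)) Kint (ker b) (rD b u) x.
Proof.
move=> tu; have tux := rtest_translate x tu.
have := rtest_representation0 tux; rewrite add0r => <-.
apply: eq_bigr => b _; apply: eq_Rintegral => y _.
by rewrite rD_translate addrC.
Qed.

End ftc.

(** * Locally integrable functions as distributions *)

Section pairing.
Context {R : realType} {d : nat}.
Local Notation X := 'rV[R]_d.
Local Notation mu := (@lebesgue_rV R d).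
Local Notation Re := (@complex.Re R).
Local Notation Im := (@complex.Im R).
Implicit Types (f g h : X -> R[i]) (K u v : X -> R) (s : seq 'I_d).

(** The distribution of g evaluated at a real function u, which may also be a kernel from [bcs] and
    need not be smooth. *)
Definition pairing g u : R[i] := cintegral (fun x => g x * (u x)%:C).

Lemma L1loc_ae f g : L1loc f -> (\forall x \ae mu, g x = f x) -> L1loc g.
Proof.
move=> [mf fK] gf; split; first exact: cmeasurable_ae mf gf.
move=> K cK; rewrite (@integral_ae_any _ _ _ mu K _ (fun x => (normc (f x))%:E)); first exact: fK.
by apply: filterS gf => x ->.
Qed.

Lemma pairing_ae f g u : (\forall x \ae mu, g x = f x) -> pairing g u = pairing f u.
Proof. by move=> gf; apply: cintegral_ae; apply: filterS gf => x ->. Qed.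

Lemma L1loc_cbox f r : L1loc f -> (\int[mu]_x (normc (f x) * \1_(cbox r) x)%:E < +oo)%E.
Proof.
move=> [_ /(_ (cbox r) (@compact_cbox R d r))]; apply: le_lt_trans.
rewrite [leRHS]integral_mkcond; apply: ge0_le_integral_any => x _.
  by rewrite lee_fin mulr_ge0 ?normc_ge0.
by rewrite patchE indicE; case: ifP => _; rewrite ?mulr1 ?mulr0.
Qed.

Lemma L1loc_repr f : L1loc f -> exists g, [/\ cborel g, L1loc g & \forall x \ae mu, f x = g x].
Proof.
move=> lf; have [g bg fg] := cmeasurable_repr lf.1; exists g; split => //.
by apply: L1loc_ae lf _; apply: filterS fg => x ->.
Qed.

Lemma integral_pairing_lty f u : L1loc f -> bcs u ->
  (\int[mu]_x (normc (f x) * `|u x|)%:E < +oo)%E.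
Proof.
move=> lf [mu_ [M [r [M0 r0 uM]]]].
have [g [bg lg fg]] := L1loc_repr lf.
rewrite (@integral_ae_any _ _ _ mu setT _ (fun x => (normc (g x) * `|u x|)%:E)); last first.
  by apply: filterS fg => x ->.
apply: (@le_lt_trans _ _ (\int[mu]_x (M%:E * (normc (g x) * \1_(cbox r) x)%:E))%E).
  apply: ge0_le_integral_any => x _; first by rewrite lee_fin mulr_ge0 ?normc_ge0.
  by rewrite -EFinM lee_fin mulrCA ler_wpM2l ?normc_ge0.
rewrite ge0_integralZl//.
- by rewrite lte_mul_pinfty// L1loc_cbox.
- apply/measurable_EFinP; apply: measurable_funM; first exact: measurable_normc.
  exact: measurable_cbox_indic.
- by move=> x _; rewrite lee_fin mulr_ge0 ?normc_ge0.
Qed.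

Lemma cintegrable_pairing f u : cborel f -> L1loc f -> bcs u ->
  cintegrable (fun x => f x * (u x)%:C).
Proof.
move=> bf lf bu; apply: cintegrableP; first by apply: cborelM => //; apply: cborel_real; exact: bu.1.
under eq_integral do rewrite normcM normc_real; exact: integral_pairing_lty.
Qed.

Lemma pairing_sum f (T : Type) (l : seq T) (c : T -> X -> R) : L1loc f ->
  (forall t, bcs (c t)) -> pairing f (fun x => \sum_(t <- l) c t x) = \sum_(t <- l) pairing f (c t).
Proof.
move=> lf bc; have [g [bg lg fg]] := L1loc_repr lf.
rewrite (pairing_ae _ fg) (eq_bigr (fun t => pairing g (c t))) => [|t _]; last exact: pairing_ae.
(* Integrability of the partial sums is carried along, because additivity of [cintegral] requires it
   at each step. *)
suff H : cintegrable (fun x => g x * (\sum_(t <- l) c t x)%:C) /\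
    pairing g (fun x => \sum_(t <- l) c t x) = \sum_(t <- l) pairing g (c t) by exact: H.2.
elim: l => [|t l [ih1 ih2]].
  have -> : (fun x => g x * (\sum_(t <- [::]) c t x)%:C) = (fun=> 0).
    by apply/funext => x; rewrite big_nil mulr0.
  split; first by split; exact: integrable0.
  rewrite big_nil /pairing; have -> : (fun x => g x * (\sum_(t <- [::]) c t x)%:C) = (fun=> 0).
    by apply/funext => x; rewrite big_nil mulr0.
  by apply: complex_eqP; rewrite /= /Rintegral integral0.
have bct := cintegrable_pairing bg lg (bc t).
have E : (fun x => g x * (\sum_(j <- t :: l) c j x)%:C) =
   (fun x => g x * (c t x)%:C + g x * (\sum_(t <- l) c t x)%:C).
  by apply/funext => x; rewrite big_cons rmorphD mulrDr.
rewrite /pairing E; split.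
  case: bct ih1 => [r1 i1] [r2 i2]; split.
    by under eq_fun do rewrite ReD EFinD; exact: integrableD.
  by under eq_fun do rewrite ImD EFinD; exact: integrableD.
by rewrite cintegralD// big_cons -/(pairing g (c t)) -ih2.
Qed.

Lemma pairingD f g u : L1loc f -> L1loc g -> bcs u ->
  pairing (fun x => f x + g x) u = pairing f u + pairing g u.
Proof.
move=> lf lg bu; have [f' [bf' lf' ff']] := L1loc_repr lf; have [g' [bg' lg' gg']] := L1loc_repr lg.
rewrite (pairing_ae _ ff') (pairing_ae _ gg').
rewrite (@pairing_ae (fun x => f' x + g' x)); last by apply: filterS2 ff' gg' => x -> ->.
rewrite /pairing -cintegralD; [|exact: cintegrable_pairing..].
by congr cintegral; apply/funext => x; rewrite mulrDl.
Qed.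

Lemma pairingZ a f u : L1loc f -> bcs u -> pairing (fun x => a * f x) u = a * pairing f u.
Proof.
move=> lf bu; have [f' [bf' lf' ff']] := L1loc_repr lf.
rewrite (pairing_ae _ ff') (@pairing_ae (fun x => a * f' x)); last first.
  by apply: filterS ff' => x ->.
rewrite /pairing -cintegralZl; last exact: cintegrable_pairing.
by congr cintegral; apply/funext => x; rewrite mulrA.
Qed.

Lemma bcs_reflect K (y : X) : bcs K -> bcs (fun x => K (y - x)).
Proof.
move=> [mK [M [r [M0 r0 KM]]]]; split.
  by apply: measurableT_comp mK _; exact: measurable_reflect.
exists M, (r + `|y|); split => //; first exact: addr_ge0.
move=> x; apply: le_trans (KM _) _; rewrite ler_wpM2l// !indicE ler_nat.
case: (boolP (y - x \in _)) => // /set_mem H; rewrite mem_set// => i.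
have -> : x ord0 i = y ord0 i - (y - x) ord0 i by rewrite !mxE subKr.
by apply: le_trans (ler_normB _ _) _; rewrite addrC; apply: lerD => //; exact: rV_entry_le.
Qed.

(** Fubini for f(x) K(y - x) u(y), followed by a reflection in the inner integral. *)
Lemma pairing_Kint f K u : L1loc f -> bcs K -> rtest u ->
  pairing f (Kint K u) = pairing (convolution f (fun x => (K x)%:C)) u.
Proof.
move=> lf bK tu; have [g [bg lg fg]] := L1loc_repr lf.
have bu := rtest_bcs tu.
rewrite (pairing_ae _ fg) (convolution_ae fg (g' := fun x => (K x)%:C)); last exact: nearW.
have cK := cborel_real bK.1; have cu := cborel_real bu.1.
pose F (p : X * X) := g p.1 * ((K (p.2 - p.1))%:C * (u p.2)%:C).
have bF : cborel F.
  apply: cborelM; first exact: cborel_fst.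
  apply: cborelM; last exact: (cborel_snd cu).
  apply: (@cborel_comp _ _ _ _ _ (fun p : X * X => p.2 - p.1) (fun x => (K x)%:C)) => //.
  exact: measurable_rV_sub.
have realE (w : X -> R) : mu.-integrable setT (EFin \o w) ->
    (\int[mu]_x w x)%:C = cintegral (fun x => (w x)%:C).
  by move=> _; apply: complex_eqP => //=; rewrite /Rintegral integral0.
have sec x : bcs (fun y => K (y - x) * u y).
  apply: bcsM => //; exact: (bcs_translate (- x) bK).
have E1 : pairing g (Kint K u) = cintegral (fun x => cintegral (fun y => F (x, y))).
  congr cintegral; apply/funext => x.
  have -> : Kint K u x = \int[mu]_y (K (y - x) * u y).
    rewrite -[RHS](@Rintegral_translate R d _ x); last exact: borel_lmeasurable (sec x).1.
    by apply: eq_Rintegral => y _; rewrite addrK addrC.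
  rewrite realE; last exact: bcs_integrable.
  rewrite -cintegralZl; last first.
    split; first exact: bcs_integrable (sec x).
    exact: integrable0.
  by congr cintegral; apply/funext => y; rewrite /F /= rmorphM.
have Foo : (\int[mu]_x \int[mu]_y (normc (F (x, y)))%:E < +oo)%E.
  have [_ [M [r [M0 r0 KM]]]] := bK; have [_ [N [q [N0 q0 uN]]]] := bu.
  (* If y lies in the box of u and y - x in that of K, then x lies in the box of radius r + q; local
     integrability of g there is enough. *)
  have bound x y : normc (F (x, y)) <= (M * N) * (normc (g x) * \1_(cbox (r + q)) x) * \1_(cbox q) y.
    rewrite /F /= !normcM !normc_real.
    apply: (@le_trans _ _ (normc (g x) * ((M * \1_(cbox r) (y - x)) * (N * \1_(cbox q) y)))).
      by rewrite ler_wpM2l ?normc_ge0// ler_pM.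
    have -> : M * N * (normc (g x) * \1_(cbox (r + q)) x) * \1_(cbox q) y =
      (M * N * normc (g x)) * (\1_(cbox (r + q)) x * \1_(cbox q) y) by ring.
    have -> : normc (g x) * (M * \1_(cbox r) (y - x) * (N * \1_(cbox q) y)) =
      (M * N * normc (g x)) * (\1_(cbox r) (y - x) * \1_(cbox q) y) by ring.
    rewrite ler_wpM2l ?mulr_ge0 ?normc_ge0// !indicE.
    case: (boolP (y \in cbox q)) => [/set_mem yq|_]; last by rewrite !mulr0.
    rewrite !mulr1 ler_nat; case: (boolP (y - x \in cbox r)) => // /set_mem yxr.
    rewrite mem_set// => i; have -> : x ord0 i = y ord0 i - (y - x) ord0 i by rewrite !mxE subKr.
    by apply: le_trans (ler_normB _ _) _; rewrite addrC; apply: lerD.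
  apply: (@le_lt_trans _ _ (\int[mu]_x ((M * N) * (normc (g x) * \1_(cbox (r + q)) x))%:E * mu (cbox q))%E).
    apply: (@le_trans _ _ (\int[mu]_x (((M * N) * (normc (g x) * \1_(cbox (r + q)) x))%:E * mu (cbox q)))%E).
      apply: ge0_le_integral_any => x _; first by apply: integral_ge0 => y _; rewrite lee_fin normc_ge0.
      apply: (@le_trans _ _ (\int[mu]_y (((M * N) * (normc (g x) * \1_(cbox (r + q)) x))%:E * (\1_(cbox q) y)%:E))%E).
        by apply: ge0_le_integral_any => y _; rewrite ?lee_fin ?normc_ge0// -EFinM lee_fin.
      rewrite ge0_integralZl//.
      - by rewrite integral_indic ?setIT//; exact: measurable_cbox.
      - by apply/measurable_EFinP; exact: measurable_cbox_indic.
      - by rewrite lee_fin mulr_ge0 ?mulr_ge0 ?normc_ge0.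
    rewrite ge0_integralZr//.
    - apply/measurable_EFinP; apply: measurable_funM => //; apply: measurable_funM.
        exact: measurable_normc.
      exact: measurable_cbox_indic.
    - by move=> x _; rewrite lee_fin mulr_ge0 ?mulr_ge0 ?normc_ge0.
  apply: lte_mul_pinfty; last exact: lebesgue_cbox_lty.
    by apply: integral_ge0 => x _; rewrite lee_fin mulr_ge0 ?mulr_ge0 ?normc_ge0.
  have MN0 : 0 <= M * N by rewrite mulr_ge0.
  under eq_integral do rewrite EFinM.
  rewrite ge0_integralZl; first last.
  - by rewrite lee_fin.
  - by move=> x _; rewrite lee_fin mulr_ge0 ?normc_ge0.
  - apply/measurable_EFinP; apply: measurable_funM; first exact: measurable_normc.
    exact: measurable_cbox_indic.
  - exact: measurableT.
  rewrite fin_numM// ge0_fin_numE; first exact: L1loc_cbox.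
  by apply: integral_ge0 => x _; rewrite lee_fin mulr_ge0 ?normc_ge0.
rewrite E1 (cintegral_Fubini bF); last exact: Foo.
congr cintegral; apply/funext => y.
have -> : (fun x => F (x, y)) = (fun x => (u y)%:C * (g x * (K (y - x))%:C)).
  by apply/funext => x; rewrite /F /=; ring.
have lgK : cintegrable (fun x => g x * (K (y - x))%:C).
  by apply: (@cintegrable_pairing g (fun x => K (y - x))) => //; exact: bcs_reflect.
rewrite cintegralZl// mulrC; congr (_ * _).
rewrite -[RHS](@cintegral_reflect R d _ y).
  by congr cintegral; apply/funext => x; rewrite subKr.
apply: cborel_cmeasurable; apply: cborelM => //.
by apply: (@cborel_comp _ _ _ _ _ (fun x : X => y - x) g) => //; exact: measurable_reflect.
Qed.

(** [rtest_ortho_ae0] for the real and the imaginary part of the difference of two Borel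
    representatives. *)
Lemma pairing_unique f g : L1loc f -> L1loc g ->
  (forall u, rtest u -> pairing f u = pairing g u) -> \forall x \ae mu, f x = g x.
Proof.
move=> lf lg fgE; have [f' [bf' lf' ff']] := L1loc_repr lf; have [g' [bg' lg' gg']] := L1loc_repr lg.
have H : forall u, rtest u -> pairing f' u = pairing g' u.
  by move=> u tu; rewrite -(pairing_ae _ ff') -(pairing_ae _ gg') fgE.
have L (h : X -> R) r : measurable_fun setT h -> (forall x, `|h x| <= normc (f' x) + normc (g' x)) ->
   (\int[mu]_(x in cbox r) `|h x|%:E < +oo)%E.
  move=> mh hfg; apply: (@le_lt_trans _ _ (\int[mu]_(x in cbox r) ((normc (f' x))%:E + (normc (g' x))%:E))%E).
    by apply: ge0_le_integral_any => x _; rewrite ?lee_fin// -EFinD lee_fin.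
  rewrite ge0_integralD//; last 5 first.
  - exact: measurable_cbox.
  - by move=> x _; rewrite lee_fin normc_ge0.
  - by apply/measurable_EFinP; apply: measurable_funTS; exact: measurable_normc.
  - by move=> x _; rewrite lee_fin normc_ge0.
  - by apply/measurable_EFinP; apply: measurable_funTS; exact: measurable_normc.
  by rewrite lte_add_pinfty//; [apply: lf'.2|apply: lg'.2]; exact: compact_cbox.
have re0 : \forall x \ae mu, Re (f' x) - Re (g' x) = 0.
  apply: rtest_ortho_ae0.
  - by apply: measurable_funB; [exact: bf'.1|exact: bg'.1].
  - move=> r; apply: L; first by apply: measurable_funB; [exact: bf'.1|exact: bg'.1].
    by move=> x; apply: le_trans (ler_normB _ _) _; apply: lerD; exact: normr_Re_le.
  - move=> u tu; have bu := rtest_bcs tu.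
    have [r1 _] := cintegrable_pairing bf' lf' bu; have [r2 _] := cintegrable_pairing bg' lg' bu.
    have := congr1 Re (H u tu); rewrite /pairing /= => /eqP; rewrite -subr_eq0 -RintegralB// => /eqP.
    move=> <-; apply: eq_Rintegral => x _; rewrite !ReM /=; ring.
have im0 : \forall x \ae mu, Im (f' x) - Im (g' x) = 0.
  apply: rtest_ortho_ae0.
  - by apply: measurable_funB; [exact: bf'.2|exact: bg'.2].
  - move=> r; apply: L; first by apply: measurable_funB; [exact: bf'.2|exact: bg'.2].
    by move=> x; apply: le_trans (ler_normB _ _) _; apply: lerD; exact: normr_Im_le.
  - move=> u tu; have bu := rtest_bcs tu.
    have [_ r1] := cintegrable_pairing bf' lf' bu; have [_ r2] := cintegrable_pairing bg' lg' bu.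
    have := congr1 Im (H u tu); rewrite /pairing /= => /eqP; rewrite -subr_eq0 -RintegralB// => /eqP.
    move=> <-; apply: eq_Rintegral => x _; rewrite !ImM /=; ring.
have fg' : \forall x \ae mu, f' x = g' x.
  by apply: filterS2 re0 im0 => x /subr0_eq r0 /subr0_eq i0; exact: complex_eqP.
by apply: filterS3 ff' gg' fg' => x -> ->.
Qed.

End pairing.

Lemma size_subseqs (T : eqType) (l b : seq T) : b \in subseqs l -> (size b <= size l)%N.
Proof.
elim: l b => [|i l ih] b /=; first by rewrite inE => /eqP ->.
rewrite mem_cat => /orP[/ih/leqW//|/mapP[b' /ih H ->]].
by rewrite ltnS.
Qed.

(** * A Sobolev-type bound for families of weak derivatives *)

Section sobolev.
Context {R : realType} {d : nat}.
Local Notation X := 'rV[R]_d.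
Local Notation mu := (@lebesgue_rV R d).
Implicit Types (f g h : X -> R[i]) (K u v : X -> R) (s : seq 'I_d).

Lemma L1loc_bounded f : cmeasurable f ->
  (forall q, exists B, forall x, cbox q x -> normc (f x) <= B) -> L1loc f.
Proof.
move=> mf H; split => // K cK; have [q q0 Kq] := compact_sub_cbox cK.
have [B HB] := H q.
apply: (@le_lt_trans _ _ (\int[mu]_(x in cbox q) (cst `|B|%:E x))%E).
  apply: (@le_trans _ _ (\int[mu]_(x in cbox q) (normc (f x))%:E)%E).
    by apply: ge0_subset_integral_any => // x _; rewrite lee_fin normc_ge0.
  apply: ge0_le_integral_any => x xq; first by rewrite lee_fin normc_ge0.
  by rewrite lee_fin (le_trans (HB x xq))// ler_norm.
rewrite integral_cst//; last exact: measurable_cbox.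
by rewrite lte_mul_pinfty// lebesgue_cbox_lty.
Qed.

Lemma normc_convolution_bcs f K M r x : cmeasurable f -> bcs K -> 0 <= M ->
  (forall y, `|K y| <= M * \1_(cbox r) y) ->
  ((normc (convolution f (fun y => (K y)%:C) x))%:E <=
   M%:E * \int[mu]_y (normc (f (x - y)) * \1_(cbox r) y)%:E)%E.
Proof.
move=> mf bK M0 KM; apply: le_trans (normc_convolution_le _ _ _) _ => //.
  by apply: cborel_cmeasurable; apply: cborel_real; exact: bK.1.
have [f' bf ff'] := cmeasurable_repr mf.
have E (w : X -> R) : (\int[mu]_y (normc (f (x - y)) * w y)%:E =
    \int[mu]_y (normc (f' (x - y)) * w y)%:E)%E.
  by apply: integral_ae_any; apply: filterS (ae_reflect x ff') => y ->.
rewrite (E (fun y => normc (K y)%:C)) (E (\1_(cbox r))) -ge0_integralZl//; first last.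
- by move=> y _; rewrite lee_fin mulr_ge0 ?normc_ge0.
- apply/measurable_EFinP; apply: measurable_funM; last exact: measurable_cbox_indic.
  exact: (measurableT_comp (measurable_normc bf) (measurable_reflect x)).
apply: ge0_le_integral_any => y _; first by rewrite lee_fin mulr_ge0 ?normc_ge0.
by rewrite -EFinM lee_fin mulrCA ler_wpM2l ?normc_ge0// normc_real.
Qed.

(** The convolution is even locally bounded: for x in the box of radius q only the values of f on
    the box of radius q + r enter. *)
Lemma L1loc_convolution f K : L1loc f -> bcs K -> L1loc (convolution f (fun y => (K y)%:C)).
Proof.
move=> lf bK; have [mK [M [r [M0 r0 KM]]]] := bK.
have mcK : cmeasurable (fun y => (K y)%:C) by apply: cborel_cmeasurable; exact: cborel_real.
apply: L1loc_bounded; first by apply: cmeasurable_convolution => //; exact: lf.1.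
move=> q; pose I := (\int[mu]_y (normc (f y) * \1_(cbox (q + r)) y)%:E)%E.
have I0 : (0 <= I)%E by apply: integral_ge0 => y _; rewrite lee_fin mulr_ge0 ?normc_ge0.
have Ifin : I \is a fin_num by rewrite ge0_fin_numE// L1loc_cbox.
exists (M * fine I) => x xq; rewrite -lee_fin EFinM fineK//.
apply: le_trans (normc_convolution_bcs x lf.1 bK M0 KM) _.
apply: lee_wpmul2l; first by rewrite lee_fin.
have mnf : lmeasurable (fun y => normc (f y) * \1_(cbox (q + r)) y).
  have [f' bf ff'] := cmeasurable_repr lf.1.
  exists (fun y => normc (f' y) * \1_(cbox (q + r)) y).
    by apply: measurable_funM; [exact: measurable_normc|exact: measurable_cbox_indic].
  by apply: filterS ff' => y ->.
rewrite -[leRHS](lintegral_reflect x mnf); last by move=> y; rewrite mulr_ge0 ?normc_ge0.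
apply: ge0_le_integral_any => y _; first by rewrite lee_fin mulr_ge0 ?normc_ge0.
rewrite lee_fin ler_wpM2l ?normc_ge0// !indicE ler_nat.
case: (boolP (y \in _)) => // /set_mem yr; rewrite mem_set// => i.
rewrite !mxE; apply: le_trans (ler_normB _ _) _; apply: lerD; [exact: xq|exact: yr].
Qed.

Lemma L1locD f g : L1loc f -> L1loc g -> L1loc (fun x => f x + g x).
Proof.
move=> [mf fK] [mg gK]; split; first exact: cmeasurableD.
move=> K cK; have mK := compact_measurable_rV cK.
have [f' bf ff'] := cmeasurable_repr mf; have [g' bg gg'] := cmeasurable_repr mg.
apply: (@le_lt_trans _ _ (\int[mu]_(x in K) ((normc (f' x))%:E + (normc (g' x))%:E))%E).
  rewrite (@integral_ae_any _ _ _ mu K _ (fun x => (normc (f' x + g' x))%:E)).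
    by apply: ge0_le_integral_any => x _; rewrite lee_fin ?normc_ge0// le_normcD.
  by apply: filterS2 ff' gg' => x -> ->.
rewrite ge0_integralD//; first last.
- by apply/measurable_EFinP; apply: measurable_funTS; exact: measurable_normc.
- by move=> x _; rewrite lee_fin normc_ge0.
- by apply/measurable_EFinP; apply: measurable_funTS; exact: measurable_normc.
- by move=> x _; rewrite lee_fin normc_ge0.
have E (h h' : X -> R[i]) : (\forall x \ae mu, h x = h' x) ->
   (\int[mu]_(x in K) (normc (h' x))%:E = \int[mu]_(x in K) (normc (h x))%:E)%E.
  by move=> hh'; apply: integral_ae_any; apply: filterS hh' => x ->.
by rewrite (E _ _ ff') (E _ _ gg') lte_add_pinfty// ?fK ?gK.
Qed.

Lemma L1loc0 : L1loc (fun _ : X => 0 : R[i]).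
Proof.
apply: L1loc_bounded; first by apply: cborel_cmeasurable; exact: cborel_cst.
by move=> q; exists 0 => x _; rewrite normc0.
Qed.

Lemma L1locZ a f : L1loc f -> L1loc (fun x => a * f x).
Proof.
move=> [mf fK]; split.
  by apply: cmeasurableM => //; apply: cborel_cmeasurable; exact: cborel_cst.
move=> K cK; have mK := compact_measurable_rV cK.
have [f' bf ff'] := cmeasurable_repr mf.
rewrite (@integral_ae_any _ _ _ mu K _ (fun x => ((normc a)%:E * (normc (f' x))%:E)%E)); last first.
  by apply: filterS ff' => x ->; rewrite normcM EFinM.
rewrite ge0_integralZl//; first last.
- by rewrite lee_fin normc_ge0.
- by move=> x _; rewrite lee_fin normc_ge0.
- by apply/measurable_EFinP; apply: measurable_funTS; exact: measurable_normc.
rewrite lte_mul_pinfty ?lee_fin ?normc_ge0//.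
rewrite (@integral_ae_any _ _ _ mu K _ (fun x => (normc (f x))%:E)); first exact: fK.
by apply: filterS ff' => x ->.
Qed.

Lemma L1loc_sum (T : Type) (l : seq T) (F : T -> X -> R[i]) :
  (forall t, L1loc (F t)) -> L1loc (fun x => \sum_(t <- l) F t x).
Proof.
move=> lF; elim: l => [|t l ih].
  rewrite (_ : (fun _ => _) = (fun=> 0)); first exact: L1loc0.
  by apply/funext => x; rewrite big_nil.
rewrite (_ : (fun _ => _) = (fun x => F t x + \sum_(t <- l) F t x)); first exact: L1locD.
by apply/funext => x; rewrite big_cons.
Qed.

Lemma pairing_suml (T : Type) (l : seq T) (F : T -> X -> R[i]) u :
  (forall t, L1loc (F t)) -> bcs u ->
  pairing (fun x => \sum_(t <- l) F t x) u = \sum_(t <- l) pairing (F t) u.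
Proof.
move=> lF bu; elim: l => [|t l ih].
  rewrite big_nil /pairing (_ : (fun x => _) = (fun=> 0)).
    by apply: complex_eqP; rewrite /= /Rintegral integral0.
  by apply/funext => x; rewrite big_nil mul0r.
rewrite big_cons -ih -pairingD//; last exact: L1loc_sum.
by congr pairing; apply/funext => x; rewrite big_cons.
Qed.

(* D s plays the role of the weak derivative of D [::] along the directions in s. *)
Definition weak_family (N : nat) (D : seq 'I_d -> X -> R[i]) : Prop :=
  forall s, (size s <= N)%N -> L1loc (D s) /\
    forall u, rtest u -> pairing (D s) u = (-1) ^+ size s * pairing (D [::]) (rD s u).

Variable r : R.
Hypothesis r0 : 0 < r.

Let kerc (b : seq 'I_d) (y : X) : R[i] := (ker r b y)%:C.

(** The transpose of [rtest_representation] for [rD s u]: kernels pass to D by [pairing_Kint],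
    derivatives by the definition of [weak_family]. The lists [b ++ s] have at most d + size s
    entries, whence the condition on N. *)
Lemma weak_family_repr N D s : weak_family N D -> (d + size s <= N)%N ->
  \forall x \ae mu, D s x = \sum_(b <- subseqs (enum 'I_d))
     (-1) ^+ size b * convolution (D (b ++ s)) (kerc b) x.
Proof.
move=> wD sN; pose L := subseqs (enum 'I_d).
have bN b : b \in L -> (size (b ++ s) <= N)%N.
  move=> /size_subseqs; rewrite size_enum_ord size_cat => bd.
  by apply: leq_trans sN; rewrite leq_add2r.
(* Extension by zero makes local integrability hold for every list b, as the lemmas on finite sums
   require. *)
pose D' b := if b \in L then D (b ++ s) else fun=> 0.
have lD' b : L1loc (D' b).
  by rewrite /D'; case: ifPn => [/bN/wD[]//|_]; exact: L1loc0.
have lG b : L1loc (fun x => (-1) ^+ size b * convolution (D' b) (kerc b) x).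
  by apply: L1locZ; apply: L1loc_convolution => //; exact: ker_bcs.
suff : \forall x \ae mu, D s x = \sum_(b <- L) (-1) ^+ size b * convolution (D' b) (kerc b) x.
  apply: filterS => x ->; rewrite big_seq [RHS]big_seq; apply: eq_bigr => b bL.
  by rewrite /D' bL.
have sN' : (size s <= N)%N by apply: leq_trans sN; rewrite leq_addl.
have [l0 _] := wD [::] (leq0n _).
have [ls Hs] := wD s sN'.
apply: pairing_unique => //; first exact: L1loc_sum.
move=> u tu; have bu := rtest_bcs tu; have tsu := rtest_rD s tu.
rewrite Hs// pairing_suml//.
have -> : rD s u = (fun x => \sum_(b <- L) Kint (ker r b) (rD b (rD s u)) x).
  by apply/funext => x; exact: rtest_representation.
rewrite pairing_sum//; last first.
  by move=> b; apply: rtest_bcs; have [] := Kint_rtest [::] (ker_bcs r0 b) (rtest_rD b tsu).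
rewrite big_distrr /= big_seq [RHS]big_seq; apply: eq_bigr => b bL.
rewrite pairingZ//; last by apply: L1loc_convolution => //; exact: ker_bcs.
rewrite -(pairing_Kint (lD' b) (ker_bcs r0 b) tu).
have [tK _] := Kint_rtest [::] (ker_bcs r0 b) tu.
have [_ ->] : L1loc (D' b) /\ forall u, rtest u -> pairing (D' b) u = (-1) ^+ size (b ++ s) * pairing (D [::]) (rD (b ++ s) u).
  by rewrite /D' bL; apply: wD; exact: bN.
have [_ ->] := Kint_rtest (b ++ s) (ker_bcs r0 b) tu.
(* The signs from b occur twice, once in the coefficient and once from moving the derivatives, and
   cancel; the sign of s remains. *)
by rewrite mulrA size_cat -exprD addnA addnn -mul2n exprD exprM sqrrN !expr1n mul1r rD_cat.
exact: tK.
Qed.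

Lemma normc_sum (T : Type) (l : seq T) (F : T -> R[i]) :
  normc (\sum_(t <- l) F t) <= \sum_(t <- l) normc (F t).
Proof.
elim: l => [|t l ih]; first by rewrite !big_nil normc0.
by rewrite !big_cons (le_trans (le_normcD _ _))// lerD.
Qed.

Lemma normc_sign n : normc ((-1) ^+ n) = 1 :> R.
Proof. by elim: n => [|n ih]; rewrite ?expr0 ?normc1// exprS normcM ih normcN normc1 mulr1. Qed.

(** The constant is the number of terms of the representation times the bound (1 + 1/r)^d of each
    kernel; every convolution is then controlled by an average of |D t| over a box. *)
Lemma weak_family_bound N D s w B : weak_family N D -> (d + size s <= N)%N ->
  (forall x, 0 <= w x) -> 0 <= B ->
  (forall t x, (size t <= N)%N ->
     ((w x)%:E * \int[mu]_y (normc (D t (x - y)) * \1_(cbox r) y)%:E <= B%:E)%E) ->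
  \forall x \ae mu, normc (D s x) * w x <= (size (subseqs (enum 'I_d)))%:R * (1 + r^-1) ^+ d * B.
Proof.
move=> wD sN w0 B0 H; apply: filterS (weak_family_repr wD sN) => x ->.
have c0 : 0 <= (1 + r^-1) ^+ d by rewrite exprn_ge0// addr_ge0// invr_ge0 ltW.
apply: (@le_trans _ _ (\sum_(b <- subseqs (enum 'I_d)) (1 + r^-1) ^+ d * B)); last first.
  by rewrite big_const_seq count_predT iter_addr addr0 -mulrA mulr_natl.
apply: le_trans (ler_wpM2r (w0 x) (normc_sum _ _)) _.
rewrite mulr_suml big_seq [leRHS]big_seq; apply: ler_sum => b /size_subseqs.
rewrite size_enum_ord => bd; rewrite normcM normc_sign mul1r.
have bsN : (size (b ++ s) <= N)%N by rewrite size_cat (leq_trans _ sN)// leq_add2r.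
have [lD _] := wD _ bsN.
rewrite -lee_fin EFinM.
apply: le_trans (lee_wpmul2r _ (normc_convolution_bcs x lD.1 (ker_bcs r0 b) c0 (ker_bound r0 b))) _.
  by rewrite lee_fin.
rewrite -muleA [X in (_ * X)%E]muleC EFinM; apply: lee_wpmul2l; first by rewrite lee_fin.
exact: H.
Qed.

End sobolev.

(** * The spaces E^n_w *)

Section derivative_families.
Context {R : realType} {d : nat}.
Local Notation X := 'rV[R]_d.
Local Notation mu := (@lebesgue_rV R d).
Implicit Types (g h : X -> R[i]) (u v : X -> R) (s : seq 'I_d) (E : normed_fspace R d)
  (f : @functional R d).

Definition mseq n (a : mindex d n) : seq 'I_d := flatten [seq nseq (a i) i | i <- enum 'I_d].

(** The multi-index counting each direction in s. [inord] gives the right value only for counts up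
    to n, hence the hypothesis [size s <= n] in what follows. *)
Definition mx n s : mindex d n := [ffun i => inord (count_mem i s)].

Lemma count_mseq n (a : mindex d n) i : count_mem i (mseq a) = a i.
Proof.
rewrite /mseq count_flatten -map_comp sumnE big_map -[enum 'I_d]filter_predT big_filter big_enum /=.
rewrite (bigD1 i)//= count_nseq /= eqxx mul1n big1 ?addn0// => j ji.
by rewrite count_nseq /= (negbTE ji) mul0n.
Qed.

Lemma size_mseq n (a : mindex d n) : size (mseq a) = mdeg a.
Proof.
rewrite /mseq size_flatten /shape -map_comp sumnE big_map /mdeg big_enum /=.
by apply: eq_bigr => i _; rewrite size_nseq.
Qed.

Lemma mxE_count n s i : (size s <= n)%N -> mx n s i = count_mem i s :> nat.
Proof. by move=> sn; rewrite ffunE inordK// ltnS (leq_trans (count_size _ _)). Qed.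

Lemma perm_mseq_mx n s : (size s <= n)%N -> perm_eq (mseq (mx n s)) s.
Proof. by move=> sn; apply/allP => i _ /=; rewrite count_mseq mxE_count. Qed.

Lemma mdeg_mx n s : (size s <= n)%N -> mdeg (mx n s) = size s.
Proof. by move=> sn; rewrite -size_mseq; apply: perm_size; exact: perm_mseq_mx. Qed.

Lemma eq_tf_mderiv n m (a : mindex d n) (b : mindex d m) :
  (forall i, a i = b i :> nat) -> @tf_mderiv R d n a = tf_mderiv b.
Proof.
move=> ab; apply/funext => phi; rewrite /tf_mderiv.
by elim: (enum 'I_d) => //= i l ->; rewrite ab.
Qed.

Lemma eq_dderiv n m (a : mindex d n) (b : mindex d m) f :
  (forall i, a i = b i :> nat) -> dderiv a f = dderiv b f.
Proof.
move=> ab; rewrite /dderiv (eq_tf_mderiv ab) (_ : mdeg a = mdeg b)//.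
by apply: eq_bigr => i _.
Qed.

Lemma tf_mderivE n (a : mindex d n) (phi : testfun R d) :
  tf_mderiv a phi = foldr tf_pderiv phi (mseq a).
Proof.
rewrite /tf_mderiv /mseq; elim: (enum 'I_d) => //= i l ->.
by rewrite foldr_cat; elim: (a i : nat) => //= k ->.
Qed.

Lemma Re_pderivs s (phi : testfun R d) :
  @complex.Re R \o foldr tf_pderiv phi s = rD s (@complex.Re R \o phi).
Proof. by elim: s => //= i s <-. Qed.

Lemma Im_pderivs s (phi : testfun R d) :
  @complex.Im R \o foldr tf_pderiv phi s = rD s (@complex.Im R \o phi).
Proof. by elim: s => //= i s <-. Qed.

Lemma pderivs_real s (phi : testfun R d) u : (forall x, phi x = (u x)%:C) ->
  forall x, foldr tf_pderiv phi s x = (rD s u x)%:C.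
Proof.
move=> phiu x; apply: complex_eqP => /=.
  have := congr1 (@^~ x) (Re_pderivs s phi) => /= ->; congr (rD s _ x).
  by apply/funext => y /=; rewrite phiu.
have := congr1 (@^~ x) (Im_pderivs s phi) => /= ->.
have -> : @complex.Im R \o phi = (fun=> 0) by apply/funext => y /=; rewrite phiu.
elim: s x => //= i s ih x; rewrite (_ : rD s _ = cst 0); last exact/funext.
by rewrite /rpderiv derive_cst.
Qed.

Lemma regular_real g (phi : testfun R d) u : (forall x, phi x = (u x)%:C) ->
  regular g phi = pairing g u.
Proof. by move=> phiu; congr cintegral; apply/funext => x; rewrite phiu. Qed.

Lemma regular_inj g h : L1loc g -> L1loc h -> regular g = regular h ->
  \forall x \ae mu, g x = h x.
Proof.
move=> lg lh gh; apply: pairing_unique => // u tu.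
have [phi phiu] := rtest_testfun tu.
by rewrite -(regular_real g phiu) gh (regular_real h phiu).
Qed.

Lemma density_spec f g : L1loc g -> f = regular g ->
  [/\ L1loc (density f), f = regular (density f) & \forall x \ae mu, density f x = g x].
Proof.
move=> lg fg.
have [ld fd] : L1loc (density f) /\ f = regular (density f).
  by apply: (@xgetPex _ (fun=> 0) [set g | L1loc g /\ f = regular g]); exists g.
by split => //; apply: regular_inj => //; rewrite -fd -fg.
Qed.

Lemma tf_mderiv0 n (phi : testfun R d) : tf_mderiv (mx n [::]) phi = phi.
Proof.
rewrite tf_mderivE; have : perm_eq (mseq (mx n [::])) [::] by exact: perm_mseq_mx.
by move=> /perm_nilP ->.
Qed.

Lemma dderiv0 n f : dderiv (mx n [::]) f = f.
Proof. by apply/funext => phi; rewrite /dderiv mdeg_mx// expr0 mul1r tf_mderiv0. Qed.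

Lemma lintegralZl (G : X -> R) k : lmeasurable G -> (forall x, 0 <= G x) -> 0 <= k ->
  (\int[mu]_x (k * G x)%:E = k%:E * \int[mu]_x (G x)%:E)%E.
Proof.
move=> [G' mG' GG'] G0 k0.
rewrite (@integral_ae_any _ _ _ mu setT (fun x => (G x)%:E) (fun x => `|G' x|%:E)); last first.
  by apply: filterS GG' => x <-; rewrite ger0_norm.
rewrite -ge0_integralZl//; last by apply/measurable_EFinP; exact: measurableT_comp.
by apply: integral_ae_any; apply: filterS GG' => x <-; rewrite ger0_norm.
Qed.

Section EnW_family.
Variables (E : normed_fspace R d) (tE : TIBF_bounded_type E).

Lemma EnW_density n w f (a : mindex d n) : EnW E n w f -> (mdeg a <= n)%N ->
  [/\ L1loc (density (dderiv a f)), dderiv a f = regular (density (dderiv a f)) &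
    E (mul_weight (density (dderiv a f)) w)].
Proof.
move=> [_ H] an; have [g [lg fg Eg]] := H a an.
have [ld fd dg] := density_spec lg fg; split => //.
have dgw : \forall x \ae mu, mul_weight (density (dderiv a f)) w x = mul_weight g w x.
  by apply: filterS dg => x; rewrite /mul_weight => ->.
by have [] := tibf_ae tE Eg dgw.
Qed.

(** The derivatives of f as functions indexed by lists, so that they form a [weak_family]; [density]
    makes a choice that is immaterial almost everywhere. *)
Definition family n f s : X -> R[i] := density (dderiv (mx n s) f).

Lemma EnW_family_spec n w f s : EnW E n w f -> (size s <= n)%N ->
  [/\ L1loc (family n f s), dderiv (mx n s) f = regular (family n f s) &
    E (mul_weight (family n f s) w)].
Proof. by move=> Ef sn; apply: EnW_density => //; rewrite mdeg_mx. Qed.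

Lemma family_dderiv n m (a : mindex d m) f : (mdeg a <= n)%N ->
  density (dderiv a f) = family n f (mseq a).
Proof.
move=> an; rewrite /family; congr density; apply: eq_dderiv => i.
by rewrite mxE_count ?size_mseq// count_mseq.
Qed.

Lemma EnW_weak_family n w f : EnW E n w f -> weak_family n (family n f).
Proof.
move=> Ef s sn; have [ls fs _] := EnW_family_spec Ef sn; split => // u tu.
have [l0 f0 _] := EnW_family_spec (s := [::]) Ef (leq0n _).
rewrite dderiv0 in f0.
have [phi phiu] := rtest_testfun tu.
rewrite -(regular_real _ phiu) -fs /dderiv mdeg_mx// {1}f0; congr (_ * _).
rewrite tf_mderivE (regular_real _ (pderivs_real _ phiu)); congr pairing.
by apply: rD_perm => //; exact: perm_mseq_mx.
Qed.

Lemma fnorm_family_le n w f s : EnW E n w f -> (size s <= n)%N ->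
  fnorm E (mul_weight (family n f s) w) <= EnW_norm E n w f.
Proof.
move=> Ef sn; rewrite /EnW_norm; apply: (le_bigmax_cond 0 (j := mx n s) (fun a => fnorm E (mul_weight (density (dderiv a f)) w))).
by rewrite mdeg_mx.
Qed.

Lemma EnW_norm_le n w f B : 0 <= B ->
  (forall s, (size s <= n)%N -> fnorm E (mul_weight (family n f s) w) <= B) ->
  EnW_norm E n w f <= B.
Proof.
move=> B0 H; apply/bigmax_leP; split => // a an.
by rewrite (family_dderiv f an); apply: H; rewrite size_mseq.
Qed.

Lemma family_mono n m f s : (n <= m)%N -> (size s <= n)%N -> family n f s = family m f s.
Proof.
move=> nm sn; congr density; apply: eq_dderiv => i.
by rewrite !mxE_count// (leq_trans sn).
Qed.

(** The weight passes inside the average by w(x) <= C w'(x - y). The average around x is then an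
    integral of a translate over one fixed box, so the embedding into L^1_loc and the uniform bound
    on translations give a constant independent of x. *)
Lemma average_bound (w w' : X -> R) C r : 0 <= C -> (forall x, 0 <= w x) -> (forall x, 0 <= w' x) ->
  (forall x y, cbox r y -> w (x + y) <= C * w' x) ->
  exists2 A, 0 <= A & forall h x, L1loc h -> E (mul_weight h w') ->
   ((w x)%:E * \int[mu]_y (normc (h (x - y)%R) * \1_(cbox r) y)%:E <=
     (A * fnorm E (mul_weight h w'))%:E)%E.
Proof.
move=> C0 w0 w'0 wC.
have [CE HE] := tibf_embedding tE (@compact_cbox R d r).
have [C0' C0'0 HC0] := tibf_translate_bounded tE.
exists (C * (`|CE| * C0')); first by rewrite !mulr_ge0// ltW.
move=> h x lh Eh; set F := mul_weight h w'.
have EF : E (translate (- x) F) by apply: (tibf_translate tE).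
have lF := tibf_sub tE Eh.
have mref (g : X -> R[i]) : cmeasurable g -> lmeasurable (fun y => normc (g (x - y)) * \1_(cbox r) y).
  move=> /cmeasurable_repr[g' bg gg']; exists (fun y => normc (g' (x - y)) * \1_(cbox r) y).
    apply: measurable_funM; last exact: measurable_cbox_indic.
    exact: (measurableT_comp (measurable_normc bg) (measurable_reflect x)).
  by have := ae_reflect x gg'; apply: filterS => y ->.
have ge0 (g : X -> R[i]) y : 0 <= normc (g (x - y)) * \1_(cbox r) y.
  by rewrite mulr_ge0 ?normc_ge0.
rewrite -lintegralZl//; last exact: mref lh.1.
apply: (@le_trans _ _ (\int[mu]_y (C * (normc (F (x - y)) * \1_(cbox r) y))%:E)%E).
  apply: ge0_le_integral_any => y _; first by rewrite lee_fin mulr_ge0.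
  rewrite lee_fin mulrCA [leRHS]mulrA indicE; case: (boolP (y \in _)) => [/set_mem yr|_]; last first.
    by rewrite !mulr0.
  rewrite !mulr1 /F /mul_weight normcM normc_real (ger0_norm (w'0 _)) mulrCA.
  rewrite ler_wpM2l ?normc_ge0//; have := wC (x - y) y yr; by rewrite subrK.
rewrite lintegralZl//; last exact: mref lF.1.
rewrite -mulrA EFinM; apply: lee_wpmul2l; first by rewrite lee_fin.
(* The box is symmetric, so the reflection of y turns the average of F (x - y) into an integral of
   the translate of F by - x. *)
have cbN y : \1_(cbox r) (0 - y) = \1_(cbox r) y :> R.
  rewrite !indicE; congr (_%:R); congr (nat_of_bool _).
  by apply/idP/idP => /set_mem H; apply: mem_set => i; have := H i; rewrite !mxE add0r normrN.
have -> : (\int[mu]_y (normc (F (x - y)) * \1_(cbox r) y)%:E =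
    \int[mu]_y (normc (translate (- x) F y) * \1_(cbox r) y)%:E)%E.
  rewrite -[RHS](@lintegral_reflect R d _ 0); last first.
  - by move=> y; rewrite mulr_ge0 ?normc_ge0.
  - have [g' bg gg'] := cmeasurable_repr (tibf_sub tE EF).1.
    exists (fun y => normc (g' y) * \1_(cbox r) y).
      by apply: measurable_funM; [exact: measurable_normc|exact: measurable_cbox_indic].
    by apply: filterS gg' => y ->.
  apply: eq_integral => y _; rewrite cbN /translate; congr ((normc (F _) * _)%:E).
  by rewrite opprK sub0r addrC.
have -> : (\int[mu]_y (normc (translate (- x) F y) * \1_(cbox r) y)%:E =
    \int[mu]_(y in cbox r) (normc (translate (- x) F y))%:E)%E.
  rewrite [RHS]integral_mkcond; apply: eq_integral => y _.
  by rewrite patchE indicE; case: ifP => _; rewrite ?mulr1 ?mulr0.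
apply: le_trans (HE _ EF) _; rewrite lee_fin -mulrA.
apply: (@le_trans _ _ (`|CE| * fnorm E (translate (- x) F))).
  by rewrite ler_wpM2r ?ler_norm// (tibf_norm_ge0 tE).
by rewrite ler_wpM2l// HC0.
Qed.

End EnW_family.
End derivative_families.

(** * Weights on boxes, and indicators of boxes in solid spaces *)

Section weight_estimates.
Context {R : realType} {d : nat}.
Local Notation X := 'rV[R]_d.
Local Notation mu := (@lebesgue_rV R d).
Implicit Types (g h : X -> R[i]) (u v w : X -> R) (s : seq 'I_d) (E : normed_fspace R d).

(** Local bounds become a bound on the box by compactness, in its near-covering form with the bound
    M tending to infinity. *)
Lemma weight_bounded w q : weight_function w -> exists M, forall x, cbox q x -> w x <= M.
Proof.
move=> [_ _ wloc].
have /compact_near_coveringP/(_ _ (+oo : set_system R) (fun M x => w x <= M)) := @compact_cbox R d q.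
move=> /(_ _); case.
  move=> x _; have [M wM] := wloc x.
  exists ([set y | w y <= M], [set M' : R | M <= M']); first by split => //; apply: nbhs_pinfty_ge; exact: num_real.
  by move=> [y M'] [/= yM MM']; exact: le_trans yM MM'.
move=> M [_ H]; exists (M + 1); apply: H; by rewrite ltrDl.
Qed.

Lemma L1loc_mul_weight h w : weight_function w -> L1loc h -> L1loc (mul_weight h w).
Proof.
move=> ww lh; have [lw w1 _] := ww; split.
  by apply: cmeasurableM; [exact: lh.1|exact: cmeasurable_real].
move=> K cK; have [q q0 Kq] := compact_sub_cbox cK; have [M wM] := weight_bounded q ww.
have [h' bh hh'] := cmeasurable_repr lh.1.
have mh : lmeasurable (fun x => normc (h x) * \1_(cbox q) x).
  exists (fun x => normc (h' x) * \1_(cbox q) x); last by apply: filterS hh' => x ->.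
  by apply: measurable_funM; [exact: measurable_normc|exact: measurable_cbox_indic].
apply: (@le_lt_trans _ _ (\int[mu]_x (`|M| * (normc (h x) * \1_(cbox q) x))%:E)%E).
  rewrite integral_mkcond; apply: ge0_le_integral_any => x _.
    by rewrite patchE; case: ifP => // _; rewrite lee_fin normc_ge0.
  rewrite patchE indicE; case: ifP => [/set_mem Kx|_]; last first.
    by rewrite lee_fin !mulr_ge0 ?normc_ge0.
  rewrite mem_set ?mulr1; last exact: Kq.
  rewrite lee_fin /mul_weight normcM normc_real mulrC ler_wpM2r ?normc_ge0//.
  rewrite ger0_norm ?(le_trans ler01)//; apply: le_trans (ler_norm M); exact: wM (Kq _ Kx).
rewrite lintegralZl//; last by move=> x; rewrite mulr_ge0 ?normc_ge0.
by rewrite lte_mul_pinfty// ?L1loc_cbox.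
Qed.

Lemma Lp1P h : Lp_space R d 1 h <-> cmeasurable h /\ (\int[mu]_x (normc (h x))%:E < +oo)%E.
Proof.
have E : ('N[mu]_1[(fun x => (normc (h x))%:E)] = \int[mu]_x (normc (h x))%:E)%E.
  by rewrite Lnorm1; apply: eq_integral => x _; rewrite gee0_abs// lee_fin normc_ge0.
by rewrite /Lp_space /= E.
Qed.

Lemma fnorm_Lp1 h : fnorm (Lp_space R d 1) h = fine (\int[mu]_x (normc (h x))%:E)%E.
Proof.
rewrite /= Lnorm1; congr fine; apply: eq_integral => x _.
by rewrite gee0_abs// lee_fin normc_ge0.
Qed.

(** Finiteness is essential: [fine] sends an infinite integral to 0, and the convolution would
    vanish there. *)
Lemma convolution_real_ge (a b : X -> R) x c :
  (c%:E <= \int[mu]_y (a (x - y) * b y)%:E)%E -> (\int[mu]_y (a (x - y) * b y)%:E < +oo)%E ->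
  c <= normc (convolution (fun x => (a x)%:C) (fun x => (b x)%:C) x).
Proof.
move=> cT Too; have Tfin : (\int[mu]_y (a (x - y) * b y)%:E)%E \is a fin_num.
  by rewrite fin_real// Too andbT (lt_le_trans (ltNyr c) cT).
apply: le_trans (normr_Re_le _); apply: le_trans (ler_norm _).
rewrite -lee_fin (le_trans cT)// -[leLHS]fineK// lee_fin /=.
by rewrite le_eqVlt; apply/orP; left; apply/eqP; apply: eq_Rintegral => y _ /=; rewrite !mul0r subr0.
Qed.

Lemma indic_L1 A : measurable A -> (mu A < +oo)%E -> Lp_space R d 1 (fun x => (\1_A x)%:C).
Proof.
move=> mA Aoo; apply/Lp1P; split.
  by apply: cborel_cmeasurable; apply: cborel_real; exact: measurable_indic.
under eq_integral do rewrite normc_real ger0_norm//.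
by rewrite integral_indic// setIT.
Qed.

Lemma indic_L1loc A : measurable A -> L1loc (fun x : X => (\1_A x : R)%:C).
Proof.
move=> mA; apply: L1loc_bounded.
  by apply: cborel_cmeasurable; apply: cborel_real; exact: measurable_indic.
move=> q; exists 1 => x _; rewrite normc_real ger0_norm// indicE.
Qed.

(** Some nonzero f in E exceeds 1/(k+1) in modulus on a set A inside the box of radius k with
    positive finite measure, so the indicator of A is in E by solidity. Its convolution with the
    indicator of the box of radius q + k equals the measure of A on the box of radius q, and
    solidity applies again. *)
Lemma solid_indic_cbox E q : solid_TIBF_bounded_type E -> 0 <= q ->
  E (fun x => (\1_(cbox q) x)%:C).
Proof.
move=> [tE sE] q0; have [f Ef fn0] := tibf_nontrivial tE.
have [f' bf ff'] := cmeasurable_repr (tibf_sub tE Ef).1.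
have mf := measurable_normc bf.
pose A (k : nat) := cbox k%:R `&` [set x : X | k.+1%:R^-1 <= normc (f' x)].
have mA k : measurable (A k).
  apply: measurableI; first exact: measurable_cbox.
  rewrite (_ : mkset _ = (fun x => normc (f' x)) @^-1` `[k.+1%:R^-1, +oo[).
    by rewrite -[X in measurable X]setTI; apply: mf => //; exact: measurable_itv.
  by apply/seteqP; split => x /=; rewrite in_itv/= andbT.
have [k Ak] : exists k, mu (A k) != 0%E.
  apply/not_existsP => H; apply: fn0.
  have A0 k : \forall x \ae mu, ~ A k x.
    exists (A k); split => //; last by move=> x /= /contrapT.
    by apply/eqP; apply: contrapT => /negP; exact: H.
  have := ae_foralln A0; apply: filterS2 ff' => x -> nA.
  apply/eqP; rewrite -normc_eq0; apply/eqP; apply: contrapT => /eqP f0.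
  have f0' : 0 < normc (f' x) by rewrite lt_neqAle eq_sym f0 normc_ge0.
  pose k := maxn (Num.truncn `|x|).+1 (Num.truncn (normc (f' x))^-1).
  apply: (nA k); split.
    move=> i; apply: le_trans (rV_entry_le x i) _; apply: ltW.
    by apply: lt_le_trans (truncnS_gt _) _; rewrite ler_nat leq_maxl.
  rewrite /= invf_ple ?posrE//; apply: ltW; apply: lt_le_trans (truncnS_gt _) _.
  by rewrite ler_nat ltnS leq_maxr.
have Afin : (mu (A k) < +oo)%E.
  apply: le_lt_trans (@lebesgue_cbox_lty R d k%:R); apply: le_measure; rewrite ?inE//.
    exact: measurable_cbox.
  exact: subIsetl.
have EA : E (fun x => (\1_(A k) x)%:C).
  have EZ := tibf_scale tE (k.+1%:R)%:C Ef.
  have [] := sE _ (fun x => (\1_(A k) x)%:C) EZ (indic_L1loc (mA k)) => //.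
  apply: filterS ff' => x ->; rewrite normcM !normc_real !ger0_norm// indicE.
  case: (boolP (_ \in _)) => [/set_mem[_ /=]|_]; last by rewrite mulr_ge0 ?normc_ge0.
  by rewrite -div1r ler_pdivrMr// mulrC.
have cq : Lp_space R d 1 (fun x => (\1_(cbox (q + k%:R)) x)%:C).
  by apply: indic_L1; [exact: measurable_cbox|exact: lebesgue_cbox_lty].
have [Econv _] := tibf_convolution tE EA cq.
have mAfin : mu (A k) \is a fin_num by rewrite ge0_fin_numE.
have m0 : 0 < fine (mu (A k)) by rewrite fine_gt0// Afin andbT lt0e Ak/=.
have EZ := tibf_scale tE ((fine (mu (A k)))^-1)%:C Econv.
have [] := sE _ (fun x => (\1_(cbox q) x)%:C) EZ (indic_L1loc (@measurable_cbox R d q)) => //.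
apply: nearW => x; rewrite normcM !normc_real !ger0_norm ?invr_ge0 ?(ltW m0)//.
rewrite indicE; case: (boolP (_ \in _)) => [/set_mem xq|_]; last by rewrite mulr_ge0 ?normc_ge0 ?invr_ge0 ?(ltW m0).
rewrite -ler_pdivrMl ?invr_gt0// invrK mulr1.
have TE : (\int[mu]_y (\1_(A k) (x - y) * \1_(cbox (q + k%:R)) y)%:E = mu (A k))%E.
  rewrite -[LHS](@lintegral_reflect R d _ x); first last.
  - by move=> y; rewrite mulr_ge0.
  - apply: borel_lmeasurable; apply: measurable_funM; last exact: measurable_cbox_indic.
    have mi : measurable_fun setT (\1_(A k) : X -> R) by exact: measurable_indic.
    exact: (measurableT_comp mi (measurable_reflect x)).
  rewrite -[X in _ = mu X]setIT -integral_indic//; apply: eq_integral => y _; congr EFin.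
  rewrite subKr !indicE; case: (boolP (y \in A k)) => [/set_mem[yk _]|_]; last by rewrite mul0r.
  rewrite mem_set ?mulr1// => i; rewrite !mxE; apply: le_trans (ler_normB _ _) _.
  by apply: lerD; [exact: xq|exact: yk].
apply: convolution_real_ge; first by rewrite TE fineK.
by rewrite TE.
Qed.

End weight_estimates.

(** * From weighted bounds to membership in E under (N) *)

Section comparison.
Context {R : realType} {d : nat}.
Local Notation X := 'rV[R]_d.
Local Notation mu := (@lebesgue_rV R d).
Implicit Types (g h : X -> R[i]) (u v w : X -> R) (s : seq 'I_d) (E F : normed_fspace R d)
  (f : @functional R d).

(** On this box the sum of squares is at most d/(d+1), so it lies in the Euclidean unit ball of
    (wM); d + 1 also covers d = 0. *)
Definition rad : R := d.+1%:R^-1.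

Lemma rad_gt0 : 0 < rad. Proof. by rewrite invr_gt0. Qed.

Lemma cbox_rad (y : X) : cbox rad y -> euclidean_norm y <= 1.
Proof.
move=> yr; rewrite /euclidean_norm -[X in _ <= X]sqrtr1 ler_sqrt//.
have rad1 : rad <= 1 by rewrite invf_le1// ler1n.
apply: (@le_trans _ _ (\sum_(i < d) rad)).
  apply: ler_sum => i _; rewrite -real_normK ?num_real// expr2.
  apply: (@le_trans _ _ (rad * 1)); last by rewrite mulr1.
  by apply: ler_pM => //; exact: le_trans (yr i) rad1.
by rewrite sumr_const card_ord -[X in X <= _]mulr_natl ler_pdivrMr// mul1r ler_nat.
Qed.

Variable W : nat -> X -> R.
Hypotheses (hW : weight_function_system W) (hM : condition_wM W).

Lemma weight_mono n m x : (n <= m)%N -> W n x <= W m x.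
Proof. by move=> nm; rewrite -(subnKC nm); elim: (m - n)%N => [|k ih]; rewrite ?addn0// addnS (le_trans ih)// hW.2. Qed.

Lemma weight_ge1 n x : 1 <= W n x. Proof. by have [_ +  _] := hW.1 n; apply. Qed.

Lemma weight_gt0 n x : 0 < W n x. Proof. by apply: lt_le_trans (weight_ge1 n x). Qed.

Lemma weight_lmeasurable n : lmeasurable (W n). Proof. by have [] := hW.1 n. Qed.

Lemma weight_moderate n : exists m C, [/\ (n <= m)%N, 0 < C &
  forall x y, cbox rad y -> W n (x + y) <= C * W m x].
Proof.
have [m [nm [C C0 H]]] := hM n; exists m, C; split => // x y /cbox_rad; exact: H.
Qed.

Lemma ratio_lmeasurable n m : lmeasurable (fun x => W n x / W m x).
Proof.
(* Writing the inverse as exp(- ln) exhibits the quotient as a composition of measurable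
   functions. *)
have -> : (fun x => W n x / W m x) = (fun x => W n x * expR (- ln (W m x))).
  by apply/funext => x; rewrite expRN lnK// posrE weight_gt0.
apply: (@lmeasurable_comp2 R d (fun p => p.1 * expR (- ln p.2))); [|exact: weight_lmeasurable..].
apply: measurable_funM; first exact: measurable_fst.
apply: measurableT_comp; first exact: measurable_expR.
apply: measurableT_comp => //; apply: measurableT_comp; first exact: measurable_ln.
exact: measurable_snd.
Qed.

Lemma ratio_gt0 n m x : 0 < W n x / W m x.
Proof. by rewrite divr_gt0// weight_gt0. Qed.

Lemma ratio_cmeasurable n m : cmeasurable (fun x => (W n x / W m x)%:C).
Proof. by apply: cmeasurable_real; exact: ratio_lmeasurable. Qed.

Hypothesis hN : condition_N W.

(* By (wM), W n / W m is dominated by a multiple of the convolution of the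
   indicator of a box with the L^1 function W n' / W m', and this lies in E. *)
Lemma ratio_in_solid n : exists2 m, (n <= m)%N & forall E, solid_TIBF_bounded_type E ->
  E (fun x => (W n x / W m x)%:C).
Proof.
have [n' [C [nn' C0 HC]]] := weight_moderate n.
have [m' n'm' L1] := hN n'.
have [m [C' [m'm C'0 HC']]] := weight_moderate m'.
exists m; first by rewrite (leq_trans nn')// (leq_trans n'm').
move=> E [tE sE].
have Ecb := solid_indic_cbox (conj tE sE) (ltW rad_gt0).
have [Econv _] := tibf_convolution tE Ecb L1.
pose V : R := fine (mu (cbox rad)).
have V0 : 0 < V by rewrite /V lebesgue_cbox ?(ltW rad_gt0)//= exprn_gt0// mulrn_wgt0// rad_gt0.
have EV : mu (cbox rad) = V%:E by rewrite /V lebesgue_cbox ?(ltW rad_gt0).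
(* The convolution at x integrates W n' / W m' over a box around x of volume V, and there (wM), used
   for the numerator and for the denominator, keeps it above (W n x / W m x) / (C C'). *)
have EZ := tibf_scale tE ((C * C') / V)%:C Econv.
have lr : L1loc (fun x => (W n x / W m x)%:C).
  apply: L1loc_bounded; first exact: ratio_cmeasurable.
  move=> q; exists 1 => x _; rewrite normc_real ger0_norm ?(ltW (ratio_gt0 _ _ _))//.
  rewrite ler_pdivrMr ?weight_gt0// mul1r; apply: weight_mono.
  by rewrite (leq_trans nn')// (leq_trans n'm').
have [] := sE _ (fun x => (W n x / W m x)%:C) EZ lr => //.
apply: nearW => x; rewrite normcM !normc_real ger0_norm ?(ltW (ratio_gt0 _ _ _))//.
rewrite ger0_norm ?divr_ge0 ?mulr_ge0 ?(ltW C0) ?(ltW C'0) ?(ltW V0)//.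
have CC0 : 0 < C * C' / V by rewrite divr_gt0// mulr_gt0.
rewrite -ler_pdivrMl// invf_div.
have mF : lmeasurable (fun y => \1_(cbox rad) (x - y) * (W n' y / W m' y)).
  apply: (@lmeasurable_comp2 R d (fun p => p.1 * p.2) (fun y => \1_(cbox rad) (x - y))).
  - by apply: measurable_funM; [exact: measurable_fst|exact: measurable_snd].
  - apply: (@lmeasurable_reflect R d (\1_(cbox rad)) x).
    by apply: borel_lmeasurable; exact: measurable_cbox_indic.
  - exact: ratio_lmeasurable.
have F0 y : 0 <= \1_(cbox rad) (x - y) * (W n' y / W m' y) by rewrite mulr_ge0// ltW// ratio_gt0.
apply: convolution_real_ge; last first.
  have [_ L1oo] := (Lp1P _).1 L1; apply: le_lt_trans L1oo.
  apply: ge0_le_integral_any => y _; rewrite lee_fin//.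
  rewrite normc_real ger0_norm ?(ltW (ratio_gt0 _ _ _))// -[leRHS]mul1r ler_wpM2r ?(ltW (ratio_gt0 _ _ _))//.
rewrite -(lintegral_reflect x mF)//.
have K0 : 0 <= W n x / W m x / (C * C') := ltW (divr_gt0 (ratio_gt0 n m x) (mulr_gt0 C0 C'0)).
apply: (@le_trans _ _ (\int[mu]_y ((W n x / W m x) / (C * C') * \1_(cbox rad) y)%:E)%E).
  rewrite lintegralZl//; last by apply: borel_lmeasurable; exact: measurable_cbox_indic.
  rewrite integral_indic; [|exact: measurableT|exact: measurable_cbox].
  rewrite setIT [X in (_ * X)%E](_ : _ = V%:E); last exact: EV.
  by rewrite -EFinM lee_fin mulrC mulrA mulrAC.
apply: ge0_le_integral_any => y _.
  by rewrite lee_fin mulr_ge0//; exact: K0.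
rewrite lee_fin subKr indicE; case: (boolP (y \in _)) => [/set_mem yr|_]; last first.
  by rewrite mulr0 mul0r.
rewrite mulr1 mul1r ler_pdivrMr ?mulr_gt0// ler_pdivrMr ?weight_gt0//.
have H1 : W n x <= C * W n' (x - y) by have := HC (x - y) y yr; rewrite subrK.
have H2 : W m' (x - y) <= C' * W m x.
  by apply: HC'; move=> i; rewrite mxE normrN; exact: yr.
apply: le_trans H1 _.
have -> : W n' (x - y) / W m' (x - y) * (C * C') * W m x =
   C * W n' (x - y) * ((C' * W m x) / W m' (x - y)) by ring.
by rewrite ler_peMr ?mulr_ge0 ?(ltW C0) ?(ltW (weight_gt0 _ _))// ler_pdivlMr ?mul1r// weight_gt0.
Qed.

(** |h| W n <= B W n / W m, and the right-hand side is in E by [ratio_in_solid]; its norm there is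
    the constant A. The index m is the same for all E. *)
Lemma solid_of_bounded n : exists m, (n <= m)%N /\ forall E, solid_TIBF_bounded_type E ->
  exists2 A, 0 <= A & forall h B, L1loc h -> 0 <= B ->
    (\forall x \ae mu, normc (h x) * W m x <= B) ->
    E (mul_weight h (W n)) /\ fnorm E (mul_weight h (W n)) <= A * B.
Proof.
have [m nm H] := ratio_in_solid n; exists m; split => // E sE.
have [tE sol] := sE; have Er := H E sE.
exists (fnorm E (fun x => (W n x / W m x)%:C)); first exact: (tibf_norm_ge0 tE).
move=> h B lh B0 hB; have EB := tibf_scale tE B%:C Er.
have [] := sol _ (mul_weight h (W n)) EB (L1loc_mul_weight (hW.1 n) lh).
  apply: filterS hB => x hx; rewrite /mul_weight !normcM !normc_real.
  rewrite (ger0_norm B0) !ger0_norm ?(ltW (ratio_gt0 _ _ _)) ?(ltW (weight_gt0 _ _))//.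
  by rewrite mulrCA mulrC -ler_pdivlMl ?weight_gt0// mulKf ?gt_eqF ?weight_gt0// ler_pdivlMr ?weight_gt0.
by move=> ? le; split => //; rewrite (le_trans le)// (tibf_norm_scale tE)// normc_real ger0_norm// mulrC.
Qed.

End comparison.

(** * Locally integrable functions as distributions *)

Section regular_distributions.
Context {R : realType} {d : nat}.
Local Notation X := 'rV[R]_d.
Local Notation mu := (@lebesgue_rV R d).
Implicit Types (g h : X -> R[i]) (phi : testfun R d).

Lemma testfun_cborel phi : cborel (phi : X -> R[i]).
Proof.
by split; [exact: (rtest_bcs (testfun_Re phi)).1|exact: (rtest_bcs (testfun_Im phi)).1].
Qed.

Lemma testfun_bcs phi : bcs (fun x => normc (phi x)).
Proof.
split; first exact: measurable_normc (testfun_cborel phi).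
have [M M0 HM] := rtest_bound (testfun_Re phi); have [N N0 HN] := rtest_bound (testfun_Im phi).
have [r r0 pr] := testfun_supp phi.
exists (M + N), r; split; [by rewrite addr_ge0// ltW|exact: ltW|].
move=> x; rewrite ger0_norm ?normc_ge0// indicE; case: (boolP (x \in _)) => [_|].
  by rewrite mulr1; apply: le_trans (normc_le _) _; exact: lerD (HM x) (HN x).
rewrite notin_setE => xr; have [->|/pr//] := eqVneq (phi x) 0.
by rewrite normc0 mulr0.
Qed.

Lemma cintegrable_regular g phi : cborel g -> L1loc g -> cintegrable (fun x => g x * phi x).
Proof.
move=> bg lg; apply: cintegrableP; first by apply: cborelM => //; exact: testfun_cborel.
apply: le_lt_trans (integral_pairing_lty lg (testfun_bcs phi)).
apply: ge0_le_integral_any => x _; first by rewrite lee_fin normc_ge0.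
by rewrite lee_fin normcM ger0_norm ?normc_ge0.
Qed.

Lemma regular_ae g h : (\forall x \ae mu, g x = h x) -> regular g = regular h.
Proof.
by move=> gh; apply/funext => phi; apply: cintegral_ae; apply: filterS gh => x ->.
Qed.

Lemma regularD g h : L1loc g -> L1loc h ->
  regular (fun x => g x + h x) = (fun phi => regular g phi + regular h phi).
Proof.
move=> lg lh; have [g' [bg lg' gg']] := L1loc_repr lg; have [h' [bh lh' hh']] := L1loc_repr lh.
rewrite (regular_ae gg') (regular_ae hh').
rewrite (@regular_ae _ (fun x => g' x + h' x)); last by apply: filterS2 gg' hh' => x -> ->.
apply/funext => phi; rewrite /regular -cintegralD; [|exact: cintegrable_regular..].
by congr cintegral; apply/funext => x; rewrite mulrDl.
Qed.

Lemma regularZ (a : R[i]) g : L1loc g ->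
  regular (fun x => a * g x) = (fun phi => a * regular g phi).
Proof.
move=> lg; have [g' [bg lg' gg']] := L1loc_repr lg.
rewrite (regular_ae gg') (@regular_ae _ (fun x => a * g' x)); last first.
  by apply: filterS gg' => x ->.
apply/funext => phi; rewrite /regular -cintegralZl; last exact: cintegrable_regular.
by congr cintegral; apply/funext => x; rewrite mulrA.
Qed.

Lemma regularB g h : L1loc g -> L1loc h ->
  regular (fun x => g x - h x) = (fun phi => regular g phi - regular h phi).
Proof.
move=> lg lh.
have -> : (fun x => g x - h x) = (fun x => g x + (-1) * h x).
  by apply/funext => x; rewrite mulN1r.
rewrite regularD//; last exact: L1locZ.
by apply/funext => phi; rewrite regularZ// mulN1r.
Qed.

(** For an empty or unbounded set [sup] takes the default value 0, so no bound on the set has to be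
    supplied. *)
Lemma sup_ge0_nonneg (A : set R) : (forall x, A x -> 0 <= x) -> 0 <= sup A.
Proof.
move=> A0; have [hA|hA] := pselect (has_sup A); last by rewrite sup_out.
have [x Ax] := hA.1; apply: le_trans (A0 x Ax) _; exact: sup_upper_bound.
Qed.

(** A distribution of order 0: on K the constant is the integral of |h| over K, and only the sup
    norm of the test function itself is used. *)
Lemma distribution_regular h : L1loc h -> Defs.distribution (regular h).
Proof.
move=> lh; have [g [bg lg hg]] := L1loc_repr lh; rewrite (regular_ae hg); split.
  move=> a phi psi chi chiE; rewrite /regular.
  rewrite -cintegralZl; last exact: cintegrable_regular.
  rewrite -cintegralD; [|exact: cintegrableZl (cintegrable_regular _ _ _)|exact: cintegrable_regular].
  by congr cintegral; apply/funext => x; rewrite chiE; ring.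
move=> K cK; pose I := (\int[mu]_(x in K) (normc (g x))%:E)%E.
have I0 : (0 <= I)%E by apply: integral_ge0 => x _; rewrite lee_fin normc_ge0.
have Ifin : I \is a fin_num by rewrite ge0_fin_numE// lg.2.
exists (fine I), 0%N => phi phiK.
pose S := sup (range (fun x => normc (phi x))).
have phiS x : normc (phi x) <= S.
  apply: sup_upper_bound; last by exists x.
  split; first by exists (normc (phi x)), x.
  have [c Hc] := bcs_bound (testfun_bcs phi); exists c => _ [y _ <-].
  by apply: le_trans (ler_norm _) _.
have S0 : 0 <= S by exact: le_trans (normc_ge0 _) (phiS 0).
apply: (@le_trans _ _ (fine I * S)); last first.
  rewrite ler_wpM2l ?fine_ge0// (bigD1 (mx 0 [::]))/= ?mdeg_mx// tf_mderiv0 lerDl.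
  apply: sumr_ge0 => a _; apply: sup_ge0_nonneg => _ [x _ <-]; exact: normc_ge0.
rewrite -lee_fin EFinM fineK//.
apply: le_trans (normc_cintegral_le _) _.
  by apply: cborelM => //; exact: testfun_cborel.
have mK := compact_measurable_rV cK.
apply: (@le_trans _ _ (\int[mu]_(x in K) ((normc (g x))%:E * S%:E))%E).
  rewrite [leRHS]integral_mkcond; apply: ge0_le_integral_any => x _; first by rewrite lee_fin normc_ge0.
  rewrite normcM patchE; case: ifPn => [_|]; first by rewrite -EFinM lee_fin ler_wpM2l ?normc_ge0.
  rewrite notin_setE => xK; have [->|px] := eqVneq (phi x) 0; first by rewrite normc0 mulr0.
  by exfalso; apply: xK; apply: phiK; exact: subset_closure.
rewrite ge0_integralZr// ?lee_fin//.
  by apply/measurable_EFinP; apply: measurable_funTS; exact: measurable_normc.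
by move=> x _; rewrite lee_fin normc_ge0.
Qed.

End regular_distributions.

(** * Estimates between the norms of two spaces and equality of topologies *)

Section frechet_comparison.
Context {R : realType} {d : nat}.
Local Notation X := 'rV[R]_d.
Local Notation mu := (@lebesgue_rV R d).
Implicit Types (g h : X -> R[i]) (u v w : X -> R) (s : seq 'I_d) (E F : normed_fspace R d)
  (f : @functional R d).
Variable W : nat -> X -> R.
Hypotheses (hW : weight_function_system W) (hM : condition_wM W).

Lemma EnW_norm_ge0 E n w f : 0 <= EnW_norm E n w f.
Proof. exact: bigmax_ge_id. Qed.

(* The derivatives are averages of further derivatives over a small box, see
   [weak_family_bound]; by (wM) such averages are bounded in terms of the E-norm. *)
Lemma bounded_of_EinfW E n : TIBF_bounded_type E -> exists m A, [/\ (n <= m)%N, 0 <= A &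
  forall f s, EinfW E W f -> (size s <= n)%N ->
    \forall x \ae mu, normc (family n f s x) * W n x <= A * EnW_norm E m (W m) f].
Proof.
move=> tE; have [m0 [C [nm0 C0 HC]]] := weight_moderate hM n.
(* N must reach m0 to absorb the shift of the weight, and d + n to provide the d further
   derivatives. *)
pose N := maxn m0 (d + n).
have nN : (n <= N)%N by rewrite (leq_trans nm0)// leq_maxl.
have HCN x y : cbox (@rad R d) y -> W n (x + y) <= C * W N x.
  move=> yr; apply: le_trans (HC x y yr) _; rewrite ler_wpM2l ?(ltW C0)//.
  by apply: (weight_mono hW); rewrite leq_maxl.
have W0 k x : 0 <= W k x by rewrite ltW// (weight_gt0 hW).
have [A0 A00 HA] := average_bound tE (ltW C0) (W0 n) (W0 N) HCN.
pose c : R := (size (subseqs (enum 'I_d)))%:R * (1 + (@rad R d)^-1) ^+ d.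
have c0 : 0 <= c by rewrite mulr_ge0// exprn_ge0// addr_ge0// invr_ge0 (ltW rad_gt0).
exists N, (c * A0); split => //; first exact: mulr_ge0.
move=> f s Ef sn; rewrite (family_mono f nN sn).
have EfN : EnW E N (W N) f by apply: Ef.
have nrm0 : 0 <= EnW_norm E N (W N) f by exact: EnW_norm_ge0.
have := @weak_family_bound R d (@rad R d) rad_gt0 N (family N f) s (W n) (A0 * EnW_norm E N (W N) f).
rewrite mulrA; apply => //.
- exact: (EnW_weak_family tE EfN).
- by apply: leq_trans (leq_maxr _ _); rewrite leq_add2l.
- exact: mulr_ge0.
- move=> t x tN; have [lt _ Et] := EnW_family_spec tE EfN tN.
  apply: le_trans (HA _ x lt Et) _; rewrite lee_fin ler_wpM2l//.
  exact: fnorm_family_le.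
Qed.

Hypothesis hN : condition_N W.

(** Weighted sup bounds are the intermediary: the E-norms control them by [bounded_of_EinfW], and
    they control the F-norm by [solid_of_bounded]. One estimate yields the inclusion and its
    continuity. *)
Lemma EinfW_transfer E F n : TIBF_bounded_type E -> solid_TIBF_bounded_type F ->
  exists m A, 0 <= A /\ forall f, EinfW E W f ->
    EnW F n (W n) f /\ EnW_norm F n (W n) f <= A * EnW_norm E m (W m) f.
Proof.
move=> tE sF; have [tF _] := sF.
have [p [np H]] := solid_of_bounded hW hM hN n; have [A1 A10 H1] := H F sF.
have [m [A2 [pm A20 H2]]] := bounded_of_EinfW p tE.
exists m, (A1 * A2); split => [|f Ef]; first exact: mulr_ge0.
have Efn : EnW E n (W n) f by apply: Ef.
have Efp : EnW E p (W p) f by apply: Ef.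
have Efm : EnW E m (W m) f by apply: Ef.
have nrm0 : 0 <= EnW_norm E m (W m) f by exact: EnW_norm_ge0.
have key s : (size s <= n)%N -> F (mul_weight (family n f s) (W n)) /\
    fnorm F (mul_weight (family n f s) (W n)) <= A1 * (A2 * EnW_norm E m (W m) f).
  move=> sn; rewrite (family_mono f np sn).
  have [lf _ _] := EnW_family_spec tE Efp (leq_trans sn np).
  apply: H1 => //; first exact: mulr_ge0.
  by apply: H2 => //; exact: leq_trans sn np.
split; last first.
  by rewrite -mulrA; apply: EnW_norm_le => [|s sn]; [rewrite !mulr_ge0|exact: (key s sn).2].
split; first exact: Efn.1.
move=> a an; have [ld fd _] := EnW_density tE Efn an; exists (density (dderiv a f)); split => //.
rewrite (family_dderiv f an); apply: (key _ _).1; by rewrite size_mseq.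
Qed.

(** Neighbourhoods are described by norms of differences, so the transfer estimate has to be applied
    to g - f. *)
Lemma EinfW_sub E f (g : @functional R d) : TIBF_bounded_type E -> EinfW E W f -> EinfW E W g ->
  EinfW E W (fun phi => g phi - f phi).
Proof.
move=> tE Ef Eg n _; have Efn : EnW E n (W n) f by apply: Ef.
have Egn : EnW E n (W n) g by apply: Eg.
have key m (a : mindex d m) (lf lg : X -> R[i]) : L1loc lf -> L1loc lg ->
    dderiv a f = regular lf -> dderiv a g = regular lg ->
    dderiv a (fun phi => g phi - f phi) = regular (fun x => lg x - lf x).
  move=> Lf Lg Hf Hg; rewrite regularB// -Hf -Hg; apply/funext => phi.
  by rewrite /dderiv mulrBr.
split.
  have [lf Hf _] := EnW_family_spec tE (s := [::]) Efn (leq0n _).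
  have [lg Hg _] := EnW_family_spec tE (s := [::]) Egn (leq0n _).
  have := key _ _ _ _ lf lg Hf Hg; rewrite dderiv0 => ->.
  apply: distribution_regular.
  rewrite (_ : (fun x => _) = (fun x => family n g [::] x + (-1) * family n f [::] x)).
    by apply: L1locD => //; exact: L1locZ.
  by apply/funext => x; rewrite mulN1r.
move=> a an; have [lf Hf Ef1] := EnW_density tE Efn an; have [lg Hg Eg1] := EnW_density tE Egn an.
have lB : L1loc (fun x => density (dderiv a g) x - density (dderiv a f) x).
  rewrite (_ : (fun x => _) = (fun x => density (dderiv a g) x + (-1) * density (dderiv a f) x)).
    by apply: L1locD => //; exact: L1locZ.
  by apply/funext => x; rewrite mulN1r.
exists (fun x => density (dderiv a g) x - density (dderiv a f) x); split => //; first exact: key.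
have := tibf_add tE Eg1 (tibf_scale tE (-1) Ef1); congr (fcarrier E _).
by apply/funext => x; rewrite /mul_weight; ring.
Qed.

Lemma EinfW_open_transfer E F : solid_TIBF_bounded_type E -> solid_TIBF_bounded_type F ->
  EinfW E W = EinfW F W -> EinfW_open F W `<=` EinfW_open E W.
Proof.
move=> sE sF EF U [UF Uopen]; have [tE _] := sE; have [tF _] := sF.
split; first by rewrite EF.
move=> f Uf; have [N [e [e0 He]]] := Uopen f Uf.
have /choice[m /choice[A HA]] : forall n, exists m, exists A, 0 <= A /\ forall f, EinfW E W f ->
    EnW F n (W n) f /\ EnW_norm F n (W n) f <= A * EnW_norm E m (W m) f.
  by move=> n; have [m [A H]] := EinfW_transfer n tE sF; exists m, A.
(* The finitely many indices m n and constants A n with n <= N are replaced by their maximum and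
   their sum; dividing e by S + 1 keeps the final inequality strict. *)
pose M := \max_(n < N.+1) m n; pose S := \sum_(n < N.+1) A n.
have A0 n : 0 <= A n by have [] := HA n.
have S0 : 0 <= S by apply: sumr_ge0 => n _.
exists M, (e / (S + 1)); split; first by rewrite divr_gt0// ltr_wpDl.
move=> g Eg gf; apply: He; first by rewrite -EF.
have Ef : EinfW E W f by rewrite EF; exact: UF.
have Egf := EinfW_sub tE Ef Eg.
move=> n nN; have [_ /(_ _ Egf)[_ le]] := HA n.
apply: le_lt_trans le _.
have mM : (m n <= M)%N by have := @leq_bigmax _ (fun n : 'I_N.+1 => m n) (Ordinal (nN : (n < N.+1)%N)).
have AS : A n <= S.
  by rewrite /S (bigD1 (Ordinal (nN : (n < N.+1)%N)))//= lerDl sumr_ge0.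
apply: (@le_lt_trans _ _ (S * (e / (S + 1)))).
  by apply: ler_pM => //; [exact: EnW_norm_ge0|exact: ltW (gf _ mM)].
by rewrite mulrCA gtr_pMr// ltr_pdivrMr ?ltr_wpDl// mul1r ltrDl.
Qed.

Lemma N_eq_Frechet E F : solid_TIBF_bounded_type E -> solid_TIBF_bounded_type F ->
  eq_Frechet E F W.
Proof.
move=> sE sF; have sub E1 E2 : TIBF_bounded_type E1 -> solid_TIBF_bounded_type E2 ->
    EinfW E1 W `<=` EinfW E2 W.
  move=> t1 s2 f E1f n _; have [m [A [_ H]]] := EinfW_transfer n t1 s2.
  exact: (H f E1f).1.
have EF : EinfW E W = EinfW F W by apply/seteqP; split; apply: sub => //; [case: sE|case: sF].
by split => //; apply/seteqP; split; exact: EinfW_open_transfer.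
Qed.

End frechet_comparison.

(** * The spaces L^1 and L^oo *)

Section complex_limits.
Context {R : realType} {d : nat}.
Local Notation X := 'rV[R]_d.
Local Notation mu := (@lebesgue_rV R d).
Local Notation Re := (@complex.Re R).
Local Notation Im := (@complex.Im R).
Implicit Types (f g : X -> R[i]) (v : nat -> X -> R[i]).

Lemma normc_leD (z1 z2 : R[i]) : normc (z1 + z2) <= normc z1 + normc z2.
Proof. by have := normc_sum [:: z1; z2] id; rewrite !big_cons !big_nil !addr0. Qed.

Lemma cborelB f g : cborel f -> cborel g -> cborel (fun x => f x - g x).
Proof.
move=> cf cg; rewrite (_ : (fun x => _) = fun x => f x + (-1) * g x).
  by apply: cborelD => //; apply: cborelM => //; exact: cborel_cst.
by apply/funext => x; rewrite mulN1r.
Qed.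

Lemma cvg_normc (z : nat -> R[i]) (l : R[i]) :
  (Re (z n) @[n --> \oo] --> Re l) -> (Im (z n) @[n --> \oo] --> Im l) ->
  normc (z n - l) @[n --> \oo] --> 0.
Proof.
move=> cR cI; have cvg0 (u : nat -> R) a : (u @ \oo --> a) -> `|u n - a| @[n --> \oo] --> 0.
  move=> ua; rewrite -(@normr0 _ R) -(subrr a); apply: cvg_norm; apply: cvgB => //; exact: cvg_cst.
apply: (@squeeze_cvgr _ _ _ _ (fun=> 0) (fun n => `|Re (z n) - Re l| + `|Im (z n) - Im l|)).
- by apply: nearW => n; rewrite normc_ge0/= -ReB -ImB normc_le.
- exact: cvg_cst.
- by rewrite -[X in _ --> X]addr0; apply: cvgD; exact: cvg0.
Qed.

(** The limit is set to 0 off the measurable set B, which makes it a pointwise limit of Borel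
    functions everywhere. *)
Lemma cborel_limit v (B : set X) : measurable B -> (forall n, cborel (v n)) ->
  (forall x, B x -> cvgn (fun n => Re (v n x)) /\ cvgn (fun n => Im (v n x))) ->
  exists2 f, cborel f & forall x, B x -> normc (v n x - f x) @[n --> \oo] --> 0.
Proof.
move=> mB cv cB.
pose f x : R[i] := if x \in B then limn (fun n => Re (v n x)) +i* limn (fun n => Im (v n x)) else 0.
exists f; last first.
  move=> x Bx; have [c1 c2] := cB x Bx.
  by apply: cvg_normc; rewrite /f mem_set.
have mi : measurable_fun setT (\1_B : X -> R) by exact: measurable_indic.
split.
- apply: (@measurable_fun_cvg _ _ _ setT (fun n x => Re (v n x) * \1_B x)) => [n|x _].
    by apply: measurable_funM => //; exact: (cv n).1.
  rewrite /f/= indicE; case: ifPn => [/set_mem Bx|_] /=.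
    by under eq_cvg do rewrite mulr1; exact: (cB x Bx).1.
  by under eq_cvg do rewrite mulr0; exact: cvg_cst.
- apply: (@measurable_fun_cvg _ _ _ setT (fun n x => Im (v n x) * \1_B x)) => [n|x _].
    by apply: measurable_funM => //; exact: (cv n).2.
  rewrite /f/= indicE; case: ifPn => [/set_mem Bx|_] /=.
    by under eq_cvg do rewrite mulr1; exact: (cB x Bx).2.
  by under eq_cvg do rewrite mulr0; exact: cvg_cst.
Qed.

End complex_limits.

(** * L^1 is a solid TIBF of bounded type *)

Section L1_space.
Context {R : realType} {d : nat}.
Local Notation X := 'rV[R]_d.
Local Notation mu := (@lebesgue_rV R d).
Implicit Types (f g : X -> R[i]).

Let I f := (\int[mu]_x (normc (f x))%:E)%E.

Lemma lintegral_normcD f g : cmeasurable f -> cmeasurable g ->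
  (I (fun x => f x + g x)%R <= I f + I g)%E.
Proof.
move=> /cmeasurable_repr[f' cf ff'] /cmeasurable_repr[g' cg gg'].
have aeI h h' : (\forall x \ae mu, h x = h' x) -> I h = I h'.
  by move=> hh; apply: integral_ae_any; apply: filterS hh => x ->.
rewrite (aeI _ _ ff') (aeI _ _ gg') (aeI _ (fun x => f' x + g' x)); last first.
  by apply: filterS2 ff' gg' => x -> ->.
have m0 h : cborel h -> measurable_fun setT (fun x => (normc (h x))%:E).
  by move=> ch; apply/measurable_EFinP; exact: measurable_normc.
rewrite -ge0_integralD//; [|by move=> x _; rewrite lee_fin normc_ge0|exact: m0|by move=> x _; rewrite lee_fin normc_ge0|exact: m0].
apply: ge0_le_integral_any => x _; first by rewrite lee_fin normc_ge0.
by rewrite -EFinD lee_fin normc_leD.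
Qed.

Lemma lmeasurable_normc f : cmeasurable f -> lmeasurable (fun x => normc (f x)).
Proof.
move=> /cmeasurable_repr[g cg fg]; exists (fun x => normc (g x)); first exact: measurable_normc.
by apply: filterS fg => x ->.
Qed.

Lemma lintegral_normcZ a f : cmeasurable f -> I (fun x => a * f x) = ((normc a)%:E * I f)%E.
Proof.
move=> mf; rewrite /I -lintegralZl ?normc_ge0//.
- by under eq_integral do rewrite normcM.
- exact: lmeasurable_normc.
- by move=> x; rewrite normc_ge0.
Qed.

Lemma lintegral_normc_eq0 f : cmeasurable f -> I f = 0%E -> \forall x \ae mu, f x = 0.
Proof.
move=> /cmeasurable_repr[g cg fg] If0.
have : (\int[mu]_x `|(normc (g x))%:E| = 0)%E.
  rewrite -[RHS]If0; apply: integral_ae_any; apply: filterS fg => x ->.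
  by rewrite gee0_abs// lee_fin normc_ge0.
move/(ae_eq_integral_abs mu measurableT (f := fun x => (normc (g x))%:E)).
have mg : measurable_fun setT (fun x => (normc (g x))%:E).
  by apply/measurable_EFinP; exact: measurable_normc.
move=> /(_ mg) g0; apply: filterS2 fg g0 => x -> /(_ Logic.I) [] /eqP.
by rewrite normc_eq0 => /eqP.
Qed.

Lemma indic_cbox_neq0 (r : R) : 0 < r -> ~ (\forall x \ae mu, (\1_(cbox r) x : R)%:C = 0).
Proof.
move=> r0 H; have : (\int[mu]_x (\1_(cbox r) x : R)%:E = 0)%E.
  rewrite (@integral_ae_any _ _ _ mu setT _ (cst 0%E)) ?integral0//.
  by apply: filterS H => x; rewrite /cst/= => /(congr1 (@complex.Re R)) /= ->.
rewrite integral_indic//; last exact: measurable_cbox.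
rewrite setIT -[X in X = _]/(mu (@cbox R d r)) lebesgue_cbox ?(ltW r0)// => /eqP.
by rewrite gt_eqF// lte_fin exprn_gt0// mulrn_wgt0.
Qed.

(** Riesz-Fischer: a subsequence with increments below 2^-(k+1) in norm telescopes to an almost
    everywhere absolutely convergent series. Fatou's lemma then bounds the distance of every late u
    n from its limit. *)
Lemma L1_complete (u : nat -> X -> R[i]) : (forall n, cmeasurable (u n)) ->
  (forall e : R, 0 < e -> exists N, forall m n, (N <= m)%N -> (N <= n)%N ->
      (I (fun x => u m x - u n x)%R < e%:E)%E) ->
  exists2 f, cmeasurable f & forall e : R, 0 < e -> exists N, forall n, (N <= n)%N ->
    (I (fun x => u n x - f x)%R <= e%:E)%E.
Proof.
move=> mu_ cau.
have /choice[v Hv] : forall n, exists g, cborel g /\ \forall x \ae mu, u n x = g x.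
  by move=> n; have [g ? ?] := cmeasurable_repr (mu_ n); exists g.
have cv n : cborel (v n) by case: (Hv n).
have aeI h h' : (\forall x \ae mu, h x = h' x) -> I h = I h'.
  by move=> hh; apply: integral_ae_any; apply: filterS hh => x ->.
have uvI m n : I (fun x => u m x - u n x) = I (fun x => v m x - v n x).
  by apply: aeI; apply: filterS2 (Hv m).2 (Hv n).2 => x -> ->.
have /choice[K HK] : forall k, exists N, forall m n, (N <= m)%N -> (N <= n)%N ->
      (I (fun x => v m x - v n x)%R < (1 / (2 ^ (k + 1))%:R)%:E)%E.
  move=> k; have [|N HN] := cau (1 / (2 ^ (k + 1))%:R); first by rewrite divr_gt0// ltr0n expn_gt0.
  by exists N => m n Nm Nn; rewrite -uvI; exact: HN.
(* This index is nondecreasing, at least K k, and at least k; the last makes the subsequence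
   eventually pass any threshold N. *)
pose J k := (k + \sum_(j < k.+1) K j)%N.
have JK k : (K k <= J k)%N by rewrite /J big_ord_recr /= addnA leq_addl.
have JJ k : (J k <= J k.+1)%N by rewrite /J leq_add// [leqRHS]big_ord_recr leq_addr.
have Jmono k l : (k <= l)%N -> (J k <= J l)%N.
  by move=> /subnK<-; elim: (l - k)%N => [//|i IH]; rewrite addSn (leq_trans IH).
pose w k := v (J k).
have HJ k l : (k <= l)%N -> (I (fun x => w l x - w k x)%R < (1 / (2 ^ (k + 1))%:R)%:E)%E.
  by move=> kl; apply: HK; rewrite ?JK// (leq_trans (JK k))// Jmono.
pose a k x := normc (w k.+1 x - w k x).
have a0 k x : 0 <= a k x by exact: normc_ge0.
have ma k : measurable_fun setT (fun x => (a k x)%:E).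
  by apply/measurable_EFinP; apply: measurable_normc; exact: (cborelB (cv _) (cv _)).
pose S x := (\sum_(k <oo) (a k x)%:E)%E.
have S0 x : (0 <= S x)%E by apply: nneseries_ge0 => *; rewrite lee_fin.
have mS : measurable_fun setT S.
  by apply: ge0_emeasurable_sum => [k x _ _|k _]; [rewrite lee_fin|exact: ma].
have IS : (\int[mu]_x S x < +oo)%E.
  rewrite integral_nneseries//; last by move=> k x _; rewrite lee_fin.
  apply: (@le_lt_trans _ _ (\sum_(k <oo) (1 / (2 ^ (k + 1))%:R)%:E)%E).
    apply: lee_nneseries => [k _ _|k _]; last exact/ltW/HJ.
    by apply: integral_ge0 => x _; rewrite lee_fin.
  by rewrite (cvg_lim _ (@cvg_geometric_eseries_half R 1 0))// ltry.
have aeS : \forall x \ae mu, (S x < +oo)%E.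
  have /integrable_ae : mu.-integrable setT S.
    apply/integrableP; split => //; under eq_integral do rewrite (gee0_abs (S0 _)).
    exact: IS.
  by move=> /(_ measurableT); apply: filterS => x /(_ Logic.I); rewrite ge0_fin_numE.
pose B := [set x | (S x < +oo)%E].
have mB : measurable B.
  by rewrite -[B]setTI; exact: emeasurable_fun_infty_o.
have cB x : B x -> cvgn (fun n => complex.Re (w n x)) /\ cvgn (fun n => complex.Im (w n x)).
  move=> Bx; have cser (b : nat -> R) : (forall k, `|b k| <= a k x) -> cvgn (series b).
    move=> ba; apply: normed_cvg; apply: nondecreasing_is_cvgn.
      by apply: nondecreasing_series => k _ _ /=.
    exists (fine (S x)) => _ [k _ <-]; rewrite -lee_fin fineK ?ge0_fin_numE//.
    rewrite /series/= -sumEFin; apply: le_trans (nneseries_lim_ge k _).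
      by apply: lee_sum => i _; rewrite lee_fin.
    by move=> *; rewrite lee_fin.
  split.
  - rewrite (_ : (fun n => _) = fun n => complex.Re (w 0%N x) + series (telescope (fun n => complex.Re (w n x))) n).
      apply: is_cvgD; first exact: is_cvg_cst.
      by apply: cser => k; rewrite /telescope/= -ReB normr_Re_le.
    by apply/funext => n; rewrite -eq_sum_telescope.
  - rewrite (_ : (fun n => _) = fun n => complex.Im (w 0%N x) + series (telescope (fun n => complex.Im (w n x))) n).
      apply: is_cvgD; first exact: is_cvg_cst.
      by apply: cser => k; rewrite /telescope/= -ImB normr_Im_le.
    by apply/funext => n; rewrite -eq_sum_telescope.
have [f cf wf] := cborel_limit mB (fun k => cv (J k)) cB.
exists f; first exact: cborel_cmeasurable.
move=> e e0; have [N HN] := cau e e0; exists N => n Nn.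
rewrite (aeI _ (fun x => v n x - f x)); last by apply: filterS (Hv n).2 => x ->.
pose h k x := (normc (v n x - w k x)%R)%:E.
have mh k : measurable_fun setT (h k).
  by apply/measurable_EFinP; apply: measurable_normc; exact: (cborelB (cv _) (cv _)).
have h0 k x : setT x -> (0 <= h k x)%E by move=> _; rewrite lee_fin normc_ge0.
have := fatou mu measurableT mh h0.
rewrite (_ : (\int[mu]_x limn_einf (h ^~ x))%E = I (fun x => v n x - f x)); last first.
  apply: integral_ae_any; apply: filterS aeS => x Bx.
  apply: (cvg_limn_einf_sup _).1; apply: cvg_EFin; first exact: nearW.
  have wf0 := wf x Bx.
  have key k : `|normc (v n x - w k x) - normc (v n x - f x)| <= normc (w k x - f x).
    have t1 : normc (v n x - w k x) <= normc (v n x - f x) + normc (w k x - f x).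
      rewrite (normc_subC (w k x)); apply: le_trans (normc_leD _ _).
      by rewrite [X in normc X <= _](_ : _ = v n x - f x + (f x - w k x))//; ring.
    have t2 : normc (v n x - f x) <= normc (v n x - w k x) + normc (w k x - f x).
      apply: le_trans (normc_leD _ _).
      by rewrite [X in normc X <= _](_ : _ = v n x - w k x + (w k x - f x))//; ring.
    by rewrite ler_norml; apply/andP; split; lra.
  apply/cvgrPdist_le => r r0; move/cvgrPdist_le : wf0 => /(_ r r0).
  apply: filterS => k H; apply: le_trans H.
  by rewrite sub0r normrN (ger0_norm (normc_ge0 _)) distrC; exact: key.
move/le_trans; apply; rewrite limn_einf_lim; apply: lime_le; first exact: is_cvg_einfs.
near=> k; apply: (@le_trans _ _ (\int[mu]_x h k x)%E).
  by apply: ereal_inf_lbound; exists k => /=.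
apply: ltW; rewrite -[X in (X < _)%E]/(I (fun x => v n x - w k x)) -uvI; apply: HN => //.
by apply: leq_trans (leq_addr _ k); near: k; exact: nbhs_infty_ge.
Unshelve. all: by end_near.
Qed.

End L1_space.

Section L1_solid.
Context {R : realType} {d : nat}.
Local Notation X := 'rV[R]_d.
Local Notation mu := (@lebesgue_rV R d).
Implicit Types (f g : X -> R[i]).

Let I f := (\int[mu]_x (normc (f x))%:E)%E.
Lemma cmeasurableZ a f : cmeasurable f -> cmeasurable (fun x => a * f x).
Proof. by apply: cmeasurableM; apply: cborel_cmeasurable; exact: cborel_cst. Qed.

Let I_ge0 f : (0 <= I f)%E.
Proof. by apply: integral_ge0 => x _; rewrite lee_fin normc_ge0. Qed.

Lemma fnorm_Lp1E f : Lp_space R d 1 f -> (fnorm (Lp_space R d 1) f)%:E = I f.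
Proof. by move=> /Lp1P[_ If]; rewrite fnorm_Lp1 fineK// ge0_fin_numE//; exact: I_ge0. Qed.

Lemma Lp_space1_solid : solid_TIBF_bounded_type (Lp_space R d 1).
Proof.
have addL f g : Lp_space R d 1 f -> Lp_space R d 1 g -> Lp_space R d 1 (fun x => f x + g x).
  move=> /Lp1P[mf If] /Lp1P[mg Ig]; apply/Lp1P; split; first exact: cmeasurableD.
  by apply: le_lt_trans (lintegral_normcD mf mg) _; rewrite lte_add_pinfty.
have scaleL a f : Lp_space R d 1 f -> Lp_space R d 1 (fun x => a * f x).
  move=> /Lp1P[mf If]; apply/Lp1P; split; first exact: cmeasurableZ.
  by rewrite lintegral_normcZ// lte_mul_pinfty// lee_fin normc_ge0.
split; first split.
- move=> f /Lp1P[mf If]; split => // K _; apply: le_lt_trans If.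
  by apply: ge0_subset_integral_any => // x _; rewrite lee_fin normc_ge0.
- move=> f g /Lp1P[mf If] gf.
  have E : I g = I f by apply: integral_ae_any; apply: filterS gf => x ->.
  by rewrite !fnorm_Lp1 -!/(I _) E; split => //; apply/Lp1P; split; [exact: cmeasurable_ae gf|rewrite -/(I g) E].
- apply/Lp1P; split; first by have [] := @L1loc0 R d.
  by rewrite normc0 integral0 ltry.
- exact: addL.
- exact: scaleL.
- by move=> f _; rewrite fnorm_Lp1; exact: (fine_ge0 (I_ge0 f)).
- move=> f Lf f0; have /Lp1P[mf _] := Lf.
  by apply: lintegral_normc_eq0 => //; rewrite -/(I f) -fnorm_Lp1E// f0.
- move=> f g Lf Lg; rewrite -lee_fin EFinD !fnorm_Lp1E//; last exact: addL.
  have /Lp1P[mf _] := Lf; have /Lp1P[mg _] := Lg; exact: lintegral_normcD.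
- move=> a f Lf; apply: EFin_inj; rewrite EFinM !fnorm_Lp1E//; last exact: scaleL.
  have /Lp1P[mf _] := Lf; exact: lintegral_normcZ.
- move=> u Lu cau; have mu_ n : cmeasurable (u n) by have /Lp1P[] := Lu n.
  have LB f g : Lp_space R d 1 f -> Lp_space R d 1 g -> Lp_space R d 1 (fun x => f x - g x).
    move=> Lf Lg; have := addL _ _ Lf (scaleL (-1) _ Lg); congr (fcarrier _ _).
    by apply/funext => x; rewrite mulN1r.
  have [||f mf Hf] := @L1_complete R d u => //.
    move=> e e0; have [N HN] := cau e e0; exists N => m n Nm Nn.
    by rewrite -/(I _) -fnorm_Lp1E ?lte_fin; [exact: HN|exact: LB].
  (* The limit is u N minus the difference u N - f, which has finite norm. *)
  have Lf : Lp_space R d 1 f.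
    have [N /(_ N (leqnn N)) HN] := Hf 1 ltr01.
    have LD : Lp_space R d 1 (fun x => u N x - f x).
      apply/Lp1P; split; last by rewrite (le_lt_trans HN)// ltry.
      have := cmeasurableD (mu_ N) (cmeasurableZ (-1) mf).
      by congr cmeasurable; apply/funext => x; rewrite mulN1r.
    have := LB _ _ (Lu N) LD; congr (fcarrier _ _).
    by apply/funext => x; ring.
  exists f => //; apply/cvgrPdist_le => e e0; have [N HN] := Hf e e0.
  exists N => // n Nn; rewrite sub0r normrN ger0_norm; last by rewrite fnorm_Lp1; exact: (fine_ge0 (I_ge0 _)).
  by rewrite -lee_fin fnorm_Lp1E; [exact: HN|exact: LB].
- exists (fun x => (\1_(cbox 1) x)%:C); last exact: indic_cbox_neq0.
  by apply: indic_L1; rewrite ?lebesgue_cbox ?ltry//; exact: measurable_cbox.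
- move=> K _; exists 1 => f Lf; rewrite mul1r fnorm_Lp1E//.
  by apply: ge0_subset_integral_any => // x _; rewrite lee_fin normc_ge0.
- move=> x f /Lp1P[mf If]; apply/Lp1P; split; first exact: cmeasurable_translate.
  rewrite (lintegral_translate (f := fun x => normc (f x)))//; first exact: lmeasurable_normc.
  by move=> ?; rewrite normc_ge0.
- exists 1 => // x f /Lp1P[mf If]; rewrite mul1r !fnorm_Lp1.
  rewrite (lintegral_translate (f := fun x => normc (f x)))//; first exact: lmeasurable_normc.
  by move=> ?; rewrite normc_ge0.
- move=> f g Lf Lg; have /Lp1P[mf If] := Lf; have /Lp1P[mg Ig] := Lg.
  have Lc : Lp_space R d 1 (convolution f g).
    apply/Lp1P; split; first exact: cmeasurable_convolution.
    by apply: le_lt_trans (normc_convolution_int_le mf mg) _; rewrite lte_mul_pinfty// ?ge0_fin_numE//; exact: I_ge0.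
  split => //; rewrite -lee_fin EFinM !fnorm_Lp1E//; exact: normc_convolution_int_le.
- move=> f g Lf [mg _] gf; have /Lp1P[mf If] := Lf.
  have le : (I g <= I f)%E.
    apply: ae_le_integral_any; [by move=> x _; rewrite lee_fin normc_ge0..|].
    by apply: filterS gf => x; rewrite lee_fin.
  have Lg : Lp_space R d 1 g by apply/Lp1P; split => //; exact: le_lt_trans le If.
  by split => //; rewrite -lee_fin !fnorm_Lp1E.
Qed.

End L1_solid.

(** * L^oo is a solid TIBF of bounded type *)

Section Loo_solid.
Context {R : realType} {d : nat}.
Local Notation X := 'rV[R]_d.
Local Notation mu := (@lebesgue_rV R d).
Local Notation Loo := (Lp_space R d +oo%E).
Implicit Types (f g : X -> R[i]).

Lemma real_cauchy_cvg (z : nat -> R) :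
  (forall e, 0 < e -> exists N, forall n, (N <= n)%N -> `|z N - z n| < e) -> cvgn z.
Proof.
move=> H; apply/cauchy_cvgP; apply: cauchy_exP => e e0; have [N HN] := H e e0.
by exists (z N), N => // n /= Nn; exact: HN.
Qed.

Lemma ex_invS_lt (e : R) : 0 < e -> exists k, k.+1%:R^-1 < e.
Proof. by move=> e0; have [N _ /(_ N (leqnn N)) H] := near_infty_natSinv_lt (PosNum e0); exists N. Qed.

(** Positivity of the total measure is what lets the L^oo norm unfold to an essential supremum. *)
Lemma lebesgue_rV_gt0 : (0 < mu [set: X])%E.
Proof.
apply: (@lt_le_trans _ _ (mu (@cbox R d 1))).
  by rewrite lebesgue_cbox// lte_fin exprn_gt0// mulrn_wgt0.
by apply: le_measure => //; rewrite ?inE//; exact: measurable_cbox.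
Qed.

Let Lnorm_ooE f : ('N[mu]_+oo[(fun x => (normc (f x))%:E)] =
  ess_sup mu (fun x => (normc (f x))%:E))%E.
Proof.
rewrite unlock lebesgue_rV_gt0; congr (ess_sup _ _); apply/funext => x /=.
by rewrite ger0_norm// normc_ge0.
Qed.

Let ess_sup_ge0 f : (0 <= ess_sup mu (fun x => (normc (f x))%:E))%E.
Proof.
by apply: ess_sup_gee; [exact: lebesgue_rV_gt0|apply: nearW => x; rewrite lee_fin normc_ge0].
Qed.

Lemma LpooP f : Loo f <-> cmeasurable f /\ exists M, \forall x \ae mu, normc (f x) <= M.
Proof.
rewrite /Lp_space/= Lnorm_ooE; split => -[mf]; last first.
  move=> [M HM]; split => //; apply: (@le_lt_trans _ _ M%:E); last exact: ltry.
  by apply/ess_supP; apply: filterS HM => x; rewrite lee_fin.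
move=> fin; split => //; exists (fine (ess_sup mu (fun x => (normc (f x))%:E))).
apply: filterS (ess_sup_ge mu (fun x => (normc (f x))%:E)) => x.
by rewrite -lee_fin fineK// ge0_fin_numE.
Qed.

Lemma fnorm_Lpoo_ae f : Loo f -> \forall x \ae mu, normc (f x) <= fnorm Loo f.
Proof.
rewrite /Lp_space/= Lnorm_ooE => -[mf fin].
apply: filterS (ess_sup_ge mu (fun x => (normc (f x))%:E)) => x.
by rewrite -lee_fin fineK// ge0_fin_numE.
Qed.

(** Membership and norm bound come together; with [fnorm_Lpoo_ae] this reduces most of the axioms to
    inequalities that hold almost everywhere. *)
Lemma fnorm_Lpoo_le f M : cmeasurable f -> (\forall x \ae mu, normc (f x) <= M) ->
  Loo f /\ fnorm Loo f <= M.
Proof.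
move=> mf HM; have Lf : Loo f by apply/LpooP; split => //; exists M.
split => //; move: Lf; rewrite /Lp_space/= Lnorm_ooE => -[_ fin].
rewrite -lee_fin fineK ?ge0_fin_numE//.
by apply/ess_supP; apply: filterS HM => x; rewrite lee_fin.
Qed.

Lemma fnorm_Lpoo_ge0 f : 0 <= fnorm Loo f.
Proof. by rewrite /= Lnorm_ooE fine_ge0. Qed.

(** The countably many exceptional null sets are discarded at once: on the remaining set B the
    Cauchy estimates hold for all pairs of late indices, so convergence is uniform there. *)
Lemma Loo_complete (u : nat -> X -> R[i]) : (forall n, Loo (u n)) ->
  (forall e : R, 0 < e -> exists N, forall m n, (N <= m)%N -> (N <= n)%N ->
      \forall x \ae mu, normc (u m x - u n x) <= e) ->
  exists2 f, cmeasurable f & forall e : R, 0 < e -> exists N, forall n, (N <= n)%N ->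
    \forall x \ae mu, normc (u n x - f x) <= e.
Proof.
move=> Lu cau.
have /choice[v Hv] : forall n, exists g, cborel g /\ \forall x \ae mu, u n x = g x.
  by move=> n; have [|g ? ?] := @cmeasurable_repr _ _ (u n); [case: (Lu n)|exists g].
have cv n : cborel (v n) by case: (Hv n).
have /choice[K HK] : forall k, exists N, forall m n, (N <= m)%N -> (N <= n)%N ->
      \forall x \ae mu, normc (v m x - v n x) <= k.+1%:R^-1.
  move=> k; have [|N HN] := cau (k.+1%:R^-1); first by rewrite invr_gt0.
  exists N => m n Nm Nn; apply: filterS3 (HN m n Nm Nn) (Hv m).2 (Hv n).2.
  by move=> x H <- <-.
pose b k m n := [set x | normc (v (K k + m)%N x - v (K k + n)%N x) <= k.+1%:R^-1].
pose B := \bigcap_k \bigcap_m \bigcap_n b k m n.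
have mB : measurable B.
  apply: bigcapT_measurable => k; apply: bigcapT_measurable => m; apply: bigcapT_measurable => n.
  rewrite -[b k m n]setTI; apply: measurable_fun_le => //.
  by apply: measurable_normc; exact: (cborelB (cv _) (cv _)).
have aeB : \forall x \ae mu, B x.
  have H k m n : \forall x \ae mu, b k m n x by apply: HK; rewrite leq_addr.
  have := ae_foralln (fun k => ae_foralln (fun m => ae_foralln (H k m))).
  by apply: filterS => x H' k _ m _ n _; exact: H'.
have key x k m n : B x -> (K k <= m)%N -> (K k <= n)%N -> normc (v m x - v n x) <= k.+1%:R^-1.
  move=> Bx Km Kn; have := Bx k Logic.I (m - K k)%N Logic.I (n - K k)%N Logic.I.
  by rewrite /b/= !subnKC.
have cB x : B x -> cvgn (fun n => complex.Re (v n x)) /\ cvgn (fun n => complex.Im (v n x)).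
  move=> Bx.
  have cau' (z : nat -> R) : (forall m n, `|z m - z n| <= normc (v m x - v n x)) -> cvgn z.
    move=> zv; apply: real_cauchy_cvg => e /ex_invS_lt[k ke]; exists (K k) => n Kn.
    by apply: le_lt_trans ke; apply: le_trans (zv _ _) _; exact: key.
  by split; apply: cau' => m n; rewrite -?ReB -?ImB ?normr_Re_le ?normr_Im_le.
have [f cf wf] := cborel_limit mB cv cB.
exists f; first exact: cborel_cmeasurable.
move=> e /ex_invS_lt[k ke].
exists (K k) => n Kn; apply: filterS2 aeB (Hv n).2 => x Bx ->.
have ke0 : 0 < e - k.+1%:R^-1 by rewrite subr_gt0.
have /cvgrPdist_lt/(_ _ ke0) := wf x Bx.
move=> [N _ HN]; pose m := maxn N (K k).
have := HN m (leq_maxl _ _); rewrite sub0r normrN ger0_norm ?normc_ge0// => H.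
have := key x k n m Bx Kn (leq_maxr _ _).
rewrite (_ : v n x - f x = v n x - v m x + (v m x - f x)); last by ring.
move=> H2; apply: le_trans (normc_leD _ _) _; apply: (le_trans (lerD H2 (ltW H))).
by rewrite addrC subrK.
Qed.

Lemma Lp_spaceoo_solid : solid_TIBF_bounded_type Loo.
Proof.
have addL f g : Loo f -> Loo g -> Loo (fun x => f x + g x) /\
    fnorm Loo (fun x => f x + g x) <= fnorm Loo f + fnorm Loo g.
  move=> Lf Lg; apply: fnorm_Lpoo_le; first exact: cmeasurableD Lf.1 Lg.1.
  apply: filterS2 (fnorm_Lpoo_ae Lf) (fnorm_Lpoo_ae Lg) => x fx gx.
  by apply: le_trans (normc_leD _ _) _; exact: lerD.
have scaleL (a : R[i]) f : Loo f -> Loo (fun x => a * f x) /\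
    fnorm Loo (fun x => a * f x) <= normc a * fnorm Loo f.
  move=> Lf; apply: fnorm_Lpoo_le; first exact: cmeasurableZ Lf.1.
  by apply: filterS (fnorm_Lpoo_ae Lf) => x fx; rewrite normcM ler_wpM2l ?normc_ge0.
have LB f g : Loo f -> Loo g -> Loo (fun x => f x - g x).
  move=> Lf Lg; have := (addL _ _ Lf (scaleL (-1) _ Lg).1).1; congr (fcarrier _ _).
  by apply/funext => x; rewrite mulN1r.
have aeL f g : Loo f -> (\forall x \ae mu, g x = f x) -> Loo g /\ fnorm Loo g <= fnorm Loo f.
  move=> Lf gf; apply: fnorm_Lpoo_le; first exact: cmeasurable_ae Lf.1 gf.
  by apply: filterS2 (fnorm_Lpoo_ae Lf) gf => x ? ->.
have transL x f : Loo f -> Loo (translate x f) /\ fnorm Loo (translate x f) <= fnorm Loo f.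
  move=> Lf; apply: fnorm_Lpoo_le; first exact: cmeasurable_translate Lf.1.
  exact: (ae_translate (- x) (fnorm_Lpoo_ae Lf)).
have K_le K f : compact K -> Loo f ->
    (\int[mu]_(x in K) (normc (f x))%:E <= (fine (mu K) * fnorm Loo f)%:E)%E.
  move=> cK Lf; have mK := compact_measurable_rV cK.
  have [q _ Kq] := compact_sub_cbox cK.
  have muK : mu K \is a fin_num.
    rewrite ge0_fin_numE//; apply: le_lt_trans (lebesgue_cbox_lty _ q).
    by apply: le_measure Kq; rewrite inE; [exact: mK|exact: measurable_cbox].
  rewrite EFinM fineK// muleC -(integral_cst _ mK).
  apply: ae_le_integral_any; [by move=> x _; rewrite lee_fin normc_ge0|
    by move=> x _; rewrite lee_fin fnorm_Lpoo_ge0|].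
  by apply: filterS (fnorm_Lpoo_ae Lf) => x; rewrite lee_fin.
split; first split.
- move=> f Lf; split; first exact: Lf.1.
  by move=> K cK; apply: le_lt_trans (K_le K f cK Lf) _; exact: ltry.
- move=> f g Lf gf; have [Lg le1] := aeL _ _ Lf gf; split => //; apply/eqP.
  rewrite eq_le le1/=; apply: (aeL _ _ Lg _).2; by apply: filterS gf => x ->.
- apply/LpooP; split; first exact: (@L1loc0 R d).1.
  by exists 0; apply: nearW => x; rewrite normc0.
- by move=> f g Lf Lg; exact: (addL _ _ Lf Lg).1.
- by move=> a f Lf; exact: (scaleL a f Lf).1.
- by move=> f _; exact: fnorm_Lpoo_ge0.
- move=> f Lf f0; apply: filterS (fnorm_Lpoo_ae Lf) => x; rewrite f0 => fx.
  by apply/eqP; rewrite -normc_eq0 eq_le fx normc_ge0.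
- by move=> f g Lf Lg; exact: (addL _ _ Lf Lg).2.
- move=> a f Lf; apply/eqP; rewrite eq_le (scaleL a f Lf).2/=.
  (* For nonzero a the reverse inequality is the one already known, applied to the inverse of a and
     to a f. *)
  have [->|a0] := eqVneq a 0; first by rewrite normc0 mul0r fnorm_Lpoo_ge0.
  have na0 : 0 < normc a by rewrite lt_def normc_ge0 normc_eq0 a0.
  have La := (scaleL a f Lf).1; have [_] := scaleL a^-1 _ La.
  rewrite (_ : (fun x => _) = f); last by apply/funext => x; rewrite mulrA mulVf// mul1r.
  by rewrite normcV ler_pdivlMl.
- move=> u Lu cau; have [|f mf Hf] := Loo_complete Lu.
    move=> e e0; have [N HN] := cau e e0; exists N => m n Nm Nn.
    have Lmn := LB _ _ (Lu m) (Lu n); apply: filterS (fnorm_Lpoo_ae Lmn) => x.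
    by move=> /le_trans; apply; apply/ltW/HN.
  have Bm n : cmeasurable (fun x => u n x - f x).
    have := cmeasurableD (Lu n).1 (cmeasurableZ (-1) mf).
    by congr cmeasurable; apply/funext => x; rewrite mulN1r.
  exists f.
    have [N /(_ N (leqnn N)) HN] := Hf 1 ltr01.
    have [LD _] := fnorm_Lpoo_le (Bm N) HN.
    have := LB _ _ (Lu N) LD; congr (fcarrier _ _).
    by apply/funext => x; ring.
  apply/cvgrPdist_le => e e0; have [N HN] := Hf e e0.
  exists N => // n Nn; rewrite sub0r normrN ger0_norm; last exact: fnorm_Lpoo_ge0.
  by have [] := fnorm_Lpoo_le (Bm n) (HN n Nn).
- exists (fun x => (\1_(cbox 1) x)%:C); last exact: indic_cbox_neq0.
  apply/LpooP; split; first by have [] := @indic_L1loc R d _ (@measurable_cbox R d 1).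
  exists 1; apply: nearW => x; rewrite normc_real indicE.
  by case: (_ \in _); rewrite ?normr1 ?normr0.
- by move=> K cK; exists (fine (mu K)) => f; exact: K_le.
- by move=> x f Lf; exact: (transL x f Lf).1.
- by exists 1 => // x f Lf; rewrite mul1r; exact: (transL x f Lf).2.
- move=> f g Lf Lg; have /Lp1P[mg Ig] := Lg.
  apply: fnorm_Lpoo_le; first exact: cmeasurable_convolution Lf.1 mg.
  apply: nearW => x; rewrite -lee_fin EFinM fnorm_Lp1E//.
  apply: le_trans (normc_convolution_le _ Lf.1 mg) _.
  rewrite -lintegralZl; [|exact: lmeasurable_normc|by move=> ?; rewrite normc_ge0|exact: fnorm_Lpoo_ge0].
  apply: ae_le_integral_any; [by move=> y _; rewrite lee_fin mulr_ge0 ?normc_ge0|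
    by move=> y _; rewrite lee_fin mulr_ge0 ?normc_ge0 ?fnorm_Lpoo_ge0|].
  apply: filterS (ae_reflect x (fnorm_Lpoo_ae Lf)) => y fy.
  by rewrite lee_fin ler_wpM2r ?normc_ge0.
- move=> f g Lf [mg _] gf; apply: fnorm_Lpoo_le => //.
  by apply: filterS2 gf (fnorm_Lpoo_ae Lf) => x; exact: le_trans.
Qed.

End Loo_solid.

(** * Necessity of condition (N) *)

Section gliding_hump.
Context {R : realType} {d : nat}.
Local Notation X := 'rV[R]_d.
Local Notation mu := (@lebesgue_rV R d).
Variable W : nat -> X -> R.
Hypotheses (hW : weight_function_system W).

Lemma weight_inv_lmeasurable n : lmeasurable (fun x => (W n x)^-1).
Proof.
have -> : (fun x => (W n x)^-1) = (fun x => expR (- ln (W n x))).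
  by apply/funext => x; rewrite expRN lnK// posrE weight_gt0.
have := @lmeasurable_comp2 R d (fun p => expR (- ln p.1)) (W n) (W n); apply; last 2 first.
- exact: weight_lmeasurable.
- exact: weight_lmeasurable.
apply: measurableT_comp; first exact: measurable_expR.
apply: measurableT_comp => //; apply: measurableT_comp; first exact: measurable_ln.
exact: measurable_fst.
Qed.

Lemma cboxS (r r' : R) : r <= r' -> @cbox R d r `<=` cbox r'.
Proof. by move=> rr' x xr i; exact: le_trans (xr i) rr'. Qed.

Lemma cbox_nat_cover (x : X) : exists k : nat, cbox k%:R x.
Proof.
exists (Num.truncn `|x|).+1 => i; apply: le_trans (rV_entry_le _ _) _.
by apply/ltW/truncnS_gt.
Qed.

(** If every annulus outside the box of radius k had integral below 1, monotone convergence along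
    growing boxes would bound the whole integral by the one over that box plus 1. *)
Lemma annulus_ge1 (Q : X -> R) (k : nat) : measurable_fun setT Q -> (forall x, 0 <= Q x) ->
  (\int[mu]_(x in cbox k%:R) (Q x)%:E < +oo)%E -> (\int[mu]_x (Q x)%:E = +oo)%E ->
  exists2 j, (k < j)%N & (1 <= \int[mu]_(x in cbox j%:R `\` cbox k%:R) (Q x)%:E)%E.
Proof.
move=> mQ Q0 Ik Ioo; apply: contrapT => H.
have mQD (D : set X) : measurable_fun D (fun x => (Q x)%:E).
  by apply: measurable_funTS; exact/measurable_EFinP.
have mc (r : R) : measurable (@cbox R d r) by exact: measurable_cbox.
have le j : (\int[mu]_(x in cbox j%:R) (Q x)%:E <= \int[mu]_(x in cbox k%:R) (Q x)%:E + 1)%E.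
  apply: (@le_trans _ _ (\int[mu]_(x in cbox (maxn j k.+1)%:R) (Q x)%:E)%E).
    apply: ge0_subset_integral_any => [x _|]; first by rewrite lee_fin.
    by apply: cboxS; rewrite ler_nat leq_maxl.
  have kj : (k < maxn j k.+1)%N by rewrite leq_maxr.
  rewrite -(@setDUK _ (cbox k%:R) (cbox (maxn j k.+1)%:R)); last first.
    by apply: cboxS; rewrite ler_nat ltnW.
  rewrite ge0_integral_setU//; last 3 first.
  - exact: measurableD.
  - by move=> x _; rewrite lee_fin.
  - by apply/eqP; rewrite setDIK.
  rewrite leeD2l// leNgt; apply/negP => /ltW H1.
  by apply: H; exists (maxn j k.+1).
suff : (\int[mu]_x (Q x)%:E <= \int[mu]_(x in cbox k%:R) (Q x)%:E + 1)%E.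
  by rewrite Ioo leye_eq => /eqP E; move: Ik; rewrite -(@lteD2rE _ 1%E)// E.
have <- : \bigcup_(j : nat) (@cbox R d j%:R) = setT.
  by apply/seteqP; split => // x _; have [j xj] := cbox_nat_cover x; exists j.
have nd : nondecreasing_seq (fun j : nat => @cbox R d j%:R).
  by move=> i j ij; apply/subsetPset; apply: cboxS; rewrite ler_nat.
have cv := @ge0_nondecreasing_set_cvg_integral _ _ _ _ _ mu nd (fun i => mc _) (fun i => mQD _)
  (fun i x _ => Q0 x).
rewrite -(cvg_lim _ cv)//; apply: lime_le; first by apply/cvg_ex; eexists; exact: cv.
exact: nearW.
Qed.

(* g is 1 / W (n + m) on the m-th of a sequence of disjoint annuli, each chosen so
   large that W n / W (n + m) has integral at least 1 on it. *)
Lemma gliding_hump n :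
  (forall m, (n <= m)%N -> (\int[mu]_x (W n x / W m x)%:E = +oo)%E) ->
  exists g : X -> R, [/\ lmeasurable g, forall x, 0 <= g x,
    forall k, exists M, forall x, g x * W k x <= M &
    (\int[mu]_x (g x * W n x)%:E = +oo)%E].
Proof.
move=> Hoo.
have /choice[Q HQ] : forall m, exists h : X -> R, [/\ measurable_fun setT h,
    forall x, 0 <= h x & \forall x \ae mu, W n x / W (n + m) x = h x].
  move=> m; have [h mh Hh] := ratio_lmeasurable hW n (n + m); exists (fun x => `|h x|); split => //.
    exact: measurableT_comp.
  by apply: filterS Hh => x <-; rewrite ger0_norm// ltW// (ratio_gt0 hW).
have mQ m : measurable_fun setT (Q m) by have [] := HQ m.
have Q0 m x : 0 <= Q m x by have [] := HQ m.
have IQoo m : (\int[mu]_x (Q m x)%:E = +oo)%E.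
  rewrite -(Hoo (n + m)%N (leq_addr _ _)); apply: integral_ae_any.
  by have [_ _] := HQ m; apply: filterS => x ->.
have IQfin m (k : nat) : (\int[mu]_(x in cbox k%:R) (Q m x)%:E < +oo)%E.
  apply: (@le_lt_trans _ _ (\int[mu]_(x in cbox k%:R) (cst 1%E) x)%E).
    apply: ae_le_integral_any => [x _|x _|]; rewrite ?lee_fin//.
    have [_ _] := HQ m; apply: filterS => x <-; rewrite lee_fin ler_pdivrMr ?(weight_gt0 hW)// mul1r.
    by apply: (weight_mono hW); exact: leq_addr.
  by rewrite integral_cst ?mul1e ?lebesgue_cbox_lty//; exact: measurable_cbox.
have /choice[nxt Hnxt] : forall m, exists f : nat -> nat, forall k, (k < f k)%N /\
    (1 <= \int[mu]_(x in cbox (f k)%:R `\` cbox k%:R) (Q m x)%:E)%E.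
  move=> m; have /choice[f Hf] : forall k : nat, exists j, (k < j)%N /\
      (1 <= \int[mu]_(x in cbox j%:R `\` cbox k%:R) (Q m x)%:E)%E.
    by move=> k; have [j ? ?] := annulus_ge1 (mQ m) (Q0 m) (IQfin m k) (IQoo m); exists j.
  by exists f.
(* The radii are chosen recursively: s (m+1) is large enough, given s m, for the m-th annulus to
   have integral at least 1 for the m-th ratio. *)
pose s := nat_rect (fun=> nat) 0%N (fun m sm => nxt m sm).
have sS m : (s m < s m.+1)%N by exact: (Hnxt m (s m)).1.
have ms m : (m <= s m)%N by elim: m => // m IH; exact: leq_ltn_trans IH (sS m).
have smono m m' : (m <= m')%N -> (s m <= s m')%N.
  by move=> /subnK<-; elim: (m' - m)%N => [//|i IH]; rewrite addSn (leq_trans IH)// ltnW.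
pose C m : set X := cbox (s m)%:R.
have mC m : measurable (C m) by exact: measurable_cbox.
have CS m m' : (m <= m')%N -> C m `<=` C m' by move=> mm'; apply: cboxS; rewrite ler_nat smono.
have exC x : exists m, `[< C m x >].
  by have [k xk] := cbox_nat_cover x; exists k; apply/asboolP; apply: cboxS xk; rewrite ler_nat.
pose idx x := ex_minn (exC x).
have idxE x m : (idx x <= m)%N <-> C m x.
  rewrite /idx; case: ex_minnP => j /asboolP Cj jmin; split => [jm|Cm].
    exact: CS jm _ Cj.
  by apply: jmin; exact/asboolP.
have idx0 x : idx x = 0%N <-> C 0%N x.
  by rewrite -idxE leqn0; split => [->//|/eqP].
have idxS x m : idx x = m.+1 <-> (C m.+1 `\` C m) x.
  rewrite /setD/= -!idxE; split => [->|[]]; first by rewrite ltnn.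
  by move=> le /negP; rewrite -ltnNge => lt; apply/eqP; rewrite eqn_leq le.
(* A point of C (m+1) outside C m has index m + 1 and uses F m; the innermost box C 0 has index 0
   and also uses F 0. *)
pose glue (F : nat -> X -> R) x := F (idx x).-1 x.
have mglue F : (forall m, measurable_fun setT (F m)) -> measurable_fun setT (glue F).
  move=> mF _ Y mY; rewrite setTI.
  rewrite (_ : _ @^-1` _ = \bigcup_m ([set x | idx x = m] `&` F m.-1 @^-1` Y)); last first.
    apply/seteqP; split => [x Yx|x [m _ [<-]]//]; by exists (idx x).
  apply: bigcupT_measurable => m; apply: measurableI; last first.
    by rewrite -[X in measurable X]setTI; exact: mF.
  case: m => [|m].
    by rewrite (_ : [set _ | _] = C 0%N)//; apply/seteqP; split => x /idx0.
  rewrite (_ : [set _ | _] = C m.+1 `\` C m); first exact: measurableD.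
  by apply/seteqP; split => x /idxS.
pose g := glue (fun m x => (W (n + m) x)^-1).
have g0 x : 0 <= g x by rewrite /g/glue invr_ge0 ltW// (weight_gt0 hW).
exists g; split => //.
- have /choice[P HP] : forall m, exists h : X -> R, measurable_fun setT h /\
      \forall x \ae mu, (W (n + m) x)^-1 = h x.
    by move=> m; have [h ? ?] := weight_inv_lmeasurable (n + m); exists h.
  exists (glue P); first by apply: mglue => m; exact: (HP m).1.
  by have := ae_foralln (fun m => (HP m).2); apply: filterS => x H; exact: H.
(* If n plus the number of the annulus reaches k, monotonicity gives g W k <= 1. Otherwise x lies in
   C k, where W k is bounded and g <= 1. *)
- move=> k; have [M HM] := weight_bounded (s k)%:R (hW.1 k).
  exists (Num.max 1 M) => x; rewrite le_max /g/glue mulrC.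
  have [kn|nk] := leqP k (n + (idx x).-1).
    by rewrite ler_pdivrMr ?(weight_gt0 hW)// mul1r (weight_mono hW).
  apply/orP; right; have xk : C k x.
    apply/idxE; move: nk; case: (idx x) => //= j; apply: leq_ltn_trans; exact: leq_addl.
  apply: le_trans (HM x xk); rewrite ler_pdivrMr ?(weight_gt0 hW)//.
  by rewrite ler_peMr ?(weight_ge1 hW)// ltW// (weight_gt0 hW).
- rewrite (@integral_ae_any _ _ _ mu setT _ (fun x => (glue Q x)%:E)); last first.
    have := ae_foralln (fun m => let: And3 _ _ H := HQ m in H); apply: filterS => x H.
    by rewrite /glue -H /g /glue mulrC.
  have mG := mglue _ mQ.
  (* Each annulus contributes at least 1, so the integral over C M is at least M. *)
  have key M : ((M%:R)%:E <= \int[mu]_(x in C M) (glue Q x)%:E)%E.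
    elim: M => [|M IH]; first by apply: integral_ge0 => x _; rewrite lee_fin Q0.
    rewrite -(@setDUK _ (C M) (C M.+1)); last exact: CS.
    rewrite ge0_integral_setU//; last 4 first.
    - exact: measurableD.
    - by apply: measurable_funTS; exact/measurable_EFinP.
    - by move=> x _; rewrite lee_fin Q0.
    - by apply/eqP; rewrite setDIK.
    rewrite -[X in X%:R]addn1 natrD EFinD; apply: leeD => //.
    have -> : (\int[mu]_(x in C M.+1 `\` C M) (glue Q x)%:E =
      \int[mu]_(x in C M.+1 `\` C M) (Q M x)%:E)%E.
      by apply: eq_integral => x; rewrite inE => /idxS xM; rewrite /glue xM.
    exact: (Hnxt M (s M)).2.
  apply/eqyP => r r0; have [N rN] : exists N : nat, r <= N%:R.
    by exists (Num.truncn r).+1; apply/ltW/truncnS_gt.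
  apply: (@le_trans _ _ (N%:R)%:E); first by rewrite lee_fin.
  apply: le_trans (key N) _; apply: ge0_subset_integral_any => // x _; by rewrite lee_fin Q0.
Qed.

End gliding_hump.

(** * Smoothing the hump, and recovering (N) *)

Section mollified_hump.
Context {R : realType} {d : nat}.
Local Notation X := 'rV[R]_d.
Local Notation mu := (@lebesgue_rV R d).
Local Notation Re := (@complex.Re R).
Local Notation Im := (@complex.Im R).
Implicit Types (g h : X -> R[i]) (u v w : X -> R) (s : seq 'I_d) (psi : testfun R d).

Lemma regular_pairing h psi : L1loc h ->
  regular h psi = pairing h (Re \o psi) + 'i%C * pairing h (Im \o psi).
Proof.
move=> /L1loc_repr[h' [ch Lh hh']].
rewrite (regular_ae hh') !(@pairing_ae _ _ h' h); [|by apply: filterS hh' => x ->..].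
have bR := rtest_bcs (testfun_Re psi); have bI := rtest_bcs (testfun_Im psi).
have cR := cintegrable_pairing ch Lh bR; have cI := cintegrable_pairing ch Lh bI.
rewrite /pairing -cintegralZl// -cintegralD//; last exact: cintegrableZl.
congr cintegral; apply/funext => x /=; rewrite mulrCA -mulrDr; congr (_ * _).
by case: (psi x) => a b; apply: complex_eqP; rewrite /=; ring.
Qed.

(** Once the convolution is transposed by [pairing_Kint], this is integration by parts for u against
    a translate of v, at every point x. *)
Lemma pairing_conv_rpderiv g i u v : L1loc g -> rtest u -> rtest v ->
  pairing (convolution g (fun x => (u x)%:C)) (rpderiv i v) =
  - pairing (convolution g (fun x => (rpderiv i u x)%:C)) v.
Proof.
move=> Lg tu tv; have tu' := rtest_rpderiv i tu; have tv' := rtest_rpderiv i tv.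
have bK := rtest_bcs (Kint_rtest [::] (rtest_bcs tu') tv).1.
rewrite -(pairing_Kint Lg (rtest_bcs tu) tv') -(pairing_Kint Lg (rtest_bcs tu') tv).
rewrite -[RHS]mulN1r -(pairingZ (-1) Lg bK).
congr cintegral; apply/funext => x; rewrite mulN1r mulNr -mulrN; congr (_ * _).
rewrite -rmorphN; congr (_%:C).
have := rtest_ibp i tu (rtest_translate x tv); rewrite rpderiv_translate.
have E w' w : Kint w' w x = \int[mu]_y (w' y * w (y + x)).
  by apply: eq_Rintegral => y _; rewrite addrC.
by rewrite !E => ->; rewrite opprK.
Qed.

Lemma regular_conv_pderiv g i u psi : L1loc g -> rtest u ->
  regular (convolution g (fun x => (u x)%:C)) (tf_pderiv i psi) =
  - regular (convolution g (fun x => (rpderiv i u x)%:C)) psi.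
Proof.
move=> Lg tu; have tu' := rtest_rpderiv i tu.
have Lc v : rtest v -> L1loc (convolution g (fun x => (v x)%:C)).
  by move=> tv; apply: L1loc_convolution => //; exact: rtest_bcs.
rewrite !regular_pairing; [|exact: Lc..].
rewrite [X in pairing _ X]/(rpderiv i (Re \o psi)) [X in 'i%C * pairing _ X]/(rpderiv i (Im \o psi)).
rewrite !pairing_conv_rpderiv//; [|exact: testfun_Im|exact: testfun_Re].
by rewrite mulrN opprD.
Qed.

Lemma regular_conv_pderivs g u psi s : L1loc g -> rtest u ->
  regular (convolution g (fun x => (u x)%:C)) (foldr tf_pderiv psi s) =
  (-1) ^+ size s * regular (convolution g (fun x => (rD (rev s) u x)%:C)) psi.
Proof.
move=> Lg; elim: s u => [|i s IH] u tu; first by rewrite mul1r.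
rewrite [foldr _ _ _]/= regular_conv_pderiv// IH; last exact: rtest_rpderiv.
by rewrite rev_cons /rD foldr_rcons [size _]/= exprS -mulrA mulN1r.
Qed.

(** All derivatives fall on u, so g may be rough. The list is reversed because the outermost
    derivative of the test function is the first to be moved; the signs cancel with that of
    [dderiv]. *)
Lemma dderiv_conv g u n (a : mindex d n) : L1loc g -> rtest u ->
  dderiv a (regular (convolution g (fun x => (u x)%:C))) =
  regular (convolution g (fun x => (rD (rev (mseq a)) u x)%:C)).
Proof.
move=> Lg tu; apply/funext => psi; rewrite /dderiv tf_mderivE regular_conv_pderivs// size_mseq.
by rewrite mulrA -exprMn mulrNN mulr1 expr1n mul1r.
Qed.

Variable W : nat -> X -> R.
Hypotheses (hW : weight_function_system W) (hM : condition_wM W).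

Section bounded_hump.
Variables (g : X -> R).
Hypotheses (mg : lmeasurable g) (g0 : forall x, 0 <= g x)
  (gW : forall k, exists M, forall x, g x * W k x <= M).

Let gc x : R[i] := (g x)%:C.

Let g_bound : exists2 M, 0 <= M & forall x, g x <= M.
Proof.
have [M HM] := gW 0; exists M; last first.
  by move=> x; apply: le_trans (HM x); rewrite ler_peMr// (weight_ge1 hW).
by apply: le_trans (HM 0); rewrite mulr_ge0// ltW// (weight_gt0 hW).
Qed.

Lemma L1loc_bounded_real : L1loc gc.
Proof.
apply: L1loc_bounded; first exact: cmeasurable_real.
have [M M0 HM] := g_bound; move=> q; exists M => x _.
by rewrite normc_real ger0_norm.
Qed.

(** Every derivative is g convolved with a derivative v of u, still supported in the box of (wM).
    There W k x <= C W m (x - y), so boundedness of g W m passes to the convolution times W k. *)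
Lemma conv_hump_Loo u : rtest u -> (forall x, u x != 0 -> cbox (@rad R d) x) ->
  EinfW (Lp_space R d +oo%E) W (regular (convolution gc (fun x => (u x)%:C))).
Proof.
move=> tu ur k _; have Lg := L1loc_bounded_real.
have Lc v : rtest v -> L1loc (convolution gc (fun x => (v x)%:C)).
  by move=> tv; apply: L1loc_convolution => //; exact: rtest_bcs.
split; first exact/distribution_regular/Lc.
move=> a ak; pose v := rD (rev (mseq a)) u; have tv : rtest v by exact: rtest_rD.
have vr : forall x, v x != 0 -> cbox (@rad R d) x by exact: rD_support.
exists (convolution gc (fun x => (v x)%:C)); split; [exact: Lc|exact: dderiv_conv|].
have [mc _] := L1loc_mul_weight (hW.1 k) (Lc v tv).
have [m [C [km C0 HC]]] := weight_moderate hM k; have [M HM] := gW m.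
have [B B0 HB] := rtest_bound tv.
have M0 : 0 <= M by apply: le_trans (HM 0); rewrite mulr_ge0// ltW// (weight_gt0 hW).
pose V := fine (mu (cbox (@rad R d))).
have EV : mu (cbox (@rad R d)) = V%:E by rewrite fineK// ge0_fin_numE// lebesgue_cbox_lty.
apply/LpooP; split => //; exists (C * M * B * V); apply: nearW => x.
rewrite normcM normc_real ger0_norm ?(ltW (weight_gt0 hW _ _))//.
rewrite -ler_pdivlMr ?(weight_gt0 hW)// -lee_fin.
apply: le_trans (normc_convolution_le _ (cmeasurable_real mg) (cmeasurable_real (borel_lmeasurable (rtest_measurable tv)))) _.
apply: (@le_trans _ _ (\int[mu]_y ((C * M * B / W k x)%:E * (\1_(cbox (@rad R d)) y : R)%:E))%E).
  apply: ge0_le_integral_any => y _; first by rewrite lee_fin mulr_ge0// normc_ge0.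
  rewrite -EFinM lee_fin !normc_real (ger0_norm (g0 _)) indicE.
  have [->|vy] := eqVneq (v y) 0.
    rewrite normr0 mulr0 mulr_ge0// divr_ge0 ?(ltW (weight_gt0 hW _ _))// !mulr_ge0//; exact: ltW.
  rewrite mem_set ?mulr1; last exact: vr.
  rewrite ler_pdivlMr ?(weight_gt0 hW)//.
  have := HC (x - y) y (vr _ vy); rewrite subrK => Wx.
  have gWx : g (x - y) * W k x <= C * M.
    apply: (@le_trans _ _ (g (x - y) * (C * W m (x - y)))); first exact: ler_wpM2l.
    by rewrite mulrCA ler_wpM2l ?(ltW C0).
  rewrite mulrAC; apply: ler_pM => //; first by rewrite mulr_ge0// ltW// (weight_gt0 hW).
rewrite ge0_integralZl//; last 2 first.
- by apply/measurable_EFinP; exact: measurable_cbox_indic.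
- by rewrite lee_fin divr_ge0 ?(ltW (weight_gt0 hW _ _))// !mulr_ge0//; exact: ltW.
rewrite integral_indic//; last exact: measurable_cbox.
by rewrite setIT [X in (_ * X)%E]EV -EFinM lee_fin mulrAC.
Qed.

(** The reverse use of (wM): (g W n) convolved with u is at most C W m times (g convolved with u),
    an integrable function. By Tonelli its integral is that of g W n times that of u, and the latter
    is positive. *)
Lemma conv_hump_L1 n u : rtest u -> (forall x, u x != 0 -> cbox (@rad R d) x) ->
  (forall x, 0 <= u x) -> (0 < \int[mu]_x (u x)%:E)%E ->
  EinfW (Lp_space R d 1) W (regular (convolution gc (fun x => (u x)%:C))) ->
  (\int[mu]_x (g x * W n x)%:E < +oo)%E.
Proof.
move=> tu ur u0 Iu Ef; have Lg := L1loc_bounded_real.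
have [m [C [nm C0 HC]]] := weight_moderate hM n.
have [_ /(_ (mx m [::]))] : EnW _ m (W m) _ := Ef m Logic.I.
rewrite mdeg_mx// => /(_ isT)[h [Lh]]; rewrite dderiv0 => fh hW1.
have Lc : L1loc (convolution gc (fun x => (u x)%:C)).
  by apply: L1loc_convolution => //; exact: rtest_bcs.
(* Membership only provides some density h; uniqueness identifies it with the convolution almost
   everywhere. *)
have ch := regular_inj Lc Lh fh; have /Lp1P[_ Ih] := hW1.
have [G mG GE] : lmeasurable (fun x => g x * W n x).
  apply: (@lmeasurable_comp2 R d (fun p => p.1 * p.2)) => //; last exact: (weight_lmeasurable hW).
  by apply: measurable_funM; [exact: measurable_fst|exact: measurable_snd].
pose F x := `|G x|; have mF : measurable_fun setT F by exact: measurableT_comp.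
have FE : \forall x \ae mu, g x * W n x = F x.
  by apply: filterS GE => x; rewrite /F => <-; rewrite ger0_norm// mulr_ge0// ltW// (weight_gt0 hW).
have F0 x : 0 <= F x by exact: normr_ge0.
have mu_ : measurable_fun setT u by exact: rtest_measurable.
rewrite (@integral_ae_any _ _ _ mu setT _ (fun x => (F x)%:E)); last by apply: filterS FE => x ->.
rewrite ltNge leye_eq; apply/negP => /eqP IF.
have [M M0 HM] := g_bound.
have mgx x : lmeasurable (fun y => g (x - y) * u y).
  apply: (@lmeasurable_comp2 R d (fun p => p.1 * p.2)) => //.
  - by apply: measurable_funM; [exact: measurable_fst|exact: measurable_snd].
  - exact: lmeasurable_reflect.
  - exact: borel_lmeasurable.
have low x : ((\int[mu]_y (F (x - y) * u y)%:E) <=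
    (C * (normc (convolution gc (fun x => (u x)%:C) x) * W m x))%:E)%E.
  have Tfin : (\int[mu]_y (g (x - y) * u y)%:E < +oo)%E.
    have /integrableP[_ Iu'] := bcs_integrable (bcsZ M (rtest_bcs tu)).
    apply: le_lt_trans Iu'; apply: ge0_le_integral_any => y _; first by rewrite lee_fin mulr_ge0.
    by rewrite /= ger0_norm ?mulr_ge0// lee_fin ler_wpM2r.
  have T0 : (0 <= \int[mu]_y (g (x - y) * u y)%:E)%E.
    by apply: integral_ge0 => y _; rewrite lee_fin mulr_ge0.
  apply: (@le_trans _ _ (\int[mu]_y ((C * W m x) * (g (x - y) * u y))%:E)%E).
    apply: ae_le_integral_any => [y _|y _|].
    - by rewrite lee_fin mulr_ge0.
    - by rewrite lee_fin !mulr_ge0 ?(ltW C0) ?(ltW (weight_gt0 hW _ _)).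
    apply: filterS (ae_reflect x FE) => y <-; rewrite lee_fin.
    have [->|uy] := eqVneq (u y) 0; first by rewrite !mulr0.
    rewrite mulrA ler_wpM2r// [leRHS]mulrC ler_wpM2l//; apply: HC.
    by move=> i; rewrite mxE normrN; exact: ur.
  rewrite lintegralZl//; last 2 first.
  - by move=> y; rewrite mulr_ge0.
  - by rewrite mulr_ge0 ?(ltW C0) ?(ltW (weight_gt0 hW _ _)).
  rewrite -[X in (_ * X)%E]fineK ?ge0_fin_numE// -EFinM lee_fin -mulrA ler_wpM2l ?(ltW C0)//.
  rewrite mulrC ler_wpM2r ?(ltW (weight_gt0 hW _ _))//.
  by apply: convolution_real_ge => //; rewrite fineK// ge0_fin_numE.
have : (\int[mu]_x \int[mu]_y (F (x - y) * u y)%:E < +oo)%E.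
  apply: (@le_lt_trans _ _ (\int[mu]_x (C * normc (mul_weight h (W m) x))%:E)%E); last first.
    rewrite lintegralZl ?(ltW C0)//; last by move=> x; rewrite normc_ge0.
      by rewrite lte_mul_pinfty// lee_fin ltW.
    by apply: lmeasurable_normc; have /Lp1P[] := hW1.
  apply: ae_le_integral_any => [x _|x _|].
  - by apply: integral_ge0 => y _; rewrite lee_fin mulr_ge0.
  - by rewrite lee_fin mulr_ge0 ?normc_ge0 ?(ltW C0).
  apply: filterS ch => x hx; apply: le_trans (low x) _.
  by rewrite hx /mul_weight normcM normc_real ger0_norm ?(ltW (weight_gt0 hW _ _)).
rewrite (fubini_tonelli (fun p : X * X => (F (p.1 - p.2) * u p.2)%:E))/=; last 2 first.
- apply/measurable_EFinP; apply: measurable_funM.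
    by apply: (measurableT_comp mF); apply: measurable_rV_sub; [exact: measurable_fst|exact: measurable_snd].
  exact: (measurableT_comp mu_ measurable_snd).
- by move=> p; rewrite lee_fin mulr_ge0.
rewrite (eq_integral (fun y => +oo * (u y)%:E)%E); last first.
  move=> y _; rewrite -IF -(lintegral_translate (f := F) (- y) (borel_lmeasurable mF) F0).
  rewrite muleC -ge0_integralZl//; last 3 first.
  - apply/measurable_EFinP; exact: (measurableT_comp mF (measurable_translate (- y))).
  - by move=> x _; rewrite lee_fin.
  - by rewrite lee_fin.
  by apply: eq_integral => x _; rewrite -EFinM mulrC.
rewrite ge0_integralZl//; last 2 first.
- exact/measurable_EFinP.
- by move=> y _; rewrite lee_fin.
by rewrite gt0_mulye.
Qed.
End bounded_hump.

Lemma N_of_Loo_sub_L1 :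
  EinfW (Lp_space R d +oo%E) W `<=` EinfW (Lp_space R d 1) W -> condition_N W.
Proof.
move=> sub n; apply: contrapT => Hn.
have [|g [mg g0 gW Ioo]] := @gliding_hump R d W hW n.
  move=> m nm; apply: contrapT => Im; apply: Hn; exists m => //.
  apply/Lp1P; split; first exact: ratio_cmeasurable.
  rewrite ltey; apply/eqP => H; apply: Im; rewrite -[RHS]H; apply: eq_integral => x _.
  by rewrite normc_real ger0_norm// ltW// ratio_gt0.
(* The bump is nonnegative and supported in the box where (wM) is available, as both convolution
   estimates require. *)
pose u : X -> R := bump 0 (fun=> - @rad R d) (fun=> @rad R d).
have tu : rtest u by exact: rtest_bump.
have ur x : u x != 0 -> cbox (@rad R d) x.
  by move=> /bump_neq0 H i; have := H i; rewrite ler_norml => /andP[/ltW-> /ltW->].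
have u0 x : 0 <= u x by exact: bump_ge0.
have mu_ := rtest_measurable tu.
have Iu : (0 < \int[mu]_x (u x)%:E)%E.
  rewrite lt_def integral_ge0 ?andbT; last by move=> x _; rewrite lee_fin.
  (* A vanishing integral would make u zero almost everywhere, but u is positive on the concentric
     box of half the radius, which is not a null set. *)
  apply/eqP => I0; have r2 : 0 < @rad R d / 2 by rewrite divr_gt0// rad_gt0.
  apply: (@indic_cbox_neq0 R d _ r2).
  have /(ae_eq_integral_abs mu measurableT) : measurable_fun setT (fun x => (u x)%:E) by exact/measurable_EFinP.
  have -> : (\int[mu]_x `|(u x)%:E| = 0)%E.
    by rewrite -[RHS]I0; apply: eq_integral => x _; rewrite gee0_abs// lee_fin.
  move=> [/(_ erefl) H _]; apply: filterS H => x /(_ Logic.I) [] ux.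
  rewrite indicE; case: (boolP (_ \in _)) => // /set_mem xr; exfalso.
  suff : 0 < u x by rewrite ux ltxx.
  apply: bump_gt0 => i; have := xr i; rewrite ler_norml => /andP[H1 H2].
  have := @rad_gt0 R d => r0; apply/andP; split; lra.
have cLoo := conv_hump_Loo mg g0 gW tu ur.
have := conv_hump_L1 mg g0 gW n tu ur u0 Iu (sub _ cLoo).
by rewrite Ioo ltxx.
Qed.

End mollified_hump.

Theorem theorem4p8 (R : realType) (d : nat) (W : nat -> 'rV[R]_d -> R)
    (hW : weight_function_system W) (hM : condition_wM W) :
  [<-> condition_N W ;
       forall E F : normed_fspace R d,
         solid_TIBF_bounded_type E -> solid_TIBF_bounded_type F ->
         EinfW E W = EinfW F W ;
       forall E F : normed_fspace R d,
         solid_TIBF_bounded_type E -> solid_TIBF_bounded_type F ->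
         eq_Frechet E F W ;
       EinfW (Lp_space R d 1) W = EinfW (Lp_space R d +oo) W ;
       eq_Frechet (Lp_space R d 1) (Lp_space R d +oo) W ].
Proof.
have s1 := @Lp_space1_solid R d; have soo := @Lp_spaceoo_solid R d.
have N_of_eq : EinfW (Lp_space R d 1) W = EinfW (Lp_space R d +oo) W -> condition_N W.
  by move=> eq1oo; apply: N_of_Loo_sub_L1 => //; rewrite eq1oo.
(* In the cycle, each step ending in an equality of Frechet spaces first recovers (N) from the pair
   L^1, L^oo and then applies [N_eq_Frechet]. *)
tfae.
- by move=> N E F sE sF; exact: (N_eq_Frechet hW hM N sE sF).1.
- by move=> eqEF E F sE sF; apply: N_eq_Frechet => //; apply: N_of_eq; exact: eqEF.
- by move=> eqEF; exact: (eqEF _ _ s1 soo).1.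
- by move=> eq1oo; apply: N_eq_Frechet => //; exact: N_of_eq.
- by move=> [eq1oo _]; exact: N_of_eq.
Qed.
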